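(* Let $N\ge 1$ and $m\ge 1$ be integers and let $a>m-1$ be a real number such that $\exp(-i\pi/a)$ is not a root of unity. Let $\Phi_N(a,m;x,y)$ be the function defined by the recursive integral formula in the context, and let $\psi_N(q,M;x,y)$ be the self-dual Baker--Akhiezer function described in the context. Then, for all $x,y\in\mathbb{R}^N$ with $x_j\ne x_k$ and $y_j\neq y_k$ for $1\le j<k\le N$, $$\Phi_N(a,m;x,y)= C_N(a,m)\,\frac{\sum_{\sigma\in S_N}\operatorname{sgn}(\sigma)\, \psi_N\big(e^{-i\pi/a},m-1;i\sigma(x),iy\big)}{\prod_{1\leq j<k\leq N}\Big(2\sinh\big(\pi(y_j-y_k)\big)\prod_{n=-m+1}^{m-1}2\sinh\big(\frac{\pi}{a}(x_k-x_j+in)\big)\Big)}$$ with the constant $$C_N(a,m) = (i^m)^{N(N-1)/2}\left(\frac{a}{\prod_{n=1}^{m-1}2\sin(\pi n/a)}\right)^{(N-1)(N-2)/2}.$$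
   Context: Empty products equal $1$; $(u,v)=\sum_j u_jv_j$ (bilinear); $\sigma(x)$ denotes $x$ with coordinates permuted by $\sigma\in S_N$. **The functions $\Phi_N$.** For $m\in\{1,2,\ldots\}$ and $a>m-1$, the functions $\Phi_N(x,y)=\Phi_N(a,m;x,y)$, $x,y\in\mathbb{R}^N$, are defined recursively by $\Phi_1(x,y)=\exp\left(\frac{2\pi i}{a}xy\right)$ and, for $N\geq 2$, $$\Phi_N(x,y) = \frac{\prod_{n=1}^{m-1}2\sin(\pi n/a)}{a\,(N-1)!}\,e^{\frac{2\pi i}{a}y_N(x_1+\cdots+x_N)}\int_{\mathbb{R}^{N-1}}dz\,\frac{W_{N-1}(z)\,\Phi_{N-1}\big(z,(y_1-y_N,\ldots,y_{N-1}-y_N)\big)}{\prod_{j=1}^N\prod_{k=1}^{N-1}\prod_{n=0}^{m-1}2\cosh\big(\frac{\pi}{a}(x_j-z_k+\frac{i}{2}(m-2n-1))\big)},$$ where $$W_{N-1}(z)=\prod_{1\leq j<k\leq N-1}2\sinh\left(\tfrac{\pi}{a}(z_k-z_j)\right)\prod_{n=-m+1}^{m-1} 2 \sinh\left(\tfrac{\pi}{a}(z_k-z_j+in)\right).$$ (These are the $b=m$, $(a_+,a_-)=(1,a)$ specialisations of suitably normalised symmetric joint eigenfunctions of the hyperbolic relativistic Calogero--Moser operators.) **The Baker--Akhiezer function.** Put $q=e^{-i\pi/a}$, $q^z:=e^{-i\pi z/a}$ for $z\in\mathbb{C}$, and $[z]=q^z-q^{-z}$. Let $M\ge 0$ be an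 integer and $e_1,\ldots,e_N$ the standard basis of $\mathbb{R}^N$. When $q$ is not a root of unity, $\psi_N(x,y)=\psi_N(q,M;x,y)$ is the (entire) function of $x,y\in\mathbb{C}^N$ uniquely characterised by: (i) $\psi_N(x,y) = q^{2(x,y)}\sum_\nu \psi_{N,\nu}(x)q^{2(\nu,y)}$, the sum running over the finite set of vectors of the form $\nu = \sum_{1\leq j<k\leq N}\left(\frac{M}{2}-l_{jk}\right)(e_j-e_k)$ with $l_{jk}\in\{0,\ldots,M\}$; (ii) for all $1\le j<k\le N$ and $s=1,\ldots,M$, $\psi_N(x,y+s(e_j-e_k)/2)=\psi_N(x,y-s(e_j-e_k)/2)$ whenever $q^{2(y_j-y_k)}=1$; (iii) for $\rho_N(M)=\frac{M}{2}\sum_{1\leq j<k\leq N}(e_j-e_k)$ one has $\psi_{N,\rho_N(M)}(x)=\prod_{1\leq j<k\leq N}\prod_{n=1}^M[n+x_k-x_j]$. For $M=0$ this gives $\psi_N(x,y)=q^{2(x,y)}$. The function is self-dual: $\psi_N(x,y)=\psi_N(y,x)$. *)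

(* Defs.v *)
From HB Require Import structures.
From mathcomp Require Import all_boot all_order all_algebra all_fingroup.
From mathcomp Require Import complex.
From mathcomp Require Import all_classical all_reals all_analysis.

Set Implicit Arguments.
Unset Strict Implicit.
Unset Printing Implicit Defensive.

Import Order.TTheory GRing.Theory Num.Theory.
Import numFieldNormedType.Exports.

Local Open Scope classical_set_scope.
Local Open Scope ring_scope.
Local Open Scope complex_scope.

Section ComplexFunctions.
Variable R : realType.
Implicit Types z : R[i].

Definition expC z : R[i] :=
  (expR (complex.Re z))%:C *
  (cos (complex.Im z) +i* sin (complex.Im z)).

Definition sinhC z : R[i] := (expC z - expC (- z)) / 2.

Definition coshC z : R[i] := (expC z + expC (- z)) / 2.

End ComplexFunctions.

Section LebesgueTuple.
Variable R : realType.

Definition tuple_cons n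
    (p : measurableTypeR R * n.-tuple (measurableTypeR R)) :
    n.+1.-tuple (measurableTypeR R) := [the n.+1.-tuple _ of p.1 :: p.2].

Lemma measurable_tuple_cons n : measurable_fun [set: _] (@tuple_cons n).
Proof. exact: measurable_cons. Qed.

Section Step.
Variables (n : nat)
  (m : {sigma_finite_measure set (n.-tuple (measurableTypeR R)) -> \bar R}).

Definition lebesgue_cons :
    set (n.+1.-tuple (measurableTypeR R)) -> \bar R :=
  pushforward (@lebesgue_measure R \x m)%E (@tuple_cons n).

Let lebesgue_cons0 : lebesgue_cons set0 = 0%E.
Proof. by rewrite /lebesgue_cons /pushforward preimage_set0 measure0. Qed.

Let measurable_preimage_cons A : measurable A -> measurable (@tuple_cons n @^-1` A).
Proof.
by move=> mA; rewrite -[X in measurable X]setTI; exact: measurable_tuple_cons.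
Qed.

Let lebesgue_cons_ge0 A : (0 <= lebesgue_cons A)%E.
Proof. by rewrite /lebesgue_cons /pushforward. Qed.

Let lebesgue_cons_sigma_additive : semi_sigma_additive lebesgue_cons.
Proof.
move=> F mF tF mUF; rewrite /lebesgue_cons /pushforward preimage_bigcup.
apply: measure_semi_sigma_additive.
- by move=> k; exact: measurable_preimage_cons.
- apply/trivIsetP => /= i j _ _ ij; rewrite -preimage_setI.
  by move/trivIsetP : tF => /(_ _ _ _ _ ij) ->//; rewrite preimage_set0.
- by rewrite -preimage_bigcup; exact: measurable_preimage_cons.
Qed.

HB.instance Definition _ := isMeasure.Build _ _ _ lebesgue_cons
  lebesgue_cons0 lebesgue_cons_ge0 lebesgue_cons_sigma_additive.

Let lebesgue_cons_sigma_finite : sigma_finite setT lebesgue_cons.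
Proof.
have /sigma_finiteP[F [FT ndF Foo]] := sigma_finiteT (@lebesgue_measure R).
have /sigma_finiteP[G [GT ndG Goo]] := sigma_finiteT m.
pose uncons (t : n.+1.-tuple (measurableTypeR R)) :
    measurableTypeR R * n.-tuple (measurableTypeR R) :=
  (thead t, [tuple of behead t]).
have unconsK : cancel (@tuple_cons n) uncons.
  by move=> [x t]; congr (_, _); apply: val_inj.
have muncons : measurable_fun [set: _] uncons.
  apply: measurable_fun_pair; first exact: measurable_tnth.
  exact: measurable_behead.
exists (fun k => uncons @^-1` (F k `*` G k)).
  rewrite -preimage_bigcup (_ : \bigcup_k (F k `*` G k) = setT) ?preimage_setT//.
  rewrite -setXTT FT GT predeqE => -[x y]; split.
    by move=> [k _ []/= ? ?]; split; exists k.
  move=> [/= [k _ Fkx] [l _ Gly]]; exists (maxn k l) => //; split.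
  - by move: x Fkx; exact/subsetPset/ndF/leq_maxl.
  - by move: y Gly; exact/subsetPset/ndG/leq_maxr.
move=> k; have [? ?] := Foo k; have [? ?] := Goo k; split.
  by rewrite -[X in measurable X]setTI; apply: muncons => //; exact: measurableX.
rewrite /lebesgue_cons /pushforward.
rewrite (_ : _ @^-1` _ = F k `*` G k).
  by rewrite product_measure1E// lte_mul_pinfty// ge0_fin_numE.
by apply/funext => p; rewrite /preimage/= -[in RHS](unconsK p).
Qed.

HB.instance Definition _ := Measure_isSigmaFinite.Build _ _ _ lebesgue_cons
  lebesgue_cons_sigma_finite.

End Step.

(* Lebesgue measure on R^n, carried by n-tuples with the product sigma-algebra:
   the n-fold product of the Lebesgue measure on R. *)
Fixpoint lebesgue_tuple n :
    {sigma_finite_measure set (n.-tuple (measurableTypeR R)) -> \bar R} :=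
  match n with
  | 0 => \d_ [tuple]
  | n'.+1 => lebesgue_cons (lebesgue_tuple n')
  end.

Definition rowt n (t : n.-tuple R) : 'rV[R]_n := \row_j tnth t j.

(* The integral over R^n of a complex-valued function, through its real and
   imaginary parts. *)
Definition integralC n (f : 'rV[R]_n -> R[i]) : R[i] :=
  Rintegral (lebesgue_tuple n) setT (fun t => complex.Re (f (rowt t))) +i*
  Rintegral (lebesgue_tuple n) setT (fun t => complex.Im (f (rowt t))).

End LebesgueTuple.

Section Phi.
Variables (R : realType) (a : R) (m : nat).

Definition sin_prod : R := \prod_(1 <= k < m) (2 * sin (pi * k%:R / a)).

(* \prod_{n = -m+1}^{m-1} 2 sinh (pi/a (t + i n)), with n = k - (m - 1) *)
Definition sinh_prod (t : R) : R[i] :=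
  \prod_(k < (m.*2).-1)
    (2 * sinhC ((pi / a)%:C * (t%:C + 'i * (k%:R - (m%:R - 1))))).

Definition W N (z : 'rV[R]_N) : R[i] :=
  \prod_(j < N) \prod_(k < N | (j < k)%N)
    (2 * sinhC ((pi / a * (z 0 k - z 0 j))%:C) * sinh_prod (z 0 k - z 0 j)).

Definition cosh_prod N N' (x : 'rV[R]_N) (z : 'rV[R]_N') : R[i] :=
  \prod_(j < N) \prod_(k < N') \prod_(n < m)
    (2 * coshC ((pi / a)%:C *
      ((x 0 j - z 0 k)%:C + 'i / 2 * (m%:R - 2 * n%:R - 1)))).

(* [Phi n] is the function $\Phi_{n+1}$ of n + 1 pairs of variables. *)
Fixpoint Phi n : 'rV[R]_n.+1 -> 'rV[R]_n.+1 -> R[i] :=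
  match n with
  | 0 => fun x y => expC ('i * (2 * pi / a * (x 0 0 * y 0 0))%:C)
  | n'.+1 => fun x y =>
      (sin_prod / (a * (n'.+1)`!%:R))%:C *
      expC ('i * (2 * pi / a * (y 0 ord_max * \sum_j x 0 j))%:C) *
      integralC (fun z : 'rV[R]_n'.+1 =>
        W z * Phi z (\row_j (y 0 (widen_ord (leqnSn _) j) - y 0 ord_max)) /
        cosh_prod x z)
  end.

Definition Cconst N : R[i] :=
  ('i ^+ m) ^+ ((N * (N - 1))./2) *
  ((a / sin_prod)%:C) ^+ (((N - 1) * (N - 2))./2).

End Phi.

Section BakerAkhiezer.
Variables (R : realType) (a : R).
Local Notation C := R[i].

(* $q^z$ with $q = e^{-i\pi/a}$; the branch is the one fixed by [a]. *)
Definition qpow (z : C) : C := expC (- 'i * (pi / a)%:C * z).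

Definition qnum (z : C) : C := qpow z - qpow (- z).

Definition bil N (u v : 'rV[C]_N) : C := \sum_j u 0 j * v 0 j.

Definition root_vec N (j k : 'I_N) : 'rV[C]_N := delta_mx 0 j - delta_mx 0 k.

Definition BA_weight N M (l : {ffun 'I_N * 'I_N -> 'I_M.+1}) : 'rV[C]_N :=
  \sum_(j < N) \sum_(k < N | (j < k)%N)
    (M%:R / 2 - (l (j, k))%:R) *: root_vec j k.

(* The finite set of admissible vectors: different $l$ may give the same
   vector, which is then listed only once. *)
Definition BA_support N M : seq 'rV[C]_N :=
  undup [seq BA_weight l | l : {ffun 'I_N * 'I_N -> 'I_M.+1}].

Definition rho N M : 'rV[C]_N :=
  (M%:R / 2) *: \sum_(j < N) \sum_(k < N | (j < k)%N) root_vec j k.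

Definition entire2 N (psi : 'rV[C]_N -> 'rV[C]_N -> C) : Prop :=
  forall p, differentiable
    ((fun u => psi u.1 u.2) : 'rV[C]_N * 'rV[C]_N -> C^o) p.

(* Entireness is part of the characterisation: at points [x] where the
   prescribed leading coefficient vanishes, the other conditions alone do not
   determine [psi x]. *)
Record is_Baker_Akhiezer N M (psi : 'rV[C]_N -> 'rV[C]_N -> C) : Prop := {
  BA_entire : entire2 psi;
  BA_expansion : exists2 coef : 'rV[C]_N -> 'rV[C]_N -> C,
    (forall x y, psi x y = qpow (2 * bil x y) *
       \sum_(nu <- BA_support N M) coef nu x * qpow (2 * bil nu y)) &
    (forall x, coef (rho N M) x =
       \prod_(j < N) \prod_(k < N | (j < k)%N) \prod_(1 <= n < M.+1)
         qnum (n%:R + x 0 k - x 0 j));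
  BA_quasi_invariance : forall (j k : 'I_N) (s : nat) (x y : 'rV[C]_N),
    (j < k)%N -> (1 <= s <= M)%N -> qpow (2 * (y 0 j - y 0 k)) = 1 ->
    psi x (y + (s%:R / 2) *: root_vec j k) =
    psi x (y - (s%:R / 2) *: root_vec j k)
}.

Definition imul N (x : 'rV[R]_N) : 'rV[C]_N := \row_j ('i * (x 0 j)%:C).

End BakerAkhiezer.

(* Main.v *)
(** By induction on N, Phi_N is, up to explicit factors, an alternating sum over S_N of an exponential
polynomial in x and y. In the recursion the integrand then expands into products of one-variable
functions: an exponential over a product of hyperbolic cosines. By partial fractions and the Fourier
transform of the logistic function, each one-dimensional integral is a sum over the nodes
i x_j + r - M/2 (0 <= r <= M = m - 1), the values of i z at the zeros of the denominator. The resulting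
finite sum over nodes vanishes for y_j - y_k = s, |s| <= M: for the variable y_N this is the vanishing
of the sum of the residues of a rational function of low degree, and for the other variables it holds
by induction.

What makes this suffice is a rigidity statement. For generic x, consider the sums over w in S_N and z
of c(w, z) q^(2 (w x + z, y)) with z in the zonotope of the vectors (M/2) (e_j - e_k). If such a sum
vanishes on all these hyperplanes, then every line of exponents parallel to a root carries enough terms
to exhaust the width of the zonotopes, so that c is determined by its value at w = 1 and at the highest
weight rho. Rigidity provides the symmetries of the node sum and the shape of its coefficients, and it
identifies the outcome with the antisymmetrisation of the Baker-Akhiezer function. *)

Require Import Defs.
From mathcomp Require Import all_boot all_order all_algebra all_fingroup.
From mathcomp Require Import complex.
From mathcomp Require Import all_classical all_reals all_analysis.
From mathcomp Require Import measurable_realfun.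
From mathcomp Require Import ring lra zify.

Set Implicit Arguments.
Unset Strict Implicit.
Unset Printing Implicit Defensive.

Import Order.TTheory GRing.Theory Num.Theory.
Import numFieldNormedType.Exports.

Local Open Scope classical_set_scope.
Local Open Scope ring_scope.
Local Open Scope complex_scope.

(** * Complex exponentials and derivatives *)

(** The recursion singles out the last variable: the node sum is visibly antisymmetric only in y_1,
    ..., y_(N-1), and its coefficients are at first quotients in the q^(x_j). One count repairs both
    defects. Vanishing at the 2M+1 integers |s| <= M forces at least 2M+2 exponents on every
    occupied line parallel to e_j - e_k. They are shared by the zonotopes placed at w x and at its
    reflection, so on average each gets a segment of M steps per root, and these segments already
    use up the height of the zonotope. A missing vertex or an empty neighbour leaves too little
    room. Hence exchanging y_N with another variable can only rescale the coefficients, and a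
    conjugation inside S_N disposes of the scalar. The cancellation of denominators, explicit in x_N
    alone, is then carried to every variable by symmetry. The same count at points with x_j - x_k =
    r, |r| <= M, where exponents of two frames merge, shows that the antisymmetrised sum vanishes
    there; the next step relies on this to discard tuples of nodes lying over a common x_j. *)

Section ComplexBasics.
Variable R : realType.
Implicit Types (z w : R[i]) (t : R).
Local Notation Re := (@complex.Re R).
Local Notation Im := (@complex.Im R).
Local Notation cmod := (@ComplexField.Normc.normc R).

Lemma cReD z w : Re (z + w) = Re z + Re w. Proof. by case: z w => [? ?] [? ?]. Qed.
Lemma cImD z w : Im (z + w) = Im z + Im w. Proof. by case: z w => [? ?] [? ?]. Qed.
Lemma cReN z : Re (- z) = - Re z. Proof. by case: z. Qed.
Lemma cImN z : Im (- z) = - Im z. Proof. by case: z. Qed.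
Lemma cReM z w : Re (z * w) = Re z * Re w - Im z * Im w.
Proof. by case: z w => [? ?] [? ?]. Qed.
Lemma cImM z w : Im (z * w) = Re z * Im w + Im z * Re w.
Proof. by case: z w => [? ?] [? ?]. Qed.
Lemma cReC t : Re t%:C = t. Proof. by []. Qed.
Lemma cImC t : Im t%:C = 0. Proof. by []. Qed.
Lemma eqReIm z w : Re z = Re w -> Im z = Im w -> z = w.
Proof. by case: z w => [? ?] [? ?] /= -> ->. Qed.

Lemma rcN (s : R) : (- s)%:C = - s%:C :> R[i]. Proof. exact: rmorphN. Qed.
Lemma rcB (s t : R) : (s - t)%:C = s%:C - t%:C :> R[i]. Proof. exact: rmorphB. Qed.
Lemma rcM (s t : R) : (s * t)%:C = s%:C * t%:C :> R[i]. Proof. exact: rmorphM. Qed.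
Lemma rcV (s : R) : (s^-1)%:C = (s%:C)^-1 :> R[i]. Proof. exact: fmorphV. Qed.
Lemma rc_nat n : (n%:R : R)%:C = n%:R :> R[i]. Proof. exact: rmorph_nat. Qed.
Lemma rc_eq0 (s : R) : (s%:C == 0 :> R[i]) = (s == 0).
Proof. by rewrite -[0]/((0 : R)%:C) (inj_eq (@complexI R)). Qed.

Lemma Re_expC z : Re (expC z) = expR (Re z) * cos (Im z).
Proof. by rewrite /expC cReM /= mul0r subr0. Qed.
Lemma Im_expC z : Im (expC z) = expR (Re z) * sin (Im z).
Proof. by rewrite /expC cImM /= mul0r addr0. Qed.

Lemma expC0 : expC (0 : R[i]) = 1.
Proof. by apply: eqReIm; rewrite /expC ?cReM ?cImM /= expR0 cos0 sin0; ring. Qed.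

Lemma expCD z w : expC (z + w) = expC z * expC w.
Proof.
apply: eqReIm; rewrite /expC !(cReM, cImM) /= cReD cImD expRD cosD sinD; ring.
Qed.

Lemma normc_expC z : cmod (expC z) = expR (Re z).
Proof.
rewrite /expC ComplexField.Normc.normcM /= expr0n /= addr0 cos2Dsin2 sqrtr1 mulr1.
by rewrite sqrtr_sqr ger0_norm ?expR_ge0.
Qed.

Lemma expC_neq0 z : expC z != 0.
Proof.
apply/eqP => h; have := expR_gt0 (Re z).
by rewrite -normc_expC h ComplexField.Normc.normc0 ltxx.
Qed.

Lemma expCN z : expC (- z) = (expC z)^-1.
Proof.
apply: (mulfI (expC_neq0 z)); rewrite -expCD subrr expC0.
by rewrite mulfV ?expC_neq0.
Qed.

Lemma expC_real t : expC t%:C = (expR t)%:C.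
Proof. by apply: eqReIm; rewrite /expC !(cReM, cImM) /= cos0 sin0; ring. Qed.

Lemma cmod_ge_Re z : `|Re z| <= cmod z.
Proof.
case: z => x y /=; rewrite -sqrtr_sqr ler_sqrt ?addr_ge0 ?sqr_ge0//.
by rewrite lerDl sqr_ge0.
Qed.

Lemma cmod_ge_Im z : `|Im z| <= cmod z.
Proof.
case: z => x y /=; rewrite -sqrtr_sqr ler_sqrt ?addr_ge0 ?sqr_ge0//.
by rewrite lerDr sqr_ge0.
Qed.

Lemma cmodM z w : cmod (z * w) = cmod z * cmod w.
Proof. exact: ComplexField.Normc.normcM. Qed.

Lemma cmod_ge0 z : 0 <= cmod z.
Proof. by case: z => x y; apply: sqrtr_ge0. Qed.

Lemma cmodV z : cmod z^-1 = (cmod z)^-1.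
Proof. exact: ComplexField.Normc.normcV. Qed.

Lemma cmodD z w : cmod (z + w) <= cmod z + cmod w.
Proof. exact: le_normcD. Qed.

Lemma cmodR t : cmod t%:C = `|t|.
Proof. by rewrite /= expr0n /= addr0 sqrtr_sqr. Qed.

End ComplexBasics.

Section Cderive.
Variable R : realType.
Implicit Types (f g : R -> R[i]) (z w d : R[i]) (t : R).
Local Notation Re := (@complex.Re R).
Local Notation Im := (@complex.Im R).

(** Componentwise, because the fundamental theorem of calculus, the mean value theorem and
    differentiation under the integral are applied to the real and imaginary parts separately. *)
Definition cderive f t d :=
  is_derive t (1 : R) (fun u => Re (f u)) (Re d) /\
  is_derive t (1 : R) (fun u => Im (f u)) (Im d).

Lemma cderive_ext f g t d d' : (f =1 g) -> d = d' -> cderive f t d -> cderive g t d'.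
Proof. by move=> /funext <- <-. Qed.

Lemma cderive_cst z t : cderive (fun=> z) t 0.
Proof. by split; apply: is_derive_cst. Qed.

Lemma cderiveD f g t d e : cderive f t d -> cderive g t e ->
  cderive (fun u => f u + g u) t (d + e).
Proof.
move=> [f1 f2] [g1 g2]; split.
- rewrite cReD; have := is_deriveD f1 g1.
  by congr (is_derive _ _ _ _); apply/funext => u; rewrite cReD.
- rewrite cImD; have := is_deriveD f2 g2.
  by congr (is_derive _ _ _ _); apply/funext => u; rewrite cImD.
Qed.

Lemma cderiveM f g t d e : cderive f t d -> cderive g t e ->
  cderive (fun u => f u * g u) t (f t * e + d * g t).
Proof.
have scE (x y : R) : x *: (y : R^o) = x * y by [].
move=> [f1 f2] [g1 g2]; split.
- have h := is_deriveB (is_deriveM f1 g1) (is_deriveM f2 g2).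
  have -> : Re (f t * e + d * g t) = Re (f t) *: Re e + Re (g t) *: Re d -
      (Im (f t) *: Im e + Im (g t) *: Im d) :> R.
    by rewrite !scE; case: (f t) (g t) d e {h f1 f2 g1 g2} => [? ?] [? ?] [? ?] [? ?] /=; ring.
  by move: h; congr (is_derive _ _ _ _); apply/funext => u; rewrite cReM.
- have h := is_deriveD (is_deriveM f1 g2) (is_deriveM f2 g1).
  have -> : Im (f t * e + d * g t) = Re (f t) *: Im e + Im (g t) *: Re d +
      (Im (f t) *: Re e + Re (g t) *: Im d) :> R.
    by rewrite !scE; case: (f t) (g t) d e {h f1 f2 g1 g2} => [? ?] [? ?] [? ?] [? ?] /=; ring.
  by move: h; congr (is_derive _ _ _ _); apply/funext => u; rewrite cImM.
Qed.

Lemma cderiveZ f t d z : cderive f t d -> cderive (fun u => z * f u) t (z * d).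
Proof.
move=> h; apply: cderive_ext (cderiveM (cderive_cst z t) h) => //.
by rewrite mul0r addr0.
Qed.

Lemma cderive_real t : cderive (fun u => u%:C) t 1.
Proof. by split => /=; [apply: is_derive_id|apply: is_derive_cst]. Qed.

Lemma cderive_exp f t d : cderive f t d ->
  cderive (fun u => expC (f u)) t (d * expC (f t)).
Proof.
move=> [f1 f2].
have e1 : is_derive t (1 : R) (fun u => expR (Re (f u))) (expR (Re (f t)) * Re d).
  exact: (is_derive1_comp (f := @expR R) (is_derive_expR _) f1).
have c1 : is_derive t (1 : R) (fun u => cos (Im (f u))) (- sin (Im (f t)) * Im d).
  exact: (is_derive1_comp (f := @cos R) (is_derive_cos _) f2).
have s1 : is_derive t (1 : R) (fun u => sin (Im (f u))) (cos (Im (f t)) * Im d).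
  exact: (is_derive1_comp (f := @sin R) (is_derive_sin _) f2).
have E : cderive (fun u => (expR (Re (f u)))%:C) t (expR (Re (f t)) * Re d)%:C.
  by split => //=; apply: is_derive_cst.
have T : cderive (fun u => cos (Im (f u)) +i* sin (Im (f u))) t
    ((- sin (Im (f t)) * Im d) +i* (cos (Im (f t)) * Im d)) by split.
apply: cderive_ext (cderiveM E T) => //.
rewrite /expC; case: (f t) d {f1 f2 e1 c1 s1 E T} => [x y] [p r] /=.
by apply: eqReIm; rewrite !(cReD, cImD, cReM, cImM) /=; ring.
Qed.

Lemma cderiveV f t d : f t != 0 -> cderive f t d ->
  cderive (fun u => (f u)^-1) t (- d / f t ^+ 2).
Proof.
move=> ft0 [f1 f2].
have scE (x y : R) : x *: (y : R^o) = x * y by [].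
have VE z : z^-1 = (Re z / (Re z * Re z + Im z * Im z)) +i* (- Im z / (Re z * Re z + Im z * Im z)).
  by case: z => x y; rewrite /GRing.inv /= mulNr.
have n0 : Re (f t) * Re (f t) + Im (f t) * Im (f t) != 0.
  rewrite -!expr2 paddr_eq0 ?sqr_ge0// !sqrf_eq0; apply: contra ft0 => /andP[/eqP a /eqP b].
  by apply/eqP; apply: eqReIm.
have S : is_derive t (1 : R) (fun u => Re (f u) * Re (f u) + Im (f u) * Im (f u))
    (2 * Re (f t) * Re d + 2 * Im (f t) * Im d).
  have h := is_deriveD (is_deriveM f1 f1) (is_deriveM f2 f2).
  by move: h; congr (is_derive _ _ _ _); rewrite !scE /=; ring.
have V := @is_deriveV _ (fun u => Re (f u) * Re (f u) + Im (f u) * Im (f u)) t _ 1 n0 S.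
have [x [y [p [r [fE dE]]]]] : exists x y p r, f t = x +i* y /\ d = p +i* r.
  by case: (f t) (d) => [x y] [p r]; exists x, y, p, r.
(* The components of -d/f^2 in the shape produced by differentiating Re f / |f|^2 and -Im f / |f|^2
   as products. *)
have key : - d / f t ^+ 2 =
   (Re (f t) *: (- (Re (f t) * Re (f t) + Im (f t) * Im (f t)) ^- 2 *:
     (2 * Re (f t) * Re d + 2 * Im (f t) * Im d))
     + (Re (f t) * Re (f t) + Im (f t) * Im (f t))^-1 *: Re d : R) +i*
   ((- Im (f t)) *: (- (Re (f t) * Re (f t) + Im (f t) * Im (f t)) ^- 2 *:
     (2 * Re (f t) * Re d + 2 * Im (f t) * Im d))
     + (Re (f t) * Re (f t) + Im (f t) * Im (f t))^-1 *: - Im d : R).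
  move: n0 {S V f1 f2 ft0}; rewrite !scE fE dE /= => n0.
  apply: eqReIm; rewrite expr2 VE !(cReM, cImM, cReN, cImN) /=.
  - have -> : (x * x - y * y) * (x * x - y * y) + (x * y + y * x) * (x * y + y * x) =
    (x * x + y * y) ^+ 2 by ring.
    by field.
  - have -> : (x * x - y * y) * (x * x - y * y) + (x * y + y * x) * (x * y + y * x) =
    (x * x + y * y) ^+ 2 by ring.
    by field.
rewrite key; split.
- have h := is_deriveM f1 V.
  by move: h; congr (is_derive _ _ _ _); apply/funext => u; rewrite VE.
- have h := is_deriveM (is_deriveN f2) V.
  by move: h; congr (is_derive _ _ _ _); apply/funext => u; rewrite VE.
Qed.

(** Despite the name, plain differentiability everywhere; it serves to make the components
    continuous, hence measurable. *)
Definition csmooth f := forall t, exists d, cderive f t d.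

Lemma csmooth_continuous f : csmooth f ->
  continuous (fun t => Re (f t)) /\ continuous (fun t => Im (f t)).
Proof.
move=> s; split => t; have [d [a b]] := s t.
- by apply: differentiable_continuous; apply/derivable1_diffP; case: a.
- by apply: differentiable_continuous; apply/derivable1_diffP; case: b.
Qed.

Lemma csmooth_measurable f : csmooth f ->
  measurable_fun setT (fun t => Re (f t)) /\ measurable_fun setT (fun t => Im (f t)).
Proof. by move=> /csmooth_continuous [a b]; split; apply: continuous_measurable_fun. Qed.

End Cderive.

(** * Integrals of complex-valued functions *)

Section ComplexIntegral.
Context d (T : measurableType d) (R : realType) (mu : {measure set T -> \bar R}).
Implicit Types (f g : T -> R[i]) (z : R[i]).
Local Notation Re := (@complex.Re R).
Local Notation Im := (@complex.Im R).
Local Notation cmod := (@ComplexField.Normc.normc R).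

Definition intC f : R[i] :=
  Rintegral mu setT (fun t => Re (f t)) +i* Rintegral mu setT (fun t => Im (f t)).

Definition integrableC f :=
  mu.-integrable setT (EFin \o (fun t => Re (f t))) /\
  mu.-integrable setT (EFin \o (fun t => Im (f t))).

Lemma ext_integrable (f g : T -> \bar R) :
  mu.-integrable setT f -> f =1 g -> mu.-integrable setT g.
Proof. by move=> h /funext <-. Qed.

Lemma eq_intC f g : f =1 g -> intC f = intC g.
Proof. by move=> /funext ->. Qed.

Lemma eq_integrableC f g : f =1 g -> integrableC f -> integrableC g.
Proof. by move=> /funext ->. Qed.

Lemma integrableC0 : integrableC (fun=> 0).
Proof. by split; apply: integrable0. Qed.

Lemma integrableCD f g : integrableC f -> integrableC g ->
  integrableC (fun t => f t + g t).
Proof.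
move=> [f1 f2] [g1 g2]; split.
- apply: (ext_integrable (integrableD measurableT f1 g1)) => x.
  by rewrite /= cReD.
- apply: (ext_integrable (integrableD measurableT f2 g2)) => x.
  by rewrite /= cImD.
Qed.

Lemma intCD f g : integrableC f -> integrableC g ->
  intC (fun t => f t + g t) = intC f + intC g.
Proof.
move=> [f1 f2] [g1 g2]; apply: eqReIm; rewrite ?cReD ?cImD /=.
- by under eq_fun do rewrite cReD; rewrite RintegralD.
- by under eq_fun do rewrite cImD; rewrite RintegralD.
Qed.

Lemma integrableCZ z f : integrableC f -> integrableC (fun t => z * f t).
Proof.
move=> [f1 f2]; split.
- apply: (ext_integrable (integrableB measurableT
    (integrableZl measurableT (Re z) f1) (integrableZl measurableT (Im z) f2))) => x.
  by rewrite /= cReM.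
- apply: (ext_integrable (integrableD measurableT
    (integrableZl measurableT (Re z) f2) (integrableZl measurableT (Im z) f1))) => x.
  by rewrite /= cImM.
Qed.

Lemma intCZ z f : integrableC f -> intC (fun t => z * f t) = z * intC f.
Proof.
move=> [f1 f2]; apply: eqReIm; rewrite ?cReM ?cImM /=.
- under eq_fun do rewrite cReM; rewrite RintegralB ?RintegralZl//.
  + apply: (ext_integrable (integrableZl measurableT (Re z) f1)) => //.
  + apply: (ext_integrable (integrableZl measurableT (Im z) f2)) => //.
- under eq_fun do rewrite cImM; rewrite RintegralD ?RintegralZl//.
  + apply: (ext_integrable (integrableZl measurableT (Re z) f2)) => //.
  + apply: (ext_integrable (integrableZl measurableT (Im z) f1)) => //.
Qed.

Lemma intC0 : intC (fun=> 0) = 0.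
Proof.
by apply: eqReIm; rewrite /= -[X in Rintegral _ _ X]/(cst 0) /Rintegral integral0.
Qed.

Lemma integrableC_sum (I : Type) (r : seq I) (P : pred I) (F : I -> T -> R[i]) :
  (forall i, P i -> integrableC (F i)) ->
  integrableC (fun t => \sum_(i <- r | P i) F i t).
Proof.
move=> h; elim: r => [|i r IH].
  by apply: eq_integrableC integrableC0 => t; rewrite big_nil.
case Pi : (P i).
  by apply: eq_integrableC (integrableCD (h i Pi) IH) => t; rewrite big_cons Pi.
by apply: eq_integrableC IH => t; rewrite big_cons Pi.
Qed.

Lemma intC_sum (I : Type) (r : seq I) (P : pred I) (F : I -> T -> R[i]) :
  (forall i, P i -> integrableC (F i)) ->
  intC (fun t => \sum_(i <- r | P i) F i t) = \sum_(i <- r | P i) intC (F i).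
Proof.
move=> h; elim: r => [|i r IH].
  by rewrite big_nil -[RHS]intC0; apply: eq_intC => t; rewrite big_nil.
rewrite big_cons; case Pi : (P i); last first.
  by rewrite -IH; apply: eq_intC => t; rewrite big_cons Pi.
have hs := @integrableC_sum I r P F h.
rewrite -IH -(intCD (h i Pi) hs).
by apply: eq_intC => t; rewrite big_cons Pi.
Qed.

Lemma dominated_integrableC f (g : T -> R) :
  measurable_fun setT (fun t => Re (f t)) -> measurable_fun setT (fun t => Im (f t)) ->
  mu.-integrable setT (EFin \o g) -> (forall t, cmod (f t) <= g t) -> integrableC f.
Proof.
move=> m1 m2 ig fg; split; apply: (le_integrable _ _ _ ig) => //.
- exact/measurable_EFinP.
- move=> t _ /=; rewrite lee_fin (le_trans (cmod_ge_Re _))// (le_trans (fg t))//.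
  exact: ler_norm.
- exact/measurable_EFinP.
- move=> t _ /=; rewrite lee_fin (le_trans (cmod_ge_Im _))// (le_trans (fg t))//.
  exact: ler_norm.
Qed.

End ComplexIntegral.

Section RealLine.
Variable R : realType.
Local Notation mu := (@lebesgue_measure R).
Local Notation Re := (@complex.Re R).
Local Notation Im := (@complex.Im R).
Local Notation cmod := (@ComplexField.Normc.normc R).

(** Dominated convergence for the truncations of f to [-n, n]. It reduces integrals over the line to
    segments, where the fundamental theorem and the substitution t -> -t apply. *)
Lemma cvg_Rintegral_segments (f : R -> R) : mu.-integrable setT (EFin \o f) ->
  (fun n : nat => Rintegral mu `[- n%:R, n%:R]%classic f) @ \oo --> Rintegral mu setT f.
Proof.
move=> fi.
have mf := measurable_int mu fi.
pose fn (n : nat) := (EFin \o f) \_ `[- n%:R, n%:R]%classic : R -> \bar R.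
have := @dominated_convergence _ _ R mu setT measurableT fn (EFin \o f) (abse \o (EFin \o f)).
case=> //.
- move=> n; apply/(measurable_restrictT _ _).1 => //.
  by apply: measurable_funTS.
- apply: aeW => t _; apply: cvg_near_cst.
  near=> n; rewrite /fn /patch ifT//.
  rewrite inE /= in_itv /= -ler_norml; apply: ltW.
  by near: n; exact: nbhs_infty_gtr.
- exact: integrable_abse.
- apply: aeW => t n _; rewrite /fn /patch; case: ifPn => //= _.
  by rewrite normr0 lee_fin.
move=> _ _ h; apply: fine_cvg.
rewrite fineK ?integrable_fin_num//.
apply: cvg_trans h; rewrite [X in X @ _ `=>` _](_ : _ = (fun n => (\int[mu]_x fn n x)%E))//.
by apply/funext => n; rewrite /fn integral_mkcond.
Unshelve. all: by end_near. Qed.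

Lemma Rintegral_derivative (F f : R -> R) (a b : R) :
  (forall t, is_derive t (1 : R) F (f t)) -> continuous f ->
  mu.-integrable setT (EFin \o f) ->
  (fun n : nat => F n%:R) @ \oo --> b -> (fun n : nat => F (- n%:R)) @ \oo --> a ->
  Rintegral mu setT f = b - a.
Proof.
move=> dF cf fi Fp Fm.
have h1 := cvg_Rintegral_segments fi.
have h2 : (fun n : nat => F n%:R - F (- n%:R)) @ \oo --> b - a by apply: cvgB.
rewrite -(cvg_lim (@norm_hausdorff _ _) h1); apply: cvg_lim; first exact: norm_hausdorff.
apply: cvg_trans h2; rewrite [X in X @ _ `=>` _](_ : _ =
  (fun n : nat => F n%:R - F (- n%:R)))//.
  apply/funext => -[|n].
    by rewrite oppr0 subrr set_itv1 Rintegral_set1.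
  rewrite /Rintegral (@continuous_FTC2 _ f F)//=.
  - by rewrite -subr_gt0 opprK addr_gt0.
  - exact: continuous_subspaceT.
  - have cF t : {for t, continuous F}.
      by apply: differentiable_continuous; apply/derivable1_diffP; case: (dF t).
    split.
    + by move=> t _; case: (dF t).
    + exact/cvg_at_right_filter/cF.
    + exact/cvg_at_left_filter/cF.
  - by move=> t _; rewrite derive1E; case: (dF t) => _ ->.
Qed.

(** The form of integration by parts used for the Fourier integrals: g squeezes the boundary terms
    to 0. *)
Lemma intC_derivative0 (F f : R -> R[i]) (g : R -> R) :
  (forall t, cderive F t (f t)) -> csmooth f -> integrableC mu f ->
  (forall t, cmod (F t) <= g t) ->
  (fun n : nat => g n%:R) @ \oo --> 0 -> (fun n : nat => g (- n%:R)) @ \oo --> 0 ->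
  intC mu f = 0.
Proof.
move=> dF sf [i1 i2] Fg gp gm.
have [c1 c2] := csmooth_continuous sf.
have sq (h : R -> R) : (forall t, `|h t| <= g t) ->
    ((fun n : nat => h n%:R) @ \oo --> 0) /\ ((fun n : nat => h (- n%:R)) @ \oo --> 0).
  move=> hg; split; apply: norm_cvg0.
  - apply: (@squeeze_cvgr _ _ _ _ (cst 0) _ _ _ _ _ gp) => //; last exact: cvg_cst.
    by apply/nearW => n; rewrite normr_ge0 hg.
  - apply: (@squeeze_cvgr _ _ _ _ (cst 0) _ _ _ _ _ gm) => //; last exact: cvg_cst.
    by apply/nearW => n; rewrite normr_ge0 hg.
have [p1 m1] := sq (fun t => Re (F t)) (fun t => le_trans (cmod_ge_Re _) (Fg t)).
have [p2 m2] := sq (fun t => Im (F t)) (fun t => le_trans (cmod_ge_Im _) (Fg t)).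
apply: eqReIm => /=.
- by rewrite (Rintegral_derivative (fun t => (dF t).1) c1 i1 p1 m1) subrr.
- by rewrite (Rintegral_derivative (fun t => (dF t).2) c2 i2 p2 m2) subrr.
Qed.

Lemma cderive_intC (H H' : R -> R -> R[i]) (G : R -> R) (a u v : R) :
  u < a < v -> (forall s, u < s < v -> integrableC mu (H s)) ->
  (forall s t, u < s < v -> cderive (H^~ t) s (H' s t)) ->
  mu.-integrable setT (EFin \o G) ->
  (forall s t, u < s < v -> cmod (H' s t) <= G t) ->
  cderive (fun s => intC mu (H s)) a (intC mu (H' a)).
Proof.
move=> ua Hi dH Gi HG.
have aI : `]u, v[%classic a by rewrite /= in_itv.
have G0 t : 0 <= G t by apply: le_trans (HG a t ua); exact: cmod_ge0.
have main (h h' : R -> R -> R) :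
  (forall s, u < s < v -> mu.-integrable setT (EFin \o h s)) ->
  (forall s t, u < s < v -> is_derive s (1 : R) (h^~ t) (h' s t)) ->
  (forall s t, u < s < v -> `|h' s t| <= G t) ->
  is_derive a (1 : R) (fun s => Rintegral mu setT (h s)) (Rintegral mu setT (h' a)).
  move=> hi dh hG.
  have E s t : u < s < v -> partial1of2 h s t = h' s t.
    by move=> /(dh s t) [_ e]; rewrite /partial1of2 derive1E.
  have Hd : forall x y, `]u, v[%classic x -> setT y -> derivable (h^~ y) x 1.
    by move=> x y; rewrite /= in_itv /= => /(dh x y) [].
  have Hb : forall x y, `]u, v[%classic x -> setT y -> `|partial1of2 h x y| <= G y.
    by move=> x y; rewrite /= in_itv /= => xI _; rewrite E// hG.
  have Hii : forall x, `]u, v[%classic x -> mu.-integrable setT (EFin \o h x).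
    by move=> x; rewrite /= in_itv /= => /hi.
  split.
    exact: (derivable_under_integral measurableT aI Hii Hd G0 Gi Hb).
  rewrite -derive1E (differentiation_under_integral measurableT aI Hii Hd G0 Gi Hb).
  by apply: eq_Rintegral => t _; rewrite E.
split.
- apply: (main (fun s t => Re (H s t)) (fun s t => Re (H' s t))) =>
  [s /Hi[]//|s t /(dH s t)[]//|s t sI].
  exact: le_trans (cmod_ge_Re _) (HG s t sI).
- apply: (main (fun s t => Im (H s t)) (fun s t => Im (H' s t))) =>
  [s /Hi[]//|s t /(dH s t)[]//|s t sI].
  exact: le_trans (cmod_ge_Im _) (HG s t sI).
Qed.
End RealLine.

(** * Fourier transform of the logistic function *)

Section Logistic.
Variable R : realType.
Variable k : R.
Hypothesis k0 : 0 < k.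
Implicit Types (w : R[i]) (t s y : R).
Local Notation mu := (@lebesgue_measure R).
Local Notation Re := (@complex.Re R).
Local Notation Im := (@complex.Im R).
Local Notation cmod := (@ComplexField.Normc.normc R).

(** [logistic w] is t -> 1/(1 + exp(w - k t)), regular on the real line as long as |Im w| < pi, the
    condition that recurs below. [dlogistic w] is its t-derivative divided by k, and also minus its
    w-derivative; [dlogisticR], the case w = 0, is the integrable function that dominates all
    others. *)
Definition logden w t : R[i] := 1 + expC (w - (k * t)%:C).
Definition logistic w t : R[i] := (logden w t)^-1.
Definition dlogistic w t : R[i] := expC (w - (k * t)%:C) / logden w t ^+ 2.
Definition dlogisticR t : R := expR (- (k * t)) / (1 + expR (- (k * t))) ^+ 2.
Definition wave y t : R[i] := expC ('i * (y * k * t)%:C).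

Lemma cmod_wave y t : cmod (wave y t) = 1.
Proof. by rewrite normc_expC cReM /= mul0r mul1r subr0 expR0. Qed.

Lemma Re_iR (b : R) : Re ('i * b%:C) = 0.
Proof. by rewrite cReM cReC cImC /= mul0r mulr0 subr0. Qed.

Lemma Im_iR (b : R) : Im ('i * b%:C) = b.
Proof. by rewrite cImM cReC cImC /= mul0r mul1r add0r. Qed.

Lemma Re_wave y t : Re (wave y t) = cos (y * k * t).
Proof. by rewrite /wave Re_expC Re_iR Im_iR expR0 mul1r. Qed.

Lemma Im_wave y t : Im (wave y t) = sin (y * k * t).
Proof. by rewrite /wave Im_expC Re_iR Im_iR expR0 mul1r. Qed.

Lemma cos_lt_le (v v0 : R) : `|v| <= v0 -> v0 < pi -> cos v0 <= cos v.
Proof.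
move=> vv v0p; rewrite -(cos_norm v).
have [->//|ne] := eqVneq `|v| v0.
have i1 : v0 \in `[0, pi] by rewrite in_itv /= (ltW v0p) (le_trans _ vv).
have i2 : `|v| \in `[0, pi] by rewrite in_itv /= normr_ge0 (le_trans vv (ltW v0p)).
by apply: ltW; rewrite ltr_cos// lt_neqAle ne.
Qed.

Lemma cos_gtN1 (v0 : R) : 0 <= v0 < pi -> 0 < 1 + cos v0.
Proof.
move=> /andP[h1 h2]; rewrite -[X in X < _](subrr 1) ltrD2l -cospi ltr_cos//.
- by rewrite in_itv /= h1 ltW.
- by rewrite in_itv /= pi_ge0 lexx.
Qed.

(** With x = exp(Re w - k t) and c = (1 + cos v0)/2, the square of the modulus, 1 + 2 x cos(Im w) +
    x^2, is c (1 + x)^2 plus the nonnegative (1 - c)(1 - x)^2 + 2 x (cos(Im w) - cos v0). Since c <=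
    1, the square root of c may be replaced by c. *)
Lemma cmod_logden w t (v0 A : R) : `|Im w| <= v0 -> v0 < pi -> `|Re w| <= A ->
  (1 + cos v0) / 2 * expR (- A) * (1 + expR (- (k * t))) <= cmod (logden w t).
Proof.
move=> hv v0p hA.
have c0 : 0 < 1 + cos v0 by apply: cos_gtN1; rewrite v0p (le_trans _ hv).
set c := (1 + cos v0) / 2.
have c01 : 0 < c <= 1 by rewrite /c; have := cos_le1 v0; lra.
set x := expR (Re w - k * t).
have x0 : 0 < x by apply: expR_gt0.
have h1 : expR (- A) * (1 + expR (- (k * t))) <= 1 + x.
  rewrite mulrDr mulr1 -expRD lerD//.
    by rewrite -[X in _ <= X]expR0 ler_expR oppr_le0 (le_trans _ hA).
  rewrite ler_expR lerD2r lerNl (le_trans _ hA)// -normrN; exact: ler_norm.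
have sq : (c * (1 + x)) ^+ 2 <= cmod (logden w t) ^+ 2.
  have -> : cmod (logden w t) ^+ 2 = 1 + 2 * x * cos (Im w) + x ^+ 2.
    rewrite /logden; case E : (1 + _) => [p r].
    rewrite /= sqr_sqrtr ?addr_ge0 ?sqr_ge0//.
    have -> : p = 1 + x * cos (Im w).
      rewrite -[LHS]/(Re (p +i* r)) -E cReD Re_expC.
      by rewrite cReD cImD cReN cImN cReC cImC subr0.
    have -> : r = x * sin (Im w).
      rewrite -[LHS]/(Im (p +i* r)) -E cImD Im_expC.
      by rewrite cReD cImD cReN cImN cReC cImC subr0 add0r.
    have := cos2Dsin2 (Im w); move: (cos _) (sin _) => C S CS.
    have -> : 1 + 2 * x * C + x ^+ 2 = 1 + 2 * x * C + x ^+ 2 * (C ^+ 2 +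
      S ^+ 2) by rewrite CS mulr1.
    ring.
  have hc := cos_lt_le hv v0p.
  have : cos v0 = 2 * c - 1 by rewrite /c; field.
  move: hc; move: (cos _) (cos _) => C C0 hc e; subst C0.
  apply: (@le_trans _ _ (c * (1 + x) ^+ 2)).
    rewrite exprMn ler_wpM2r ?sqr_ge0// expr2 ler_piMl//; lra.
  rewrite -subr_ge0.
  have -> : 1 + 2 * x * C + x ^+ 2 - c * (1 + x) ^+ 2 =
     (1 - c) * (1 - x) ^+ 2 + 2 * x * (C - (2 * c - 1)) by ring.
  apply: addr_ge0; first by apply: mulr_ge0; [lra|apply: sqr_ge0].
  by apply: mulr_ge0; [lra|rewrite subr_ge0].
rewrite -mulrA; apply: (@le_trans _ _ (c * (1 + x))).
  by rewrite ler_wpM2l//; lra.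
by move: sq; rewrite ler_sqr// nnegrE ?cmod_ge0// mulr_ge0//; lra.
Qed.

Lemma logden_neq0 w t : `|Im w| < pi -> logden w t != 0.
Proof.
move=> h; apply/eqP => E.
have := @cmod_logden w t `|Im w| `|Re w| (lexx _) h (lexx _).
rewrite E ComplexField.Normc.normc0; apply/negP; rewrite -ltNge.
have := @cos_gtN1 `|Im w|; rewrite h normr_ge0 => /(_ isT) c.
apply: mulr_gt0; first by apply: mulr_gt0; [lra|exact: expR_gt0].
by apply: addr_gt0 => //; exact: expR_gt0.
Qed.

Lemma dlogisticR_ge0 t : 0 <= dlogisticR t.
Proof. by rewrite /dlogisticR divr_ge0 ?expR_ge0 ?sqr_ge0. Qed.

Lemma dlogisticR_even t : dlogisticR (- t) = dlogisticR t.
Proof.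
rewrite /dlogisticR mulrN opprK -[X in X / _]invrK -expRN.
rewrite -{2}(opprK (k * t)) (expRN (- (k * t))).
have := expR_gt0 (- (k * t)); move: (expR _) => x x0.
have n1 : x != 0 by rewrite gt_eqF.
have n2 : 1 + x != 0 by rewrite gt_eqF// addr_gt0.
have n3 : x + 1 != 0 by rewrite addrC.
by field; rewrite ?n1 ?n2 ?n3.
Qed.

Lemma logden0 t : logden 0 t = (1 + expR (- (k * t)))%:C.
Proof.
have E : 0 - (k * t)%:C = (- (k * t))%:C :> R[i] by rewrite sub0r rmorphN.
by rewrite /logden E expC_real rmorphD.
Qed.

Lemma logistic0 t : logistic 0 t = ((1 + expR (- (k * t)))^-1)%:C.
Proof. by rewrite /logistic logden0 fmorphV. Qed.

Lemma dlogistic0 t : dlogistic 0 t = (dlogisticR t)%:C.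
Proof.
have E : 0 - (k * t)%:C = (- (k * t))%:C :> R[i] by rewrite sub0r rmorphN.
rewrite /dlogistic /logden /dlogisticR E expC_real.
by rewrite [in RHS]rmorphM /= fmorphV /= rmorphXn /= rmorphD /=.
Qed.

Lemma dlogisticR_le t : dlogisticR t <= expR (- (k * `|t|)).
Proof.
have -> : dlogisticR t = dlogisticR `|t|.
  by case: (leP 0 t) => h; [rewrite ger0_norm|rewrite ltr0_norm// dlogisticR_even].
rewrite /dlogisticR ler_pdivrMr ?exprn_gt0 ?addr_gt0 ?expR_gt0// ler_peMr ?expR_ge0//.
by rewrite exprn_ege1// lerDl expR_ge0.
Qed.

Lemma cvg_expRk : (fun n : nat => expR (- (k * `|n%:R : R|))) @ \oo --> (0 : R).
Proof.
have h : `|expR (- k)| < 1.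
  by rewrite ger0_norm ?expR_ge0// -[X in _ < X]expR0 ltr_expR oppr_lt0.
apply: cvg_trans (cvg_geometric 1 h).
rewrite [X in X @ _ `=>` _](_ : _ = geometric 1 (expR (- k)))//.
apply/funext => n; rewrite /geometric /= mul1r -expRM_natr.
by rewrite ger0_norm// mulNr.
Qed.

Lemma cderive_logden w t : cderive (logden w) t (- k%:C * expC (w - (k * t)%:C)).
Proof.
have h1 : cderive (fun t : R => w - (k * t)%:C) t (- k%:C).
  apply: cderive_ext (cderiveD (cderive_cst w t) (cderiveZ (- k%:C) (cderive_real t))).
    by move=> u /=; rewrite mulNr rmorphM.
  by rewrite add0r mulr1.
apply: cderive_ext (cderiveD (cderive_cst 1 t) (cderive_exp h1)) => //.
by rewrite add0r.
Qed.

Lemma cderive_logistic w t : `|Im w| < pi ->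
  cderive (logistic w) t (k%:C * dlogistic w t).
Proof.
move=> h; apply: cderive_ext (cderiveV (logden_neq0 t h) (cderive_logden w t)) => //.
by rewrite !mulNr opprK /dlogistic mulrA.
Qed.

Lemma csmooth_dlogistic w : `|Im w| < pi -> csmooth (dlogistic w).
Proof.
move=> h t.
have h1 : cderive (fun t : R => expC (w - (k * t)%:C)) t (- k%:C * expC (w - (k * t)%:C)).
  have := cderiveD (cderive_cst (-1) t) (cderive_logden w t).
  by apply: cderive_ext; [move=> u; rewrite /logden addrA addNr add0r|rewrite add0r].
have hE := cderive_logden w t.
have n0 : logden w t * logden w t != 0 by rewrite mulf_neq0 ?logden_neq0.
have := cderiveM h1 (cderiveV n0 (cderiveM hE hE)).
move=> H; exists (expC (w - (k * t)%:C) * (- (logden w t * (- k%:C * expC (w - (k * t)%:C)) +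
  - k%:C * expC (w - (k * t)%:C) * logden w t) / (logden w t * logden w t) ^+ 2) +
  - k%:C * expC (w - (k * t)%:C) / (logden w t * logden w t)).
by apply: cderive_ext H => // u; rewrite /dlogistic expr2.
Qed.

Lemma cderive_wave y t : cderive (wave y) t ('i * (y * k)%:C * wave y t).
Proof.
have h1 : cderive (fun t : R => 'i * (y * k * t)%:C) t ('i * (y * k)%:C).
  apply: cderive_ext (cderiveZ ('i * (y * k)%:C) (cderive_real t)).
    by move=> u /=; rewrite [in RHS]rmorphM /= mulrA.
  by rewrite mulr1.
exact: cderive_ext (cderive_exp h1).
Qed.

Lemma continuous_dlogisticR : continuous dlogisticR.
Proof.
have h : `|Im (0 : R[i])| < pi by rewrite /= normr0 pi_gt0.
have [c _] := csmooth_continuous (csmooth_dlogistic h).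
by rewrite (_ : dlogisticR = (fun t => Re (dlogistic 0 t)))//; apply/funext => t;
  rewrite dlogistic0.
Qed.

(** By evenness this is twice the integral over the half-line, where the primitive [logistic 0] / k
    increases from 1/(2k) to 1/k. *)
Lemma int_dlogisticR : (\int[mu]_t (dlogisticR t)%:E = (k^-1)%:E)%E.
Proof.
rewrite (ge0_symfun_integralT dlogisticR_ge0 continuous_dlogisticR); last first.
  by move=> t /=; rewrite dlogisticR_even.
have -> : [set x : R | 0 <= x] = `[0, +oo[%classic.
  by apply/seteqP; split => x /=; rewrite in_itv /= andbT.
have h : `|Im (0 : R[i])| < pi by rewrite /= normr0 pi_gt0.
pose F t : R := k^-1 * Re (logistic 0 t).
have dF t : is_derive t (1 : R) F (dlogisticR t).
  have [d _] := cderiveZ (k^-1)%:C (cderive_logistic t h).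
  have -> : dlogisticR t = Re ((k^-1)%:C * (k%:C * dlogistic 0 t)).
    by rewrite dlogistic0 !cReM !cReC !cImC !mul0r !subr0 mulKf ?gt_eqF.
  move: d; congr (is_derive _ _ _ _); apply/funext => u.
  by rewrite cReM cReC cImC mul0r subr0.
have FE t : F t = k^-1 * (1 + expR (- (k * t)))^-1.
  by rewrite /F logistic0.
have cF t : {for t, continuous F}.
  by apply: differentiable_continuous; apply/derivable1_diffP; case: (dF t).
rewrite (@ge0_continuous_FTC2y _ dlogisticR F 0 k^-1).
- rewrite FE mulr0 oppr0 expR0 -EFinB -EFinM; congr (_%:E).
  by field; rewrite gt_eqF.
- by move=> t _; exact: dlogisticR_ge0.
- exact: continuous_subspaceT continuous_dlogisticR.
- rewrite (_ : F = fun t => k^-1 * (1 + expR (- (k * t)))^-1); last exact/funext.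
  rewrite -[X in _ --> X]mulr1; apply: cvgM; first exact: cvg_cst.
  rewrite -[X in _ --> X]invr1; apply: cvgV; first exact: oner_neq0.
  rewrite -[X in _ --> X]addr0; apply: cvgD; first exact: cvg_cst.
  have := @cvgr_expR R; apply: cvg_comp.
  exact: gt0_cvgMry k0 cvg_id.
- by move=> t _; case: (dF t).
- exact/cvg_at_right_filter/cF.
- by move=> t _; rewrite derive1E; case: (dF t) => _ ->.
Qed.

Lemma integrable_dlogisticR : mu.-integrable setT (EFin \o dlogisticR).
Proof.
apply/integrableP; split.
  by apply/measurable_EFinP; apply: continuous_measurable_fun continuous_dlogisticR.
under eq_integral do rewrite /= ger0_norm ?dlogisticR_ge0//.
by rewrite int_dlogisticR ltry.
Qed.

Lemma intC_dlogistic0 : intC mu (dlogistic 0) = (k^-1)%:C.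
Proof.
have -> : dlogistic 0 = (fun t => (dlogisticR t)%:C) by apply/funext => t; exact: dlogistic0.
apply: eqReIm => /=.
- by rewrite /Rintegral int_dlogisticR.
- by rewrite /Rintegral integral0.
Qed.

Lemma bound_logden w t (v0 A : R) : `|Im w| <= v0 -> v0 < pi -> `|Re w| <= A ->
  (cmod (logden w t))^-1 <= ((1 + cos v0) / 2 * expR (- A))^-1 * (1 + expR (- (k * t)))^-1.
Proof.
move=> hv v0p hA; have h := cmod_logden t hv v0p hA.
have c0 : 0 < 1 + cos v0 by apply: cos_gtN1; rewrite v0p (le_trans _ hv).
have p0 : 0 < (1 + cos v0) / 2 * expR (- A) * (1 + expR (- (k * t))).
  apply: mulr_gt0; first by apply: mulr_gt0; [lra|exact: expR_gt0].
  by apply: addr_gt0 => //; exact: expR_gt0.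
by rewrite -invfM lef_pV2 ?posrE// (lt_le_trans p0 h).
Qed.

Lemma bound_dlogistic w t (v0 A : R) : `|Im w| <= v0 -> v0 < pi -> `|Re w| <= A ->
  cmod (dlogistic w t) <= expR A * (((1 + cos v0) / 2 * expR (- A))^-1) ^+ 2 * dlogisticR t.
Proof.
move=> hv v0p hA; have h := bound_logden t hv v0p hA.
rewrite /dlogistic cmodM normc_expC cReD cReN cReC expRD.
rewrite cmodV expr2 cmodM invfM -expr2 /dlogisticR.
set c := ((1 + cos v0) / 2 * expR (- A))^-1 in h *.
rewrite -mulrA; set B := (X in _ <= _ * X).
have -> : B = expR (- (k * t)) * (c * (1 + expR (- (k * t)))^-1) ^+ 2.
  by rewrite /B !expr2 invfM; ring.
rewrite [leRHS]mulrA; apply: ler_pM; rewrite ?mulr_ge0 ?expR_ge0 ?sqr_ge0//.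
- by rewrite invr_ge0 cmod_ge0.
- by rewrite invr_ge0 cmod_ge0.
- by rewrite ler_wpM2r ?expR_ge0// ler_expR (le_trans _ hA)// ler_norm.
- by rewrite ler_sqr// nnegrE ?invr_ge0 ?cmod_ge0// (le_trans _ h)// invr_ge0 cmod_ge0.
Qed.

(** The difference is (1 - exp w) exp(-k t) divided by both denominators, so it decays at both ends,
    whereas [logistic w] alone tends to 1 at +oo and has no Fourier integral. *)
Lemma bound_logisticB w t (v0 A : R) : `|Im w| <= v0 -> v0 < pi -> `|Re w| <= A ->
  cmod (logistic w t - logistic 0 t) <=
  (1 + expR A) * ((1 + cos v0) / 2 * expR (- A))^-1 * dlogisticR t.
Proof.
move=> hv v0p hA; have h := bound_logden t hv v0p hA.
have w0 : logden w t != 0 by apply: logden_neq0; apply: le_lt_trans v0p.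
have z0 : logden 0 t != 0 by apply: logden_neq0; rewrite /= normr0 pi_gt0.
have E0 : 0 - (k * t)%:C = (- (k * t))%:C :> R[i] by rewrite sub0r rmorphN.
have -> : logistic w t - logistic 0 t =
    (1 - expC w) * ((expR (- (k * t)))%:C * ((logden w t)^-1 * (logden 0 t)^-1)).
  have -> : (expR (- (k * t)))%:C = expC (0 - (k * t)%:C) by rewrite E0 expC_real.
  have e : logden 0 t - logden w t = (1 - expC w) * expC (0 - (k * t)%:C).
    by rewrite /logden !expCD expC0; ring.
  by rewrite mulrA -e /logistic; field; rewrite w0 z0.
rewrite !cmodM !cmodV cmodR ger0_norm ?expR_ge0//.
have -> : cmod (logden 0 t) = 1 + expR (- (k * t)).
  by rewrite logden0 cmodR ger0_norm// addr_ge0 ?expR_ge0.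
set c := ((1 + cos v0) / 2 * expR (- A))^-1 in h *; set x := expR _ in h *; rewrite /dlogisticR -/x.
have x0 : 0 < x := expR_gt0 _.
have -> : (1 + expR A) * c * (x / (1 + x) ^+ 2) =
  (1 + expR A) * (x * (c * (1 + x)^-1 * (1 + x)^-1)).
  by rewrite expr2 invfM; ring.
have i0 : 0 <= (cmod (logden w t))^-1 by rewrite invr_ge0 cmod_ge0.
have j0 : 0 <= (1 + x)^-1 by rewrite invr_ge0; lra.
have x0' : 0 <= x := ltW x0.
apply: ler_pM; rewrite ?cmod_ge0 ?mulr_ge0//.
- rewrite (le_trans (cmodD _ _))// ComplexField.Normc.normc1 lerD2l normcN normc_expC ler_expR.
  by rewrite (le_trans _ hA)// ler_norm.
- by rewrite ler_pM2l// ler_wpM2r.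
Qed.

Section Fourier.
Variables (y : R).

Lemma csmooth_waveM (f : R -> R[i]) : csmooth f -> csmooth (fun t => wave y t * f t).
Proof.
move=> h t; have [d hd] := h t.
by exists (wave y t * d + 'i * (y * k)%:C * wave y t * f t); exact: cderiveM (cderive_wave y t) hd.
Qed.

Lemma csmoothD (f g : R -> R[i]) : csmooth f -> csmooth g -> csmooth (fun t => f t + g t).
Proof.
move=> h h' t; have [d hd] := h t; have [d' hd'] := h' t.
by exists (d + d'); exact: cderiveD.
Qed.

Lemma csmoothZ z (f : R -> R[i]) : csmooth f -> csmooth (fun t => z * f t).
Proof. by move=> h t; have [d hd] := h t; exists (z * d); exact: cderiveZ. Qed.

Lemma csmooth_logistic w : `|Im w| < pi -> csmooth (logistic w).
Proof. by move=> h t; exists (k%:C * dlogistic w t); exact: cderive_logistic. Qed.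

Definition fdlog w t : R[i] := wave y t * dlogistic w t.
(** Subtracting [logistic 0] costs nothing later: the partial fraction coefficients that multiply
    these integrals add up to 0. *)
Definition flogB w t : R[i] := wave y t * (logistic w t - logistic 0 t).

Lemma im0 : `|Im (0 : R[i])| < pi.
Proof. by rewrite /= normr0 pi_gt0. Qed.

Lemma dominated_smooth (f : R -> R[i]) (c : R) : csmooth f ->
  (forall t, cmod (f t) <= c * dlogisticR t) -> integrableC mu f.
Proof.
move=> sf fc; have [m1 m2] := csmooth_measurable sf.
apply: (@dominated_integrableC _ _ R mu f (fun t => c * dlogisticR t) m1 m2) => //.
exact: (integrableZl measurableT c integrable_dlogisticR).
Qed.

Lemma csmooth_fdlog w : `|Im w| < pi -> csmooth (fdlog w).
Proof. by move=> h; apply: csmooth_waveM; apply: csmooth_dlogistic. Qed.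

Lemma csmooth_flogB w : `|Im w| < pi -> csmooth (flogB w).
Proof.
move=> h; apply: csmooth_waveM => t.
have [d hd] := csmooth_logistic h t; have [d' hd'] := csmooth_logistic im0 t.
exists (d + -1 * d'); apply: cderive_ext (cderiveD hd (cderiveZ (-1) hd')) => // u.
by rewrite mulN1r.
Qed.

Lemma integrable_fdlog w : `|Im w| < pi -> integrableC mu (fdlog w).
Proof.
move=> h; apply: dominated_smooth (csmooth_fdlog h) _ => t.
by rewrite cmodM cmod_wave mul1r; exact: (bound_dlogistic t (lexx _) h (lexx _)).
Qed.

Lemma integrable_flogB w : `|Im w| < pi -> integrableC mu (flogB w).
Proof.
move=> h; apply: dominated_smooth (csmooth_flogB h) _ => t.
by rewrite cmodM cmod_wave mul1r; exact: (bound_logisticB t (lexx _) h (lexx _)).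
Qed.

(** Integration by parts: the t-derivative of [flogB w] is i y k [flogB w] + k ([fdlog w] -
    [fdlog 0]), and it integrates to 0. *)
Lemma intC_fdlogB w : `|Im w| < pi ->
  intC mu (fdlog w) - intC mu (fdlog 0) = - ('i * y%:C) * intC mu (flogB w).
Proof.
move=> h.
pose f t := 'i * (y * k)%:C * flogB w t + k%:C * (fdlog w t + -1 * fdlog 0 t).
have i1 := integrable_flogB h; have i2 := integrable_fdlog h; have i3 := integrable_fdlog im0.
have i4 : integrableC mu (fun t => fdlog w t + -1 * fdlog 0 t).
  by apply: integrableCD => //; exact: integrableCZ.
have fi : integrableC mu f by apply: integrableCD; apply: integrableCZ.
have fs : csmooth f.
  apply: csmoothD; apply: csmoothZ; first exact: csmooth_flogB.
  apply: csmoothD; first exact: csmooth_fdlog.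
  by apply: csmoothZ; apply: csmooth_fdlog im0.
have dF t : cderive (flogB w) t (f t).
  have a := cderive_logistic t h; have b := cderive_logistic t im0.
  apply: cderive_ext (cderiveM (cderive_wave y t) (cderiveD a (cderiveZ (-1) b))) => //.
    by move=> u; rewrite /flogB mulN1r.
  by rewrite /f /flogB /fdlog; ring.
pose c := (1 + expR `|Re w|) * ((1 + cos `|Im w|) / 2 * expR (- `|Re w|))^-1.
have c0 : 0 <= c.
  have := @cos_gtN1 `|Im w|; rewrite h normr_ge0 => /(_ isT) hc.
  by rewrite /c mulr_ge0 ?addr_ge0 ?invr_ge0 ?mulr_ge0 ?expR_ge0//; lra.
have hb t : cmod (flogB w t) <= c * expR (- (k * `|t|)).
  rewrite /flogB cmodM cmod_wave mul1r.
  apply: le_trans (bound_logisticB t (lexx _) h (lexx _)) _.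
  by rewrite ler_wpM2l// dlogisticR_le.
have h1 : (fun n : nat => c * expR (- (k * `|n%:R : R|))) @ \oo --> (0 : R).
  by rewrite -(mulr0 c); apply: cvgM; [exact: cvg_cst|exact: cvg_expRk].
have h2 : (fun n : nat => c * expR (- (k * `|- n%:R : R|))) @ \oo --> (0 : R).
  by under eq_fun do rewrite normrN.
have := intC_derivative0 (g := fun t => c * expR (- (k * `|t|))) dF fs fi hb h1 h2.
have j1 := integrableCZ ('i * (y * k)%:C) i1; have j2 := integrableCZ k%:C i4.
have j3 := integrableCZ (-1) i3.
rewrite /f (intCD j1 j2) (intCZ _ i1) (intCZ _ i4) (intCD i2 j3) (intCZ _ i3) => E.
have kk : k%:C != 0 :> R[i] by rewrite -[0]/((0 : R)%:C) (inj_eq (@complexI R)) gt_eqF.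
apply: (mulfI kk); apply/eqP; rewrite -subr_eq0 -[X in _ == X]E; apply/eqP.
by rewrite [(y * k)%:C]rmorphM; ring.
Qed.

(** Differentiation under the integral gives -w times the integral of [fdlog] at s w, and
    integration by parts expresses this through the integral itself: along the segment from 0 to w
    one gets a linear differential equation of first order. *)
Lemma cderive_intC_flogB w s : `|Im w| < pi -> 0 <= s <= 1 ->
  cderive (fun s : R => intC mu (flogB (s%:C * w))) s
    (- w * (intC mu (fdlog 0) - 'i * y%:C * intC mu (flogB (s%:C * w)))).
Proof.
move=> h /andP[s0 s1].
have p0 : 0 < pi :> R := pi_gt0 R.
have gen (p c : R) : p != 0 -> (1 + (p - c) / (2 * p)) * c = c + (p - c) / 2 * (c / p).
  by move=> pn; field.
have pn0 : (pi : R) != 0 by rewrite gt_eqF.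
(* d is so small that s w stays in the strip |Im| <= (1 + d) b < pi for all s in ]-d, 1 + d[, an
   open interval around [0, 1]; one dominating function then serves for all these s. *)
pose b : R := `|Im w|; pose d : R := (pi - b) / (2 * pi); pose A := (1 + d) * `|Re w|.
have d0 : 0 < d by rewrite divr_gt0// ?mulr_gt0// subr_gt0.
have b0 : 0 <= b := normr_ge0 _.
have v0p : (1 + d) * b < pi.
  have -> : (1 + d) * b = b + (pi - b) / 2 * (b / pi) by exact: gen.
  have : (pi - b) / 2 * (b / pi) <= (pi - b) / 2.
    rewrite ler_piMr ?ler_pdivrMr ?mul1r ?(ltW h)//.
    by rewrite divr_ge0// subr_ge0 ltW.
  move: h; rewrite -/b; lra.
have Iw (r : R) : Im (r%:C * w) = r * Im w by rewrite cImM cReC cImC mul0r addr0.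
have Rw (r : R) : Re (r%:C * w) = r * Re w by rewrite cReM cReC cImC mul0r subr0.
have rb (r : R) : - d < r < 1 + d -> `|r| <= 1 + d.
  by move=> /andP[r1 r2]; rewrite ler_norml (ltW r2) andbT; lra.
have bI (r : R) : - d < r < 1 + d -> `|Im (r%:C * w)| <= (1 + d) * b.
  by move=> /rb hr; rewrite Iw normrM ler_wpM2r.
have bI' (r : R) : - d < r < 1 + d -> `|Im (r%:C * w)| < pi.
  by move=> /bI hr; apply: le_lt_trans v0p.
have bR (r : R) : - d < r < 1 + d -> `|Re (r%:C * w)| <= A.
  by move=> /rb hr; rewrite Rw normrM ler_wpM2r.
have sI : - d < s < 1 + d by apply/andP; split; lra.
have key := @cderive_intC R (fun r t => flogB (r%:C * w) t) (fun r t => - w * fdlog (r%:C * w) t)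
  (fun t => cmod w * (expR A * (((1 + cos ((1 + d) * b)) / 2 * expR (- A))^-1) ^+ 2) * dlogisticR t)
  s (- d) (1 + d) sI.
have e := intC_fdlogB (bI' s sI).
have -> : - w * (intC mu (fdlog 0) - 'i * y%:C * intC mu (flogB (s%:C * w))) =
   intC mu (fun t => - w * fdlog (s%:C * w) t).
  rewrite (intCZ _ (integrable_fdlog (bI' s sI))); congr (_ * _).
  by rewrite -mulNr -e addrC subrK.
apply: key.
- by move=> r rI; apply: integrable_flogB; apply: bI'.
- move=> r t rI.
  have h1 : cderive (fun r : R => expC (r%:C * w - (k * t)%:C)) r (w * expC (r%:C * w - (k *
    t)%:C)).
    have g : cderive (fun r : R => r%:C * w - (k * t)%:C) r w.
      apply: cderive_ext (cderiveD (cderiveZ w (cderive_real r)) (cderive_cst (- (k * t)%:C) r)) =>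
        //.
        by move=> u /=; rewrite mulrC.
      by rewrite mulr1 addr0.
    exact: cderive_exp g.
  have hd : cderive (fun r : R => logden (r%:C * w) t) r (w * expC (r%:C * w - (k * t)%:C)).
    by apply: cderive_ext (cderiveD (cderive_cst 1 r) h1) => //; rewrite add0r.
  have h2 := @cderiveV R (fun r : R => logden (r%:C * w) t) r _ (logden_neq0 t (bI' r rI)) hd.
  have h3 := cderiveZ (wave y t) (cderiveD h2 (cderive_cst (- logistic 0 t) r)).
  apply: cderive_ext h3 => //.
  by rewrite addr0 /fdlog /dlogistic /logden; ring.
- exact: (integrableZl measurableT _ integrable_dlogisticR).
- move=> r t rI; rewrite cmodM normcN /fdlog cmodM cmod_wave mul1r -mulrA.
  rewrite ler_wpM2l ?cmod_ge0//.
  by apply: bound_dlogistic => //; [exact: bI|exact: bR].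
Qed.

Lemma flogB0 : intC mu (flogB 0) = 0.
Proof.
by rewrite -[RHS](intC0 mu); apply: eq_intC => t; rewrite /flogB subrr mulr0.
Qed.

Lemma const_on01 (f : R -> R[i]) : (forall s, 0 <= s <= 1 -> cderive f s 0) -> f 1 = f 0.
Proof.
move=> h.
have P (g : R -> R) : (forall s, 0 <= s <= 1 -> is_derive s (1 : R) g 0) -> g 1 = g 0.
  move=> dg; apply/eqP; rewrite -subr_eq0; apply/eqP.
  have D (x : R) : x \in `]0, 1[ -> is_derive x (1 : R) g 0.
    by rewrite in_itv /= => /andP[a b]; apply: dg; rewrite !ltW.
  have c : {within `[0, 1], continuous g}.
    by apply: derivable_within_continuous => x; rewrite in_itv /= => /dg [].
  by have [x _ ->] := MVT ltr01 D c; rewrite mul0r.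
by apply: eqReIm; [apply: (P (fun t => Re (f t))) => s /h[]|apply: (P (fun t => Im (f t))) =>
  s /h[]].
Qed.

Lemma intC_flogB_y0 w : y = 0 -> `|Im w| < pi -> intC mu (flogB w) = - w * (k^-1)%:C.
Proof.
move=> y0 h.
have C0 : intC mu (fdlog 0) = (k^-1)%:C.
  rewrite -intC_dlogistic0; apply: eq_intC => t.
  by rewrite /fdlog /wave y0 !mul0r mulr0 expC0 mul1r.
have := @const_on01 (fun s => intC mu (flogB (s%:C * w)) + w * (k^-1)%:C * s%:C).
rewrite mul1r mul0r flogB0 mulr0 addr0 mulr1 => /(_ _)/Wrap[].
  move=> s sI; have := cderiveD (cderive_intC_flogB h sI) (cderiveZ (w * (k^-1)%:C) (cderive_real
    s)).
  by apply: cderive_ext => //; rewrite C0 y0 mulr0 mul0r; ring.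
by move=> /eqP; rewrite addr_eq0 mulNr => /eqP.
Qed.

(** The integrating factor exp(-i y w s) solves that equation, with value 0 at s = 0. The only
    unknown left is the integral C of [fdlog] at w = 0. *)
Lemma intC_flogB w : y != 0 -> `|Im w| < pi ->
  intC mu (flogB w) = intC mu (fdlog 0) / ('i * y%:C) * (1 - expC ('i * y%:C * w)).
Proof.
move=> y0 h; set C := intC mu (fdlog 0); set iy := 'i * y%:C.
have iy0 : iy != 0.
  rewrite mulf_neq0//; last by rewrite -[0]/((0 : R)%:C) (inj_eq (@complexI R)).
  by apply/eqP => /(congr1 Im) /= /eqP; rewrite oner_eq0.
have := @const_on01 (fun s => expC (- (iy * w) * s%:C) * (intC mu (flogB (s%:C * w)) + - (C / iy))).
have H s : 0 <= s <= 1 -> cderive (fun s : R => expC (- (iy * w) * s%:C) *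
    (intC mu (flogB (s%:C * w)) + - (C / iy))) s 0.
  move=> sI.
  have := cderiveM (cderive_exp (cderiveZ (- (iy * w)) (cderive_real s)))
     (cderiveD (cderive_intC_flogB h sI) (cderive_cst (- (C / iy)) s)).
  by apply: cderive_ext => //; rewrite -/C -/iy; field.
move=> /(_ H); rewrite mul1r mul0r flogB0 mulr0 expC0 mulr1 mul1r add0r expCN.
set e := expC _ => E; have e0 : e != 0 := expC_neq0 _.
have : e * (e^-1 * (intC mu (flogB w) + - (C / iy))) = e * - (C / iy) by rewrite E.
by rewrite mulVKf// => /eqP; rewrite subr_eq => /eqP ->; ring.
Qed.

End Fourier.

(** * The remaining constant, by concentration of a Poisson-type kernel *)

Section Value.
Variable y : R.
Hypothesis y0 : y != 0.

(** Up to the factor -i, the difference of [logistic] at the shifts i b and -i b. For 0 < b < pi it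
    is nonnegative of mass 2 b / k, and it concentrates at t = 0 as b tends to pi. Comparing its
    Fourier integral with its mass in this limit yields the value of C. *)
Definition pker (b t : R) : R := sin b / ((expR (k * t) + expR (- (k * t))) / 2 + cos b).

(** For u >= 0, exp(u/2) >= 1 + u/2 makes exp(u/2) - exp(-u/2) at least u/2, and the square of this
    difference is 2 cosh u - 2. *)
Lemma cosh_ge (u : R) : 1 + u ^+ 2 / 8 <= (expR u + expR (- u)) / 2.
Proof.
wlog u0 : u / 0 <= u.
  move=> H; case: (leP 0 u) => [|/ltW]; first exact: H.
  by rewrite -oppr_ge0 => /H; rewrite sqrrN opprK [expR (- u) + _]addrC.
have h := expR_ge1Dx (u / 2).
have g : expR (u / 2) * expR (- (u / 2)) = 1 by rewrite -expRD subrr expR0.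
have e1 : expR u = expR (u / 2) ^+ 2 by rewrite expr2 -expRD; congr expR; field.
have e2 : expR (- u) = expR (- (u / 2)) ^+ 2 by rewrite expr2 -expRD; congr expR; field.
rewrite e1 e2; move: h g (expR_gt0 (- (u / 2))); set p := expR (u / 2).
set q := expR (- (u / 2)) => h g q0.
have q1 : q <= 1 by nra.
have : (u / 2) ^+ 2 <= (p - q) ^+ 2 by rewrite ler_sqr ?nnegrE; lra.
have : (u / 2) ^+ 2 = u ^+ 2 / 4 by field.
nra.
Qed.

Lemma cos_ge (x : R) : 1 - x ^+ 2 / 2 <= cos x.
Proof.
have sl (v : R) : 0 <= v -> `|sin v| <= v.
  rewrite le_eqVlt => /predU1P[<-|v0]; first by rewrite sin0 normr0.
  have D (z : R) : z \in `]0, v[ -> is_derive z (1 : R) (@sin R) (cos z) by move=> _;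
    exact: is_derive_sin.
  have c : {within `[0, v], continuous (@sin R)}.
    by apply: continuous_subspaceT => z; exact: continuous_sin.
  have [z _] := MVT v0 D c; rewrite sin0 !subr0 => ->.
  by rewrite normrM (gtr0_norm v0) ler_piMl ?(ltW v0) ?cos_max.
have s2 (v : R) : sin v ^+ 2 <= v ^+ 2.
  wlog v0 : v / 0 <= v.
    move=> H; case: (leP 0 v) => [|/ltW]; first exact: H.
    by rewrite -oppr_ge0 => /H; rewrite sinN !sqrrN.
  by rewrite -[leLHS]real_normK ?num_real// ler_sqr ?nnegrE// sl.
have := s2 (x / 2); rewrite sin2cos2.
have : cos x = cos (x / 2) ^+ 2 *+ 2 - 1.
  by rewrite -cos_mulr2n; congr cos; rewrite -mulr_natl; field.
rewrite -mulr_natl; move: (cos _) (cos _) => c d -> h.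
have : (x / 2) ^+ 2 = x ^+ 2 / 4 by field.
lra.
Qed.

Lemma pker_den_gt0 (b t : R) : `|b| < pi -> 0 < (expR (k * t) + expR (- (k * t))) / 2 + cos b.
Proof.
move=> h; have := @cos_gtN1 `|b|; rewrite h normr_ge0 cos_norm => /(_ isT).
have := cosh_ge (k * t); have := sqr_ge0 (k * t); lra.
Qed.

Lemma logisticB_pker (b t : R) : `|b| < pi ->
  logistic ('i * b%:C) t - logistic (- ('i * b%:C)) t = - 'i * (pker b t)%:C.
Proof.
move=> h.
have i1 : `|Im ('i * b%:C)| < pi by rewrite cImM /= mul0r mul1r add0r.
have i2 : `|Im (- ('i * b%:C))| < pi by rewrite cImN normrN.
have n1 := logden_neq0 t i1; have n2 := logden_neq0 t i2.
set e := expR (- (k * t)); set c := cos b; set s := sin b.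
have e0 : 0 < e by exact: expR_gt0.
have E1 : logden ('i * b%:C) t = (1 + e * c) +i* (e * s).
  apply: eqReIm; rewrite /logden ?(cReD, cImD, Re_expC, Im_expC, cReN, cImN).
    by rewrite Re_iR Im_iR cReC cImC sub0r subr0.
  by rewrite Re_iR Im_iR cReC cImC sub0r subr0 add0r.
have E2 : logden (- ('i * b%:C)) t = (1 + e * c) +i* (- (e * s)).
  apply: eqReIm; rewrite /logden ?(cReD, cImD, Re_expC, Im_expC, cReN, cImN).
    by rewrite Re_iR Im_iR cReC cImC oppr0 sub0r addr0 cosN.
  by rewrite Re_iR Im_iR cReC cImC oppr0 sub0r addr0 sinN mulrN add0r.
have cs : c ^+ 2 + s ^+ 2 = 1 := cos2Dsin2 b.
have P : pker b t * (1 + 2 * e * c + e ^+ 2) = 2 * e * s.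
  have := pker_den_gt0 t h; rewrite /pker -/c -/s.
  have -> : expR (k * t) = e^-1 by rewrite /e expRN invrK.
  rewrite -/e => d0; have en : e != 0 by rewrite gt_eqF.
  have -> : 1 + 2 * e * c + e ^+ 2 = 2 * e * ((e^-1 + e) / 2 + c) by field.
  by move: d0; set d := _ / 2 + c => d0; have dn : d != 0 := lt0r_neq0 d0; field.
rewrite /logistic; apply: (mulfI (mulf_neq0 n1 n2)).
have -> : logden ('i * b%:C) t * logden (- ('i * b%:C)) t *
   ((logden ('i * b%:C) t)^-1 - (logden (- ('i * b%:C)) t)^-1) =
   logden (- ('i * b%:C)) t - logden ('i * b%:C) t by field; rewrite n1 n2.
rewrite E1 E2; apply: eqReIm; rewrite ?(cReD, cImD, cReM, cImM, cReN, cImN) /=.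
  by rewrite !(mul0r, mulr0, oppr0, subr0, addr0, add0r); ring.
rewrite !(mul0r, mulr0, oppr0, subr0, addr0, add0r).
have -> : - (e * s) - e * s = - (2 * e * s) by ring.
rewrite -P; have -> : 1 + 2 * e * c + e ^+ 2 =
  1 + 2 * e * c + e ^+ 2 * (c ^+ 2 + s ^+ 2) by rewrite cs mulr1.
ring.
Qed.

Definition fpker (y' b t : R) : R[i] := wave y' t * (pker b t)%:C.

Lemma fpkerE (y' b t : R) : `|b| < pi ->
  fpker y' b t = 'i * (flogB y' ('i * b%:C) t + -1 * flogB y' (- ('i * b%:C)) t).
Proof.
move=> h; rewrite /flogB /fpker.
have -> : wave y' t * (logistic ('i * b%:C) t - logistic 0 t) +
  -1 * (wave y' t * (logistic (- ('i * b%:C)) t - logistic 0 t)) =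
  wave y' t * (logistic ('i * b%:C) t - logistic (- ('i * b%:C)) t) by ring.
rewrite logisticB_pker// [RHS]mulrCA; congr (_ * _).
have ii : 'i * 'i = -1 :> R[i] by apply: eqReIm; rewrite ?cReM ?cImM /=; ring.
by rewrite mulrA mulrN ii opprK mul1r.
Qed.

Lemma integrable_fpker (y' b : R) : `|b| < pi -> integrableC mu (fpker y' b).
Proof.
move=> h.
have i1 : `|Im ('i * b%:C)| < pi by rewrite cImM /= mul0r mul1r add0r.
have i2 : `|Im (- ('i * b%:C))| < pi by rewrite cImN normrN.
have j1 := integrable_flogB y' i1; have j2 := integrableCZ (-1) (integrable_flogB y' i2).
apply: eq_integrableC (integrableCZ 'i (integrableCD j1 j2)) => t.
by rewrite fpkerE.
Qed.

Lemma intC_fpker (y' b : R) : `|b| < pi -> intC mu (fpker y' b) =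
   'i * (intC mu (flogB y' ('i * b%:C)) - intC mu (flogB y' (- ('i * b%:C)))).
Proof.
move=> h.
have i1 : `|Im ('i * b%:C)| < pi by rewrite cImM /= mul0r mul1r add0r.
have i2 : `|Im (- ('i * b%:C))| < pi by rewrite cImN normrN.
have j1 := integrable_flogB y' i1; have j0 := integrable_flogB y' i2.
have j2 := integrableCZ (-1) j0.
rewrite -mulN1r -(intCZ _ j0) -(intCD j1 j2) -(intCZ _ (integrableCD j1 j2)).
by apply: eq_intC => t; rewrite fpkerE.
Qed.

Lemma intC_odd (f : R -> R) : continuous f -> (forall t, f (- t) = - f t) ->
  mu.-integrable setT (EFin \o f) -> Rintegral mu setT f = 0.
Proof.
move=> cf fo fi.
have h := cvg_Rintegral_segments fi.
have z (n : nat) : Rintegral mu `[- n%:R, n%:R]%classic f = 0.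
  have n0 : - n%:R <= n%:R :> R by rewrite -subr_ge0 opprK addr_ge0.
  have c : {within `[- n%:R, - - n%:R], continuous f} by exact: continuous_subspaceT.
  have := @integration_by_substitution_oppr R f (- n%:R) n%:R n0 c.
  rewrite opprK => E.
  have fi' : mu.-integrable `[- n%:R, n%:R] (EFin \o f).
    by apply: integrableS fi.
  have E2 : Rintegral mu `[- n%:R, n%:R]%classic f = - Rintegral mu `[- n%:R, n%:R]%classic f.
    transitivity (Rintegral mu `[- n%:R, n%:R]%classic (fun t => -1 * f t)).
      rewrite /Rintegral E; congr fine.
      by apply: eq_integral => t _ /=; rewrite fo mulN1r.
    by rewrite RintegralZl// mulN1r.
  by move: E2; set I := Rintegral _ _ _; lra.
rewrite -(cvg_lim (@norm_hausdorff _ _) h); apply: cvg_lim; first exact: norm_hausdorff.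
by under eq_fun do rewrite z; exact: cvg_cst.
Qed.

Lemma intC_fdlog0_real : Im (intC mu (fdlog y 0)) = 0.
Proof.
have [c1 c2] := csmooth_continuous (csmooth_fdlog y im0).
have [_ j] := integrable_fdlog y im0.
apply: intC_odd => //.
have E (t : R) : Im (fdlog y 0 t) = sin (y * k * t) * dlogisticR t.
  by rewrite /fdlog dlogistic0 cImM cReC cImC mulr0 add0r Im_wave.
by move=> t; rewrite !E dlogisticR_even mulrN sinN mulNr.
Qed.

Lemma Re_fpker (y' b t : R) : Re (fpker y' b t) = cos (y' * k * t) * pker b t.
Proof. by rewrite /fpker cReM Re_wave cReC cImC mulr0 subr0. Qed.

Lemma Re_fpker0 (b t : R) : Re (fpker 0 b t) = pker b t.
Proof. by rewrite Re_fpker !mul0r cos0 mul1r. Qed.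

Lemma Rintegral_pker (b : R) : 0 < b < pi -> Rintegral mu setT (pker b) = 2 * b / k.
Proof.
move=> /andP[b0 bp]; have h : `|b| < pi by rewrite gtr0_norm.
have i1 : `|Im ('i * b%:C)| < pi by rewrite Im_iR.
have i2 : `|Im (- ('i * b%:C))| < pi by rewrite cImN normrN.
have := congr1 Re (intC_fpker 0 h).
rewrite !intC_flogB_y0//.
have -> : 'i * (- ('i * b%:C) * (k^-1)%:C - - - ('i * b%:C) * (k^-1)%:C) = (2 * b / k)%:C.
  have ii : 'i * 'i = -1 :> R[i] by apply: eqReIm; rewrite ?cReM ?cImM /=; ring.
  transitivity (- ('i * 'i) * (2 * b%:C * (k^-1)%:C) : R[i]); first by ring.
  by rewrite ii opprK mul1r !rcM rc_nat.
rewrite cReC => <-; apply: eq_Rintegral => t _; rewrite Re_fpker0//.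
Qed.

Lemma dlogisticR_cosh t :
  dlogisticR t = 1 / (2 * ((expR (k * t) + expR (- (k * t))) / 2 + 1)).
Proof.
rewrite /dlogisticR.
have -> : expR (k * t) = (expR (- (k * t)))^-1 by rewrite expRN invrK.
have := expR_gt0 (- (k * t)); move: (expR (- (k * t))) => e e0.
have n1 : e != 0 by rewrite gt_eqF.
have -> : 2 * ((e^-1 + e) / 2 + 1) = (1 + e) ^+ 2 / e by field.
by rewrite div1r invf_div.
Qed.

Lemma pker_ge0 (b t : R) : 0 < b < pi -> 0 <= pker b t.
Proof.
move=> /andP[b0 bp]; have h : `|b| < pi by rewrite gtr0_norm.
by rewrite divr_ge0 ?sin_ge0_pi ?(ltW b0) ?(ltW bp)// ltW// pker_den_gt0.
Qed.

(** At t = 0 the denominator of [pker] shrinks to 1 + cos b, which tends to 0 with b -> pi; but 1 -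
    cos(y k t) <= (y k t)^2/2 vanishes there to the same order as cosh(k t) - 1. What remains is an
    integrable bound carrying the factor sin b. *)
Lemma pker_bound (b t : R) : 0 < b < pi ->
  `|(cos (y * k * t) - 1) * pker b t| <= 2 * (2 + 8 * y ^+ 2) * sin b * dlogisticR t.
Proof.
move=> bI; have /andP[b0 bp] := bI; have h : `|b| < pi by rewrite gtr0_norm.
have s0 : 0 <= sin b by rewrite sin_ge0_pi// (ltW b0) (ltW bp).
rewrite normrM (ger0_norm (pker_ge0 t bI)) dlogisticR_cosh /pker -mulrA.
have d0 := pker_den_gt0 t h; have ch := cosh_ge (k * t); have cc := cos_ge (y * (k * t)).
have c1 := cos_le1 (y * (k * t)); have c2 := cos_geN1 (y * (k * t)); have cb := cos_geN1 b.
have x2 := sqr_ge0 (k * t); have y2 := sqr_ge0 y.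
set C := (expR _ + expR _) / 2 in d0 ch *.
have e1 : (y * (k * t)) ^+ 2 = y ^+ 2 * (k * t) ^+ 2 by rewrite exprMn.
rewrite e1 in cc; rewrite [leLHS](_ : _ = sin b * (`|cos (y * (k * t)) - 1| / (C + cos b)));
  last first.
  by rewrite mulrA; ring.
rewrite [leRHS](_ : _ = sin b * ((2 + 8 * y ^+ 2) / (C + 1))); last first.
  by field; rewrite gt_eqF//; lra.
apply: ler_wpM2l => //.
rewrite ler_pdivrMr// mulrAC ler_pdivlMr; last lra.
rewrite ler0_norm; last lra.
move: cc c1 c2; set D := cos _ => cc c1 c2.
set Y := y ^+ 2 in cc y2 *; set X := (k * t) ^+ 2 in cc x2 ch *.
have h1 : 1 - D <= 4 * Y * (C - 1).
  apply: (@le_trans _ _ (Y * X / 2)); first lra.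
  have : 0 <= Y * (8 * (C - 1) - X) by apply: mulr_ge0; lra.
  lra.
have h2 : (1 - D) * (C - 1) <= 2 * (C - 1) by rewrite ler_wpM2r; lra.
have h3 : (2 + 8 * Y) * (C - 1) <= (2 + 8 * Y) * (C + cos b) by rewrite ler_wpM2l; lra.
lra.
Qed.

Lemma intC_fdlog0 : intC mu (fdlog y 0) = (pi * y / (k * ((expR (pi * y) - expR (- (pi * y))) /
  2)))%:C.
Proof.
set c := Re (intC mu (fdlog y 0)).
have EC : intC mu (fdlog y 0) = c%:C by apply: eqReIm => //; rewrite intC_fdlog0_real.
have ii : 'i * 'i = -1 :> R[i] by apply: eqReIm; rewrite ?cReM ?cImM /=; ring.
(* For 0 < b < pi, Q b is the real part of the Fourier integral of [pker b] minus its mass; the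
   closed form also makes sense at b = pi, where it determines c. *)
pose Q (b : R) := c / y * (expR (y * b) - expR (- (y * b))) - 2 * b / k.
pose K : R := 2 * (2 + 8 * y ^+ 2) / k.
have QK (b : R) : 0 < b < pi -> `|Q b| <= K * sin b.
  move=> bI; have /andP[b0 bp] := bI; have h : `|b| < pi by rewrite gtr0_norm.
  have i1 : `|Im ('i * b%:C)| < pi by rewrite Im_iR.
  have i2 : `|Im (- ('i * b%:C))| < pi by rewrite cImN normrN Im_iR.
  have [jr _] := integrable_fpker y h; have [j0 _] := integrable_fpker 0 h.
  have jp : mu.-integrable setT (EFin \o pker b).
    by apply: ext_integrable j0 _ => t; rewrite /comp Re_fpker0.
  have ge t : Re (fpker y b t) - pker b t = (cos (y * k * t) - 1) * pker b t.
    by rewrite Re_fpker; ring.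
  have -> : Q b = Rintegral mu setT (fun t => (cos (y * k * t) - 1) * pker b t).
    have := congr1 Re (intC_fpker y h).
    have -> : 'i * (intC mu (flogB y ('i * b%:C)) - intC mu (flogB y (- ('i * b%:C)))) =
       (c / y * (expR (y * b) - expR (- (y * b))))%:C.
      rewrite !intC_flogB// EC.
      have -> : 'i * y%:C * ('i * b%:C) = (- (y * b))%:C.
        by rewrite mulrACA ii mulN1r rmorphN rmorphM.
      have -> : 'i * y%:C * - ('i * b%:C) = (y * b)%:C.
        by rewrite mulrN mulrACA ii mulN1r opprK rmorphM.
      rewrite !expC_real !(rcM, rcV, rcB).
      have i0 : 'i != 0 :> R[i] by apply/eqP => /(congr1 Im) /= /eqP; rewrite oner_eq0.
      have yc0 : y%:C != 0 :> R[i] by rewrite rc_eq0.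
      by field; rewrite i0 yc0.
    move=> E; rewrite /Q -[X in X - _]/(Re (_%:C)) -E -(Rintegral_pker bI) -RintegralB//.
    by apply: eq_Rintegral => t _; exact: ge.
  have jg : mu.-integrable setT (EFin \o (fun t => (cos (y * k * t) - 1) * pker b t)).
    by apply: ext_integrable (integrableB measurableT jr jp) _ => t; rewrite /comp -ge.
  have jd := integrableZl measurableT (2 * (2 + 8 * y ^+ 2) * sin b) integrable_dlogisticR.
  apply: le_trans (le_normr_Rintegral measurableT jg) _.
  have -> : K * sin b = Rintegral mu setT (fun t => 2 * (2 + 8 * y ^+ 2) * sin b * dlogisticR t).
    rewrite (RintegralZl _ measurableT integrable_dlogisticR) /Rintegral int_dlogisticR /= /K; ring.
  apply: le_Rintegral => //; first exact: integrable_norm.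
  by move=> t _; exact: pker_bound.
have p0 : 0 < pi :> R := pi_gt0 R.
(* Continuity of Q carries the bound |Q b| <= K sin b to b = pi, where the right side is 0. *)
have Qpi : Q pi = 0.
  have eL (z : R) : expR (z * b) @[b --> pi^'-] --> expR (z * pi).
    apply: continuous_cvg; first exact: continuous_expR.
    by apply: cvgM; [exact: cvg_cst|exact: cvg_at_left_filter cvg_id].
  have cQ : Q b @[b --> pi^'-] --> Q pi.
    apply: cvgB.
      apply: cvgM; first exact: cvg_cst.
      by apply: cvgB; [exact: eL|under eq_fun do rewrite -mulNr; rewrite -mulNr; exact: eL].
    apply: cvgM; last exact: cvg_cst.
    by apply: cvgM; [exact: cvg_cst|exact: cvg_at_left_filter cvg_id].
  have cS : K * sin b @[b --> pi^'-] --> K * sin (pi : R).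
    apply: cvgM; first exact: cvg_cst.
    by apply: cvg_at_left_filter; exact: continuous_sin.
  have cg : K * sin b - `|Q b| @[b --> pi^'-] --> K * sin pi - `|Q pi|.
    by apply: cvgB => //; apply: cvg_norm.
  have : 0 <= K * sin pi - `|Q pi|.
    apply: cvgr_to_ge cg _; near=> b; rewrite subr_ge0 QK//; apply/andP; split.
      by near: b; exact: nbhs_left_gt.
    by near: b; exact: nbhs_left_lt.
  by rewrite sinpi mulr0 sub0r oppr_ge0 normr_le0 => /eqP.
rewrite EC; congr (_%:C); move: Qpi; rewrite /Q [y * pi]mulrC => /eqP.
have E0 : expR (pi * y) - expR (- (pi * y)) != 0.
  rewrite subr_eq0; apply/eqP => /expR_inj /eqP.
  by rewrite -subr_eq0 opprK -mulr2n mulrn_eq0 /= mulf_eq0 (negbTE y0) gt_eqF.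
move: E0; set E := expR _ - _ => E0; rewrite subr_eq0 => /eqP H.
have kk : k != 0 by rewrite gt_eqF.
have -> : c = (c / y * E) * y / E by field; rewrite y0 E0.
by rewrite H; field; rewrite kk E0.
Unshelve. all: by end_near. Qed.

End Value.

End Logistic.

(** * Partial fractions and the one-dimensional integral *)

Section Lagrange.
Variables (F : fieldType) (I : finType).
Implicit Types (v : I -> F).

Lemma size_index_neq (i : I) : size [seq j <- index_enum I | j != i] = #|I|.-1.
Proof. by rewrite -sum1_size big_filter -(cardC1 i) -sum1_card; apply: eq_bigl. Qed.

Lemma lagrange_interpolation v (p : {poly F}) : injective v -> (size p <= #|I|)%N ->
  p = \sum_i p.[v i] *: \prod_(j | j != i) ((v i - v j)^-1 *: ('X - (v j)%:P)).
Proof.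
move=> vi sp; apply/eqP; rewrite -subr_eq0; apply/eqP.
set L := fun i => \prod_(j | j != i) ((v i - v j)^-1 *: ('X - (v j)%:P)).
have Li i k : (L i).[v k] = (i == k)%:R.
  rewrite /L horner_prod; case: eqP => [->|/eqP ik].
    apply: big1 => j jk; rewrite hornerZ !hornerE mulVf// subr_eq0.
    by apply: contra jk => /eqP /vi ->.
  by rewrite (bigD1 k) 1?eq_sym//= hornerZ !hornerE subrr mulr0 mul0r.
have sL i : (size (L i) <= #|I|)%N.
  rewrite /L scaler_prod; apply: leq_trans (size_scale_leq _ _) _.
  rewrite -big_filter size_prod_XsubC size_index_neq prednK//.
  by apply/card_gt0P; exists i.
apply/eqP; rewrite -size_poly_eq0 -leqn0 leqNgt; apply/negP => sp0.
set d := p - _ in sp0.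
have d0 : d != 0 by rewrite -size_poly_gt0.
have sd : (size d <= #|I|)%N.
  rewrite /d (leq_trans (size_polyD _ _))// geq_max sp size_polyN.
  apply: (leq_trans (size_sum _ _ _)); apply/bigmax_leqP => i _.
  exact: leq_trans (size_scale_leq _ _) (sL i).
have := @max_poly_roots _ d [seq v i | i <- enum I] d0.
rewrite size_map -cardT map_inj_uniq// enum_uniq => H.
have : (#|I| < size d)%N.
  apply: H => //; apply/allP => _ /mapP[k _ ->]; rewrite /root /d hornerD hornerN horner_sum.
  rewrite (bigD1 k)//= hornerZ Li eqxx mulr1 big1 ?addr0 ?subrr// => i ik.
  by rewrite hornerZ Li (negbTE ik) mulr0.
by rewrite ltnNge sd.
Qed.

(** Up to sign, the sum is the coefficient of X^(K-1), K the number of nodes, in the interpolation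
    formula for X^f; it is 0 since f <= K - 2. *)
Lemma lagrange_sum0 (u : I -> F) (f : nat) : injective u -> (f.+2 <= #|I|)%N ->
  \sum_i u i ^+ f / \prod_(j | j != i) (u j - u i) = 0.
Proof.
move=> ui fK.
have := @lagrange_interpolation u 'X^f ui; rewrite size_polyXn => /(_ (ltnW fK)).
move/(congr1 (fun p : {poly F} => p`_(#|I|.-1))).
rewrite coefXn coef_sum.
have -> : (#|I|.-1 == f) = false by apply/eqP => e; move: fK; rewrite -e; case: #|I| => // ?;
  rewrite ltnn.
rewrite mulr0n => E; rewrite -[RHS](mulr0 ((-1) ^+ #|I|.-1)) [X in _ = _ * X]E mulr_sumr.
apply: eq_bigr => i _.
rewrite coefZ hornerXn.
rewrite scaler_prod coefZ.
set s := [seq j <- index_enum I | j != i].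
have ss : size s = #|I|.-1 := size_index_neq i.
have -> : (\prod_(j | j != i) ('X - (u j)%:P))`_(#|I|.-1) = 1.
  rewrite -big_filter -/s; have := monic_prod_XsubC s predT u;
    rewrite monicE /lead_coef size_prod_XsubC ss /=.
  by move/eqP.
rewrite mulr1 mulrCA; congr (_ * _).
have -> : (-1) ^+ #|I|.-1 = \prod_(j | j != i) (-1 : F).
  by rewrite -[RHS]big_filter big_const_seq count_predT ss iter_mulr_1.
rewrite -big_split /= -prodfV; apply: eq_bigr => j ji.
by rewrite mulN1r -invrN opprB.
Qed.

(** Interpolation of X^f at the points -u_i, divided by the product of the x + u_i. *)
Lemma partial_fractions (u : I -> F) (f : nat) (x : F) : injective u -> (f < #|I|)%N ->
  (forall i, x + u i != 0) ->
  x ^+ f / \prod_i (x + u i) =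
  \sum_i (- u i) ^+ f / (\prod_(j | j != i) (u j - u i)) / (x + u i).
Proof.
move=> ui fK x0.
have vi : injective (fun i => - u i) by move=> i j /oppr_inj /ui.
have := @lagrange_interpolation (fun i => - u i) 'X^f vi; rewrite size_polyXn => /(_ fK).
move/(congr1 (fun p : {poly F} => p.[x])); rewrite hornerXn => ->.
rewrite horner_sum mulr_suml; apply: eq_bigr => i _.
rewrite hornerZ hornerXn (bigD1 i (F := fun j => x + u j))//= invfM.
rewrite horner_prod -!mulrA; congr (_ * _); rewrite [(x + u i)^-1 * _]mulrC mulrA; congr (_ / _).
rewrite -!prodfV -big_split /=; apply: eq_bigr => j ji.
rewrite hornerZ !hornerE opprK [- u i + _]addrC -mulrA mulfV ?mulr1//.
Qed.
End Lagrange.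

(* The algebra of exponential sums only uses these properties of q^z = qpow a z and of [z] = qnum a z. *)
Record qexponential (R : realType) (q br : R[i] -> R[i]) : Prop := QExponential {
  qD : forall z w, q (z + w) = q z * q w;
  q_neq0 : forall z, q z != 0;
  q_Im : forall z, q z = 1 -> complex.Im z = 0;
  q_scale : forall z, (forall t : R, q (z * t%:C) = 1) -> z = 0;
  q_int : forall n : int, q n%:~R = 1 -> n = 0;
  brE : forall z, br z = q z - q (- z)
}.

Section QpowIsExponential.
Variables (R : realType) (a : R).
Hypothesis a0 : 0 < a.
Hypothesis hq : forall k : nat, (0 < k)%N -> ~~ k.-unity_root (qpow a 1).
Local Notation C := R[i].
Local Notation q := (qpow a).
Local Notation Re := (@complex.Re R).
Local Notation Im := (@complex.Im R).
Implicit Types (z w : C).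

Lemma ii_m1 : 'i * 'i = -1 :> C.
Proof. by apply: eqReIm; rewrite ?cReM ?cImM /=; ring. Qed.

Lemma qpowD z w : q (z + w) = q z * q w.
Proof. by rewrite /qpow mulrDr expCD. Qed.

Lemma qpow_Im z : q z = 1 -> Im z = 0.
Proof.
move=> h; have := congr1 (@ComplexField.Normc.normc R) h.
rewrite /qpow normc_expC ComplexField.Normc.normc1 -expR0 => /expR_inj.
have -> : Re (- 'i * (pi / a)%:C * z) = pi / a * Im z.
  by rewrite mulNr cReM cReN cImN Re_iR Im_iR; ring.
have p0 : pi / a != 0 by rewrite mulf_neq0 ?invr_neq0 ?gt_eqF ?pi_gt0.
by move/eqP; rewrite mulf_eq0 (negbTE p0) => /eqP.
Qed.

Lemma qpow_scale_eq0 z : (forall t : R, q (z * t%:C) = 1) -> z = 0.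
Proof.
move=> h; have iz : Im z = 0 by have := qpow_Im (h 1); rewrite mulr1.
have rz : z = (Re z)%:C by apply: eqReIm.
apply: eqReIm => //=; apply/eqP; apply/negPn/negP => r0.
(* At t = a / Re z the value is q^a = exp(-i pi) = -1. *)
have := congr1 Re (h (a / Re z)); rewrite /qpow rz -rcM mulrCA mulfV// mulr1.
have -> : - 'i * (pi / a)%:C * a%:C = 'i * (- pi)%:C :> C.
  by rewrite -mulrA -rcM divfK ?gt_eqF// rcN; ring.
rewrite Re_expC Re_iR Im_iR expR0 mul1r cosN cospi => /eqP.
by rewrite -[complex.Re 1]/(1 : R) eq_sym -subr_eq0 opprK gt_eqF.
Qed.

Lemma qpow_int_eq1 (n : int) : q n%:~R = 1 -> n = 0.
Proof.
have qn k : q k%:R = q 1 ^+ k.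
  elim: k => [|k IH]; first by rewrite /qpow mulr0 expC0.
  by rewrite -natr1 qpowD IH exprSr.
have N k : q k.+1%:R != 1.
  by apply: contra (hq (ltn0Sn k)) => /eqP h; rewrite unity_rootE -qn h.
case: n => [[|k]|k] //.
  by move=> h; move: (N k); rewrite h eqxx.
rewrite NegzE mulrNz => h; have := qpowD (- k.+1%:R) k.+1%:R.
by rewrite addNr h mul1r {1}/qpow mulr0 expC0 => e; move: (N k); rewrite -e eqxx.
Qed.

Lemma qpow_exponential : qexponential q (qnum a).
Proof.
split=> //; [exact: qpowD|by move=> z; exact: expC_neq0|exact: qpow_Im|
  exact: qpow_scale_eq0|exact: qpow_int_eq1].
Qed.

End QpowIsExponential.

Section Exponential.
Variables (R : realType) (q br : R[i] -> R[i]).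
Hypothesis Hq : qexponential q br.
Local Notation C := R[i].
Local Notation Re := (@complex.Re R).
Local Notation Im := (@complex.Im R).
Implicit Types (z w : C).

Lemma q0 : q 0 = 1.
Proof. by apply: (mulfI (q_neq0 Hq 0)); rewrite -(qD Hq) addr0 mulr1. Qed.

Lemma qN z : q (- z) = (q z)^-1.
Proof.
by apply: (mulfI (q_neq0 Hq z)); rewrite -(qD Hq) subrr q0 mulfV ?(q_neq0 Hq).
Qed.

Lemma qB z w : q (z - w) = q z / q w.
Proof. by rewrite (qD Hq) qN. Qed.

Lemma qMn z n : q (n%:R * z) = q z ^+ n.
Proof.
by elim: n => [|n IH]; rewrite ?mul0r ?q0// -natr1 mulrDl mul1r (qD Hq) IH exprSr.
Qed.

Lemma q_sum (I : Type) (r : seq I) (P : pred I) (f : I -> C) :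
  q (\sum_(i <- r | P i) f i) = \prod_(i <- r | P i) q (f i).
Proof. by elim/big_rec2: _ => [|i y1 y2 _ <-]; rewrite ?q0// (qD Hq). Qed.

Lemma q_neq1_Im z : Im z != 0 -> q z != 1.
Proof. by apply: contra => /eqP /(q_Im Hq) ->. Qed.

Lemma brN z : br (- z) = - br z.
Proof. by rewrite !(brE Hq) opprK opprB. Qed.

Lemma br0 : br 0 = 0.
Proof. by rewrite (brE Hq) oppr0 subrr. Qed.

Lemma br_eq0 z : (br z == 0) = (q (2 * z) == 1).
Proof.
rewrite (brE Hq) subr_eq0 qN -(inj_eq (mulfI (q_neq0 Hq z))) mulfV ?(q_neq0 Hq)//.
by rewrite -(qD Hq) mulr_natl mulr2n.
Qed.

Lemma br_Im z : Im z != 0 -> br z != 0.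
Proof.
move=> h; rewrite br_eq0; apply: q_neq1_Im.
by rewrite mulr_natl mulr2n cImD -mulr2n mulrn_eq0.
Qed.

Lemma br_int (n : int) : n != 0 -> br n%:~R != 0.
Proof.
move=> h; rewrite br_eq0; apply: contra h => /eqP.
have -> : 2 * n%:~R = (2 * n)%:~R :> C by rewrite intrM.
by move=> /(q_int Hq) /eqP; rewrite mulf_eq0.
Qed.

Lemma br_subE z w : br (w - z) = q (- w - z) * (q (2 * w) - q (2 * z)).
Proof. rewrite (brE Hq) mulrBr -!(qD Hq); congr (q _ - q _); ring. Qed.

Section Nodes.
Variables (I : finType) (P : I -> C).
Hypothesis Pinj : injective (fun p => q (2 * P p)).

Definition nden p : C := \prod_(p' | p' != p) br (P p' - P p).

Lemma ndenE p : (nden p)^-1 =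
  q ((#|I|%:R - 2) * P p) * (\prod_p' q (P p')) / \prod_(p' | p' != p) (q (2 * P p') - q (2 * P p)).
Proof.
transitivity (\prod_(p' | p' != p) (q (P p') * q (P p) / (q (2 * P p') - q (2 * P p)))).
  rewrite /nden -prodfV; apply: eq_bigr => p' _.
  by rewrite br_subE invfM -qN -(qD Hq) opprB opprK addrC.
rewrite big_split /= prodfV; congr (_ / _).
rewrite big_split /= [X in _ = _ * X](bigD1 p)//= [RHS]mulrA [RHS]mulrC; congr (_ * _).
rewrite prodr_const cardC1 -qMn -(qD Hq); congr q.
have : (0 < #|I|)%N by apply/card_gt0P; exists p.
by case: #|I| => // K _ /=; rewrite -natr1; ring.
Qed.

(** In the variables u_p = q^(2 P_p) the summand is a common factor times u_p^f / prod (u_p' - u_p),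
    the half powers of the brackets being collected in [ndenE]. The cardinality condition gives f <=
    #|I| - 2, so [lagrange_sum0] applies. *)
Lemma nden_sum0 (f g : nat) : #|I| = (f + g + 2)%N ->
  \sum_p q ((f%:R - g%:R) * P p) / nden p = 0.
Proof.
move=> cI.
have := @lagrange_sum0 C I (fun p => q (2 * P p)) f Pinj.
rewrite cI addn2 !ltnS leq_addr => /(_ isT) E.
transitivity ((\prod_p q (P p)) * \sum_p q (2 * P p) ^+ f / \prod_(p' | p' != p) (q (2 * P p') - q
  (2 * P p))); last first.
  by rewrite E mulr0.
rewrite mulr_sumr; apply: eq_bigr => p _; rewrite ndenE !mulrA; congr (_ / _).
rewrite [RHS]mulrC; congr (_ * _).
rewrite -qMn -(qD Hq) cI !natrD; congr q; ring.
Qed.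

Definition pfcoef f p : C :=
  (- q (2 * P p)) ^+ f / \prod_(p' | p' != p) (q (2 * P p') - q (2 * P p)).

Lemma pfcoef_sum0 (f g : nat) : #|I| = (f + g + 2)%N -> \sum_p pfcoef f p = 0.
Proof.
move=> cI; have := @lagrange_sum0 C I (fun p => q (2 * P p)) f Pinj.
rewrite cI addn2 !ltnS leq_addr => /(_ isT) E.
rewrite -[RHS](mulr0 ((-1) ^+ f)) -[X in _ * X]E mulr_sumr; apply: eq_bigr => p _.
by rewrite /pfcoef (exprNn (q (2 * P p))) mulrA.
Qed.

Lemma pfcoef_nden (f g : nat) p : #|I| = (f + g + 2)%N ->
  (\prod_p' q (P p')) * pfcoef f p = (-1) ^+ f * (q ((f%:R - g%:R) * P p) / nden p).
Proof.
move=> cI; rewrite ndenE /pfcoef (exprNn (q (2 * P p))) -(qMn _ f).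
have e : q ((f%:R - g%:R) * P p) * q ((#|I|%:R - 2) * P p) = q (f%:R * (2 * P p)).
  rewrite -(qD Hq); congr q; rewrite cI !natrD; ring.
by rewrite -e; ring.
Qed.

(** In u = q^(2 Z) the left side is, up to the constant prod q^(P_p), equal to u u^f / prod (u +
    u_p). Keeping the factor u aside while expanding the rest gives terms u / (u + u_p), which are
    logistic functions when Z = i z. *)
Lemma kernel_decomposition (f g : nat) Z : #|I| = (f + g + 2)%N ->
  (forall p, q (2 * Z) + q (2 * P p) != 0) ->
  q ((f%:R - g%:R) * Z) / \prod_p (q (P p - Z) + q (Z - P p)) =
  (\prod_p q (P p)) * \sum_p pfcoef f p * (q (2 * Z) / (q (2 * Z) + q (2 * P p))).
Proof.
move=> cI xu.
have -> : \sum_p pfcoef f p * (q (2 * Z) / (q (2 * Z) + q (2 * P p))) =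
    q (2 * Z) * (q (2 * Z) ^+ f / \prod_p (q (2 * Z) + q (2 * P p))).
  rewrite (partial_fractions Pinj)//; last by rewrite cI -addnA -{1}[f]addn0 ltn_add2l addn2.
  by rewrite mulr_sumr; apply: eq_bigr => p _; rewrite mulrCA.
have -> : \prod_p (q (P p - Z) + q (Z - P p)) =
    (\prod_p q (P p))^-1 * q (- (#|I|%:R * Z)) * \prod_p (q (2 * Z) + q (2 * P p)).
  rewrite -prodfV qN qMn -prodr_const -prodfV -!big_split /=; apply: eq_bigr => p _.
  rewrite mulrDr -!qN -!(qD Hq) addrC; congr (q _ + q _); ring.
have e : q ((f%:R - g%:R) * Z) = q (2 * Z) * q (2 * Z) ^+ f * q (- (#|I|%:R * Z)).
  rewrite -exprS -(qMn _ f.+1) -(qD Hq); congr q; rewrite cI !natrD -natr1; ring.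
rewrite e !invfM invrK.
have := q_neq0 Hq (- (#|I|%:R * Z)); set E := q (- _) => E0.
have n0 : \prod_p (q (2 * Z) + q (2 * P p)) != 0 by apply/prodf_neq0.
by field; rewrite E0 n0.
Qed.

End Nodes.
End Exponential.

Section BasicIntegral.
Variables (R : realType) (a : R).
Hypothesis a0 : 0 < a.
Hypothesis hq : forall k : nat, (0 < k)%N -> ~~ k.-unity_root (qpow a 1).
Local Notation C := R[i].
Local Notation q := (qpow a).
Local Notation br := (qnum a).
Local Notation Re := (@complex.Re R).
Local Notation Im := (@complex.Im R).
Local Notation mu := (@lebesgue_measure R).
Variables (I : finType) (P : I -> C) (y : R) (f g : nat).
Hypothesis Pinj : injective (fun p => q (2 * P p)).
Hypothesis PRe : forall p, `|Re (P p)| < a / 2.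
Hypothesis y0 : y != 0.
Hypothesis cI : #|I| = (f + g + 2)%N.
Let k := 2 * pi / a.
Let Hq := qpow_exponential a0 hq.
(** The shift of the logistic function attached to the node p, as q^(2 P_p) = exp([om p]). The
    assumption |Re P_p| < a/2 amounts to |Im (om p)| < pi. *)
Let om p : C := - 'i * k%:C * P p.

Lemma scale_gt0 : 0 < k.
Proof. by rewrite divr_gt0// mulr_gt0// pi_gt0. Qed.

Lemma om_Im p : `|Im (om p)| < pi.
Proof.
have -> : Im (om p) = - (k * Re (P p)).
  by rewrite /om mulNr cImM cReN cImN Re_iR Im_iR; ring.
rewrite normrN normrM (gtr0_norm scale_gt0).
have -> : pi = k * (a / 2) by rewrite /k; field; rewrite gt_eqF.
by rewrite ltr_pM2l ?scale_gt0.
Qed.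

Lemma q_om p : q (2 * P p) = expC (om p).
Proof. rewrite /qpow /om /k !rcM rc_nat; congr expC; ring. Qed.

Lemma q_real (z : R) : q (2 * ('i * z%:C)) = expC (k * z)%:C.
Proof.
rewrite /qpow; congr expC; rewrite /k !rcM rc_nat.
transitivity (- ('i * 'i) * (2 * pi%:C * (a^-1)%:C * z%:C) : C); first by ring.
by rewrite ii_m1 opprK mul1r.
Qed.

Lemma q_wave (z : R) : q (2 * ('i * z%:C) * ('i * y%:C)) = wave k y z.
Proof.
rewrite /qpow /wave; congr expC; rewrite /k !rcM rc_nat.
transitivity (- ('i * 'i) * ('i * (2 * pi%:C * (a^-1)%:C * z%:C * y%:C)) : C); first by ring.
by rewrite ii_m1 opprK mul1r; ring.
Qed.

Let c p : C := pfcoef q P f p.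

Lemma basic_decomposition (z : R) :
  q (2 * ('i * z%:C) * ('i * y%:C) + (f%:R - g%:R) * ('i * z%:C)) /
    \prod_p (q (P p - 'i * z%:C) + q ('i * z%:C - P p)) =
  (\prod_p q (P p)) * \sum_p c p * flogB k y (om p) z.
Proof.
have lE p : logistic k (om p) z = q (2 * ('i * z%:C)) / (q (2 * ('i * z%:C)) + q (2 * P p)).
  rewrite q_real q_om /logistic /logden expCD expCN.
  have := expC_neq0 (k * z)%:C; set e := expC (k * z)%:C => e0.
  by rewrite -[1 in LHS](mulfV e0) -mulrDl invf_div.
have xu p : q (2 * ('i * z%:C)) + q (2 * P p) != 0.
  apply/eqP => h; have := invr_neq0 (logden_neq0 k z (om_Im p)).
  by rewrite -/(logistic k (om p) z) lE h invr0 mulr0 eqxx.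
rewrite (qD Hq) q_wave -mulrA (kernel_decomposition Hq Pinj cI xu) mulrCA; congr (_ * _).
(* The c p sum to 0, so [logistic 0] may be subtracted from every term, which makes each of them
   integrable. *)
transitivity (wave k y z * (\sum_p c p * logistic k (om p) z - (\sum_p c p) * logistic k 0 z)).
  rewrite (pfcoef_sum0 Pinj cI) mul0r subr0; congr (_ * _).
  by apply: eq_bigr => p _; rewrite lE.
rewrite mulr_suml -sumrB mulr_sumr; apply: eq_bigr => p _.
by rewrite /flogB; ring.
Qed.

Lemma integrable_basic : integrableC mu (fun z : R =>
  q (2 * ('i * z%:C) * ('i * y%:C) + (f%:R - g%:R) * ('i * z%:C)) /
    \prod_p (q (P p - 'i * z%:C) + q ('i * z%:C - P p))).
Proof.
apply: (@eq_integrableC _ _ R mu (fun z => (\prod_p q (P p)) * \sum_p c p * flogB k y (om p) z)).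
  by move=> z; rewrite basic_decomposition.
apply: integrableCZ; apply: integrableC_sum => p _; apply: integrableCZ.
exact: (integrable_flogB scale_gt0 y (om_Im p)).
Qed.

(** Each term contributes a multiple of exp(i y om_p) - 1. The constants -1 cancel, again because
    the c p sum to 0, and what is left is the exponential of the integrand with i z replaced by the
    nodes. *)
Lemma intC_basic : intC mu (fun z : R =>
  q (2 * ('i * z%:C) * ('i * y%:C) + (f%:R - g%:R) * ('i * z%:C)) /
    \prod_p (q (P p - 'i * z%:C) + q ('i * z%:C - P p))) =
  'i * a%:C / (expR (pi * y) - expR (- (pi * y)))%:C * (-1) ^+ f *
  \sum_p q (2 * P p * ('i * y%:C) + (f%:R - g%:R) * P p) / nden br P p.
Proof.
have ip p := integrable_flogB scale_gt0 y (om_Im p).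
rewrite (eq_intC mu basic_decomposition) intCZ; last first.
  by apply: integrableC_sum => p _; apply: integrableCZ.
rewrite intC_sum; last by move=> p _; apply: integrableCZ.
have cs : \sum_p c p = 0 := pfcoef_sum0 Pinj cI.
set D := (expR (pi * y) - expR (- (pi * y))).
have D0 : D != 0.
  rewrite subr_eq0; apply/eqP => /expR_inj /eqP.
  by rewrite -subr_eq0 opprK -mulr2n mulrn_eq0 /= mulf_eq0 (negbTE y0) gt_eqF// pi_gt0.
have vE p : intC mu (flogB k y (om p)) = 'i * a%:C / D%:C * (expC ('i * y%:C * om p) - 1).
  rewrite (intC_flogB scale_gt0 y0 (om_Im p)) (intC_fdlog0 scale_gt0 y0).
  rewrite -/D; have i0 : 'i != 0 :> C by apply/eqP => /(congr1 Im) /= /eqP; rewrite oner_eq0.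
  have yc0 : y%:C != 0 :> C by rewrite rc_eq0.
  have -> : pi * y / (k * (D / 2)) = a * y / D.
    rewrite /k; have pn : (pi : R) != 0 by rewrite gt_eqF// pi_gt0.
    move: pn; move: (pi) => pi0 pn.
    by field; rewrite D0 pn gt_eqF.
  rewrite !rcM rcV; move: (D%:C) (rc_eq0 D) => d /esym; rewrite (negbTE D0) => /esym/negbT d0.
  transitivity (a%:C / ('i * 'i) * 'i / d * (1 - expC ('i * y%:C * om p))).
    by field; rewrite i0 d0 yc0.
  by rewrite ii_m1; field; rewrite d0.
transitivity ((\prod_p q (P p)) * ('i * a%:C / D%:C * \sum_p c p * expC ('i * y%:C * om p))).
  congr (_ * _); rewrite -[RHS]subr0 -[X in _ - X](mulr0 ('i * a%:C / D%:C)) -[X in _ - _ * X]cs.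
  rewrite -mulrBr -sumrB mulr_sumr; apply: eq_bigr => p _.
  by rewrite (intCZ _ (ip p)) vE; ring.
rewrite mulrCA -[RHS]mulrA; congr (_ * _); rewrite !mulr_sumr; apply: eq_bigr => p _.
have -> : expC ('i * y%:C * om p) = q (2 * P p * ('i * y%:C)).
  rewrite /qpow /om /k; congr expC; rewrite !rcM rc_nat; ring.
by rewrite mulrA (pfcoef_nden Hq _ _ cI) (qD Hq); ring.
Qed.

End BasicIntegral.

(** * Integrals of products of one-variable functions *)

Section ProductIntegral.
Context d1 d2 (T1 : measurableType d1) (T2 : measurableType d2) (R : realType).
Variable m1 : {sigma_finite_measure set T1 -> \bar R}.
Variable m2 : {sigma_finite_measure set T2 -> \bar R}.
Local Notation Re := (@complex.Re R).
Local Notation Im := (@complex.Im R).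

Lemma integrable_prod_mul (f : T1 -> R) (g : T2 -> R) :
  m1.-integrable setT (EFin \o f) -> m2.-integrable setT (EFin \o g) ->
  (m1 \x m2)%E.-integrable setT (fun p => (f p.1 * g p.2)%:E).
Proof.
move=> fi gi.
have mf : measurable_fun setT f by apply/measurable_EFinP; exact: measurable_int fi.
have mg : measurable_fun setT g by apply/measurable_EFinP; exact: measurable_int gi.
have mfg : measurable_fun setT (fun p : T1 * T2 => (f p.1 * g p.2)%:E).
  apply/measurable_EFinP; apply: measurable_funM.
  - exact: measurableT_comp mf measurable_fst.
  - exact: measurableT_comp mg measurable_snd.
apply/(integrable12ltyP _ _ mfg).
have gi' : m2.-integrable setT (EFin \o (fun y => `|g y|)) := integrable_norm gi.
have fi' : m1.-integrable setT (EFin \o (fun y => `|f y|)) := integrable_norm fi.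
under eq_integral => x _.
  under eq_integral => y _ do rewrite /= normrM EFinM.
  rewrite integralZl//.
  over.
rewrite /=.
have -> : (\int[m1]_x (`|f x|%:E * \int[m2]_x0 `|g x0|%:E) =
   \int[m1]_x (`|f x|%:E * (fine (\int[m2]_x0 `|g x0|%:E))%:E))%E.
  by apply: eq_integral => x _; rewrite fineK//; exact: integrable_fin_num gi'.
rewrite integralZr//.
rewrite lte_mul_pinfty//.
- by apply: integral_ge0 => x _; rewrite lee_fin.
- exact: integrable_fin_num fi'.
- by rewrite ltry.
Qed.

Lemma Rintegral_prod_mul (f : T1 -> R) (g : T2 -> R) :
  m1.-integrable setT (EFin \o f) -> m2.-integrable setT (EFin \o g) ->
  Rintegral (m1 \x m2)%E setT (fun p => f p.1 * g p.2) =
  Rintegral m1 setT f * Rintegral m2 setT g.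
Proof.
move=> fi gi; have fgi := integrable_prod_mul fi gi.
rewrite {1}/Rintegral -(integral12_prod_meas1 fgi) /fubini_F /=.
under eq_integral => x _.
  under eq_integral => y _ do rewrite EFinM.
  rewrite integralZl//.
  over.
have gf := integrable_fin_num measurableT gi; have ff := integrable_fin_num measurableT fi.
rewrite /= -(fineK gf) integralZr//.
by rewrite -(fineK ff) /=.
Qed.

Lemma intC_prod_mul (f : T1 -> R[i]) (g : T2 -> R[i]) :
  integrableC m1 f -> integrableC m2 g ->
  integrableC (m1 \x m2)%E (fun p => f p.1 * g p.2) /\
  intC (m1 \x m2)%E (fun p => f p.1 * g p.2) = intC m1 f * intC m2 g.
Proof.
move=> [f1 f2] [g1 g2].
have i11 := integrable_prod_mul f1 g1; have i22 := integrable_prod_mul f2 g2.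
have i12 := integrable_prod_mul f1 g2; have i21 := integrable_prod_mul f2 g1.
split.
  split.
  - by apply: ext_integrable (integrableB measurableT i11 i22) _ => p /=; rewrite cReM.
  - by apply: ext_integrable (integrableD measurableT i12 i21) _ => p /=; rewrite cImM.
apply: eqReIm; rewrite ?cReM ?cImM /=.
- rewrite -!Rintegral_prod_mul// -RintegralB//.
  by apply: eq_Rintegral => p _; rewrite cReM.
- rewrite -!Rintegral_prod_mul// -RintegralD//.
  by apply: eq_Rintegral => p _; rewrite cImM.
Qed.
End ProductIntegral.

Section TupleIntegral.
Variable R : realType.
Local Notation mu := (@lebesgue_measure R).
Local Notation Re := (@complex.Re R).
Local Notation Im := (@complex.Im R).

Lemma intC_lebesgue_cons n (F : n.+1.-tuple (measurableTypeR R) -> R[i]) :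
  measurable_fun setT (fun t => Re (F t)) -> measurable_fun setT (fun t => Im (F t)) ->
  integrableC (mu \x (lebesgue_tuple R n))%E (fun p => F (tuple_cons p)) ->
  integrableC (lebesgue_tuple R n.+1) F /\
  intC (lebesgue_tuple R n.+1) F = intC (mu \x (lebesgue_tuple R n))%E (fun p => F (tuple_cons p)).
Proof.
move=> m1 m2 [i1 i2].
have mc := @measurable_tuple_cons R n.
have e1 : measurable_fun setT (EFin \o (fun t => Re (F t))) by exact/measurable_EFinP.
have e2 : measurable_fun setT (EFin \o (fun t => Im (F t))) by exact/measurable_EFinP.
split.
  split.
  - exact: (integrable_pushforward mc e1 (D := setT) i1 measurableT).
  - exact: (integrable_pushforward mc e2 (D := setT) i2 measurableT).
apply: eqReIm => /=.
- by rewrite /Rintegral; congr fine; exact: (integral_pushforward mc e1 (D := setT) i1 measurableT).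
- by rewrite /Rintegral; congr fine; exact: (integral_pushforward mc e2 (D := setT) i2 measurableT).
Qed.

Lemma measurable_prod_tnth n (h : 'I_n -> R -> R[i]) :
  (forall k, measurable_fun setT (fun t => Re (h k t))) ->
  (forall k, measurable_fun setT (fun t => Im (h k t))) ->
  measurable_fun setT (fun t : n.-tuple (measurableTypeR R) => Re (\prod_k h k (tnth t k))) /\
  measurable_fun setT (fun t : n.-tuple (measurableTypeR R) => Im (\prod_k h k (tnth t k))).
Proof.
move=> m1 m2.
elim: (index_enum 'I_n) => [|k r [IH1 IH2]].
  by split; under eq_fun do rewrite big_nil; exact: measurable_cst.
have k1 : measurable_fun setT (fun t : n.-tuple (measurableTypeR R) => Re (h k (tnth t k))).
  exact: measurableT_comp (m1 k) (measurable_tnth k).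
have k2 : measurable_fun setT (fun t : n.-tuple (measurableTypeR R) => Im (h k (tnth t k))).
  exact: measurableT_comp (m2 k) (measurable_tnth k).
split.
- apply: (eq_measurable_fun (fun t : n.-tuple (measurableTypeR R) =>
    Re (h k (tnth t k)) * Re (\prod_(i <- r) h i (tnth t i)) -
    Im (h k (tnth t k)) * Im (\prod_(i <- r) h i (tnth t i)))).
    by move=> t _; rewrite big_cons cReM.
  by apply: measurable_funB; apply: measurable_funM.
- apply: (eq_measurable_fun (fun t : n.-tuple (measurableTypeR R) =>
    Re (h k (tnth t k)) * Im (\prod_(i <- r) h i (tnth t i)) +
    Im (h k (tnth t k)) * Re (\prod_(i <- r) h i (tnth t i)))).
    by move=> t _; rewrite big_cons cImM.
  by apply: measurable_funD; apply: measurable_funM.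
Qed.

Lemma intC_tuple_prod n (h : 'I_n -> R -> R[i]) :
  (forall k, integrableC mu (h k)) ->
  integrableC (lebesgue_tuple R n) (fun t => \prod_k h k (tnth t k)) /\
  intC (lebesgue_tuple R n) (fun t => \prod_k h k (tnth t k)) = \prod_k intC mu (h k).
Proof.
elim: n h => [|n IH] h hi.
  have E : (fun t : 0.-tuple (measurableTypeR R) => \prod_k h k (tnth t k)) = fun=> 1.
    by apply/funext => t; rewrite big_ord0.
  rewrite E big_ord0; split.
    split.
    - exact: finite_measure_integrable_cst.
    - exact: finite_measure_integrable_cst.
  apply: eqReIm => /=.
  - by rewrite /Rintegral integral_dirac// diracT mul1e.
  - by rewrite /Rintegral integral_dirac// diracT mul1e.
have hm k : measurable_fun setT (fun t => Re (h k t)) /\ measurable_fun setT (fun t => Im (h k t)).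
  have [a b] := hi k; split; apply/measurable_EFinP.
  - exact: measurable_int a.
  - exact: measurable_int b.
have [i1 e1] := IH (fun k => h (lift ord0 k)) (fun k => hi (lift ord0 k)).
have [i2 e2] := intC_prod_mul (m1 := mu) (m2 := lebesgue_tuple R n) (hi ord0) i1.
have [m1 m2] := measurable_prod_tnth (fun k => (hm k).1) (fun k => (hm k).2).
have E (p : measurableTypeR R * n.-tuple (measurableTypeR R)) :
   \prod_k h k (tnth (tuple_cons p) k) = h ord0 p.1 * \prod_k h (lift ord0 k) (tnth p.2 k).
  rewrite big_ord_recl; congr (h ord0 _ * _); apply: eq_bigr => k _.
  by congr (h _ _); rewrite !(tnth_nth 0).
have [j1 j2] := @intC_lebesgue_cons n (fun t => \prod_k h k (tnth t k)) m1 m2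
   (@eq_integrableC _ _ R (mu \x lebesgue_tuple R n)%E _ _ (fun p => esym (E p)) i2).
split=> //; rewrite j2 (eq_intC _ E) e2 e1 big_ord_recl//.
Qed.

Lemma integralC_sum_prod n (I : finType) (b : I -> R[i]) (h : I -> 'I_n -> R -> R[i]) :
  (forall i k, integrableC mu (h i k)) ->
  integralC (fun x : 'rV[R]_n => \sum_i b i * \prod_k h i k (x 0 k)) =
  \sum_i b i * \prod_k intC mu (h i k).
Proof.
move=> hi.
transitivity (intC (lebesgue_tuple R n) (fun t => \sum_i b i * \prod_k h i k (tnth t k))).
  rewrite /integralC /intC; congr (_ +i* _); apply: eq_Rintegral => t _.
  - by congr Re; apply: eq_bigr => i _; congr (_ * _); apply: eq_bigr => k _; rewrite mxE.
  - by congr Im; apply: eq_bigr => i _; congr (_ * _); apply: eq_bigr => k _; rewrite mxE.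
have hp i := intC_tuple_prod (hi i).
rewrite intC_sum; last by move=> i _; apply: integrableCZ; exact: (hp i).1.
by apply: eq_bigr => i _; rewrite intCZ ?(hp i).2//; exact: (hp i).1.
Qed.

End TupleIntegral.

(** * Exponential sums vanishing on hyperplanes *)

Section Characters.
Variables (F : fieldType) (V : zmodType) (I : finType) (chi : I -> V -> F).
Hypothesis chiD : forall i u v, chi i (u + v) = chi i u * chi i v.
Variables (H G : V -> Prop).
Hypothesis HG : forall h g, H h -> G g -> H (h + g).

(* The operator f |-> f(. + g) - chi_{i1}(g) f removes the term of index i1 and rescales
   all the terms whose character agrees with that of i0 on G by the same nonzero factor. *)
Lemma character_component (b : I -> F) (i0 : I) :
  (forall h, H h -> \sum_i b i * chi i h = 0) ->
  forall h, H h -> \sum_(i | `[< forall g, G g -> chi i g = chi i0 g >]) b i * chi i h = 0.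
Proof.
set E := fun i => `[< forall g, G g -> chi i g = chi i0 g >].
have [k] := ubnP #|[pred i | ~~ E i && (b i != 0%R)]|; elim: k b => // k IH b.
rewrite ltnS => bk b0 h Hh.
have [i1 /andP[nE bi1]|no] := pickP (fun i => ~~ E i && (b i != 0)); last first.
  rewrite -[RHS](b0 h Hh) [RHS](bigID E) /= [X in _ = _ + X]big1 ?addr0// => i nE.
  by have := no i; rewrite nE /= => /negbFE/eqP ->; rewrite mul0r.
have /existsNP[g /not_implyP[Gg /eqP ng]] : ~ (forall g, G g ->
  chi i1 g = chi i0 g) by apply/asboolPn.
pose b' i := b i * (chi i g - chi i1 g).
have step h' : \sum_i b' i * chi i h' =
    \sum_i b i * chi i (h' + g) - chi i1 g * \sum_i b i * chi i h'.
  rewrite mulr_sumr -sumrB; apply: eq_bigr => i _; rewrite chiD /b'; ring.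
have := IH b'.
have lt : (#|[pred i | ~~ E i && (b' i != 0%R)]| < k)%N.
  apply: leq_trans bk; apply: proper_card; apply/properP; split.
    apply/fintype.subsetP => i; rewrite !inE => /andP[-> /=]; apply: contra => /eqP b0i.
    by rewrite /b' b0i mul0r.
  by exists i1; rewrite !inE nE //= /b' subrr mulr0 eqxx.
move=> /(_ lt) E1; have E0 := E1 _ h Hh.
have /eqP : (chi i0 g - chi i1 g) * (\sum_(i | E i) b i * chi i h) = 0.
  rewrite mulr_sumr -[RHS]E0.
    apply: eq_bigr => i /asboolP /(_ g Gg) e; rewrite /b' e; ring.
  by move=> h' Hh'; rewrite step !b0 ?mulr0 ?subr0//; exact: HG.
by rewrite mulf_eq0 subr_eq0 eq_sym (negbTE ng) => /eqP.
Qed.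
End Characters.

(** If at most K coefficients were nonzero, the polynomial vanishing at all their nodes except nu t0
    would have degree below K; combining the K relations with its coefficients would leave c t0
    times a nonzero value. *)
Lemma vandermonde_support (F : fieldType) (T : eqType) (r : seq T) (nu c : T ->
  F) (K : nat) (t0 : T) :
  uniq r -> {in r &, injective nu} ->
  (forall s, (s < K)%N -> \sum_(t <- r) c t * nu t ^+ s = 0) ->
  t0 \in r -> c t0 != 0 -> (K < size [seq t <- r | c t != 0%R])%N.
Proof.
move=> ur inj vs t0r ct0; rewrite ltnNge; apply/negP => sK.
set r' := [seq t <- r | c t != 0] in sK.
have t0r' : t0 \in r' by rewrite mem_filter ct0.
pose p : {poly F} := \prod_(t <- rem t0 r') ('X - (nu t)%:P).
have sp : (size p <= K)%N.
  rewrite size_prod_XsubC size_rem//; apply: leq_trans sK.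
  by case: (r') t0r'.
have e : \sum_(t <- r') c t * p.[nu t] = 0.
  transitivity (\sum_(t <- r) c t * p.[nu t]).
    rewrite big_filter [RHS](bigID (fun t => c t != 0)) /= [X in _ = _ + X]big1 ?addr0// => t.
    by move=> /negbNE/eqP ->; rewrite mul0r.
  under eq_bigr => t _ do rewrite (horner_coef_wide _ sp) mulr_sumr.
  rewrite exchange_big /= big1// => s _.
  transitivity (p`_s * \sum_(t <- r) c t * nu t ^+ s); last by rewrite vs ?mulr0.
  by rewrite mulr_sumr; apply: eq_bigr => t _; ring.
have ur' : uniq r' by apply: filter_uniq.
have rp t : t \in r' -> t != t0 -> p.[nu t] = 0.
  move=> tr tt0; apply/eqP; rewrite -[_ == 0]/(root p (nu t)) /p -(big_map nu predT (fun z =>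
    'X - z%:P)) root_prod_XsubC.
  by apply/map_f; rewrite mem_rem_uniq// inE tt0.
move: e; rewrite (big_rem t0)//= big_seq big1 ?addr0; last first.
  by move=> t; rewrite mem_rem_uniq// inE => /andP[tt0 tr]; rewrite rp ?mulr0.
apply/eqP; rewrite mulf_neq0// /p horner_prod prodf_seq_neq0; apply/allP => t.
rewrite mem_rem_uniq// inE => /andP[tt0]; rewrite mem_filter => /andP[_ tr] /=.
rewrite !hornerE subr_eq0; apply: contra tt0 => /eqP /inj -> //.
Qed.

Section ExponentialSums.
Variables (R : realType) (q br : R[i] -> R[i]).
Hypothesis Hq : qexponential q br.
Local Notation C := R[i].
Variable N : nat.
Implicit Types (X Y : 'rV[C]_N).

Lemma bilC X Y : bil X Y = bil Y X.
Proof. by apply: eq_bigr => j _; rewrite mulrC. Qed.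
Lemma bilDr X Y Z : bil X (Y + Z) = bil X Y + bil X Z.
Proof. by rewrite /bil -big_split; apply: eq_bigr => j _; rewrite mxE mulrDr. Qed.
Lemma bilZr X Y (c : C) : bil X (c *: Y) = c * bil X Y.
Proof. by rewrite /bil mulr_sumr; apply: eq_bigr => j _; rewrite mxE mulrCA. Qed.
Lemma bilDl X Y Z : bil (Y + Z) X = bil Y X + bil Z X.
Proof. by rewrite bilC bilDr ![bil X _]bilC. Qed.
Lemma bilZl X Y (c : C) : bil (c *: Y) X = c * bil Y X.
Proof. by rewrite bilC bilZr bilC. Qed.
Lemma bilNl X Y : bil (- Y) X = - bil Y X.
Proof. by rewrite -scaleN1r bilZl mulN1r. Qed.
Lemma bilBl X Y Z : bil (Y - Z) X = bil Y X - bil Z X.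
Proof. by rewrite bilDl bilNl. Qed.
Lemma bilNr X Y : bil X (- Y) = - bil X Y.
Proof. by rewrite bilC bilNl bilC. Qed.
Lemma bilBr X Y Z : bil X (Y - Z) = bil X Y - bil X Z.
Proof. by rewrite bilDr bilNr. Qed.
Lemma bil_delta X j : bil X (delta_mx 0 j) = X 0 j.
Proof.
rewrite /bil (bigD1 j)//= mxE !eqxx mulr1 big1 ?addr0// => i ij.
by rewrite mxE (negbTE ij) andbF mulr0.
Qed.
Lemma bil_root_vec X j k : bil X (root_vec R j k) = X 0 j - X 0 k.
Proof. by rewrite bilBr !bil_delta. Qed.
Lemma bil_col_perm (w : 'S_N) X Y : bil (col_perm w X) (col_perm w Y) = bil X Y.
Proof.
by rewrite [RHS](reindex_inj (@perm_inj _ w)); apply: eq_bigr => j _; rewrite !mxE.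
Qed.

Definition chq X Y : C := q (2 * bil X Y).

Lemma chqDr X Y Z : chq X (Y + Z) = chq X Y * chq X Z.
Proof. by rewrite /chq bilDr mulrDr (qD Hq). Qed.

(** Real multiples of Y stay in the hyperplane, so by [q_scale] the difference of the exponents is
    orthogonal to every real Y with Y_j = Y_k. Testing on e_i, for i other than j and k, and on e_j
    + e_k leaves only the direction e_j - e_k. *)
Lemma chq_line_eq (e e' : 'rV[C]_N) (j k : 'I_N) : j != k ->
  (forall Y, (forall i, complex.Im (Y 0 i) = 0) -> Y 0 j = Y 0 k -> chq e Y = chq e' Y) ->
  e = e' + (e 0 j - e' 0 j) *: root_vec R j k.
Proof.
move=> jk h; set d := e - e'.
have d0 Y : (forall i, complex.Im (Y 0 i) = 0) -> Y 0 j = Y 0 k -> bil d Y = 0.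
  move=> rY Yjk; have : 2 * bil d Y = 0.
    apply: (q_scale Hq) => t.
    have -> : 2 * bil d Y * t%:C = 2 * bil e (t%:C *: Y) - 2 * bil e' (t%:C *: Y).
      by rewrite !bilZr /d bilBl; ring.
    have := h (t%:C *: Y); rewrite !mxE Yjk.
  have rtY i : complex.Im ((t%:C *: Y) 0 i) = 0 by rewrite mxE cImM rY /= mulr0 mul0r addr0.
  move=> /(_ rtY erefl); rewrite /chq (qB Hq) => ->.
    by rewrite mulfV ?(q_neq0 Hq).
  by move/eqP; rewrite mulf_eq0 pnatr_eq0 /= => /eqP.
apply/eqP; rewrite -subr_eq -/d; apply/eqP; apply/rowP => i.
rewrite !mxE !eqxx /=.
have rdelta i' : forall i0, complex.Im ((delta_mx 0 i' : 'rV[C]_N) 0 i0) = 0.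
  by move=> i0; rewrite mxE -rc_nat.
have [->|ij] := eqVneq i j; first by rewrite (negbTE jk) /=; ring.
have [->|ik] := eqVneq i k.
  have := d0 (delta_mx 0 j + delta_mx 0 k).
  have -> : (delta_mx 0 j + delta_mx 0 k : 'rV[C]_N) 0 j =
    (delta_mx 0 j + delta_mx 0 k : 'rV[C]_N) 0 k.
    by rewrite !mxE !eqxx /= [k == j]eq_sym (negbTE jk) addrC.
  have rs i0 : complex.Im ((delta_mx 0 j + delta_mx 0 k : 'rV[C]_N) 0 i0) = 0.
    by rewrite mxE cImD !rdelta addr0.
  move=> /(_ rs erefl).
  rewrite bilDr !bil_delta !mxE => h2; apply/eqP; rewrite -subr_eq0 -[X in _ == X]h2; apply/eqP;
    rewrite /= mulr0n mulr1n; ring.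
have := d0 (delta_mx 0 i) (rdelta i); rewrite bil_delta !mxE !eqxx /= ![_ == i]eq_sym (negbTE ij)
  (negbTE ik).
by move=> /(_ erefl) h2; apply/eqP; rewrite -subr_eq0 -[X in _ == X]h2; apply/eqP;
  rewrite /= mulr0n; ring.
Qed.

Variables (I : finType) (b : I -> C) (x : I -> 'rV[C]_N).

(** The exponents x i may coincide, and only these collected coefficients are determined by the
    sum. *)
Definition tcoef (e : 'rV[C]_N) : C := \sum_(i | x i == e) b i.

Lemma tcoef_neq0 e : tcoef e != 0 -> exists2 i, b i != 0 & x i = e.
Proof.
move=> h; have [i /andP[/eqP xe bi]|no] := pickP (fun i => (x i == e) && (b i != 0)).
  by exists i.
case/eqP: h; apply: big1 => i xe; apply/eqP/negPn/negP => bi.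
by have := no i; rewrite xe bi.
Qed.

(** Translations within Y_j = Y_k separate the exponents into lines parallel to e_j - e_k, so the
    terms of each line vanish by themselves for the 2M+1 values of s. They form a sum of powers of
    the q^(2 e_j), and the Vandermonde argument leaves more than 2M+1 nonzero terms. The condition
    on offsets makes the q^(2 e_j) distinct: if q^(2c) = 1 then Im c = 0, so c is an integer, hence
    0. *)
Lemma exponents_on_line (j k : 'I_N) (M : nat) (e0 : 'rV[C]_N) : j != k ->
  (forall (s : int) Y, (`|s| <= M)%N -> Y 0 j - Y 0 k = s%:~R -> \sum_i b i * chq (x i) Y = 0) ->
  (forall i i' c, x i = x i' + c *: root_vec R j k ->
     complex.Im c != 0 \/ exists s : int, c = s%:~R) ->
  tcoef e0 != 0 ->
  exists r : seq 'rV[C]_N, [/\ uniq r, (M.*2.+2 <= size r)%N &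
    {in r, forall e, tcoef e != 0 /\ exists c, e = e0 + c *: root_vec R j k}].
Proof.
move=> jk van gen te0; have [i0 bi0 xi0] := tcoef_neq0 te0.
pose on i := `[< forall Y, Y 0 j = Y 0 k -> chq (x i) Y = chq (x i0) Y >].
have onP i : on i -> exists c, x i = e0 + c *: root_vec R j k.
  move/asboolP => h; have := chq_line_eq jk (fun Y _ => h Y); rewrite xi0 => ->; by eexists.
have on_of i c : x i = e0 + c *: root_vec R j k -> on i.
  move=> xi; apply/asboolP => Y Yjk; rewrite xi xi0 /chq bilDl bilZl bilC.
  by rewrite [bil (root_vec _ _ _) _]bilC bil_root_vec Yjk subrr mulr0 addr0 bilC.
pose r0 := undup [seq x i | i <- enum I & on i].
pose nu (e : 'rV[C]_N) := q (2 * e 0 j).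
have r0P e : e \in r0 -> exists2 i, on i & x i = e.
  by rewrite mem_undup => /mapP[i1]; rewrite mem_filter => /andP[oi _] xi; exists i1;
    [exact: oi|exact: esym xi].
have ev (s : int) : (`|s| <= M)%N -> \sum_(i | on i) b i * q (2 * (x i 0 j * s%:~R)) = 0.
  move=> sM; have := @character_component C 'rV[C]_N I (fun i => chq (x i)) (fun i => chqDr (x i))
    (fun Y => Y 0 j - Y 0 k = s%:~R) (fun Y => Y 0 j = Y 0 k) _ b i0.
  move=> /(_ _ _ (s%:~R *: delta_mx 0 j)) E; rewrite -[RHS]E.
  - by apply: eq_bigr => i _; rewrite /chq bilZr bil_delta [s%:~R * _]mulrC.
  - by move=> h g; rewrite !mxE => <- ->; ring.
  - by move=> h; apply: van.
  - by rewrite !mxE !eqxx eq_sym (negbTE jk) /=; ring.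
(* The coefficients absorb q^(-2 M e_j), so that the powers 0, ..., 2M of the Vandermonde argument
   stand for the hyperplanes s = -M, ..., M. *)
have := @vandermonde_support C _ r0 nu (fun e =>
  tcoef e * q (2 * (e 0 j * (- M%:Z)%:~R))) M.*2.+1 e0.
set f := [seq _ <- _ | _] => vs.
exists f; split.
- by rewrite filter_uniq// undup_uniq.
- apply: vs.
  + exact: undup_uniq.
  + move=> e e' er e'r; have [i /onP[c xi] <-] := r0P _ er; have [i' /onP[c' xi'] <-] := r0P _ e'r.
    rewrite /nu => E.
    have eij : x i = x i' + (c - c') *: root_vec R j k.
      by rewrite xi xi' scalerBl; apply/rowP => z; rewrite !mxE; ring.
    have q1 : q (2 * (c - c')) = 1.
      have -> : 2 * (c - c') = 2 * x i 0 j - 2 * x i' 0 j.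
        by rewrite xi xi' !mxE !eqxx (negbTE jk) /=; ring.
      by rewrite (qB Hq) E mulfV ?(q_neq0 Hq).
    have := gen _ _ _ eij; case => [ic|[s cs]].
      by case/negP: ic; have := q_Im Hq q1; rewrite mulr_natl mulr2n cImD -mulr2n => /eqP;
        rewrite mulrn_eq0.
    move: q1; rewrite cs -[2]/(2%:~R) -intrM => /(q_int Hq)/eqP; rewrite mulf_eq0 /= => /eqP s0.
    by rewrite eij cs s0 scale0r addr0.
  + move=> s sM.
    have := ev (s%:Z - M%:Z); have -> : (`|s%:Z - M%:Z| <= M)%N by lia.
    move=> /(_ isT) E; rewrite -[RHS]E.
    have q2 i : tcoef (x i) * q (2 * (x i 0 j * (- M%:Z)%:~R)) * nu (x i) ^+ s =
        \sum_(i' | x i' == x i) b i' * q (2 * (x i' 0 j * (s%:Z - M%:Z)%:~R)).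
      rewrite /tcoef -mulrA mulr_suml; apply: eq_bigr => i' /eqP ->.
      rewrite /nu -(qMn Hq) -(qD Hq); congr (_ * q _).
      by rewrite intrB mulrNz -!pmulrn; ring.
    transitivity (\sum_(e <- r0) \sum_(i | x i == e) b i * q (2 * (x i 0 j * (s%:Z - M%:Z)%:~R))).
      by rewrite big_seq [RHS]big_seq; apply: eq_bigr => e /r0P[i _ <-].
    rewrite (exchange_big_dep predT)//= [RHS]big_mkcond; apply: eq_bigr => i _.
    rewrite -big_filter.
    have [oi|noi] := ifPn.
      rewrite (@perm_big _ _ _ _ _ [:: x i]) ?big_seq1//; apply: uniq_perm => //.
        by rewrite filter_uniq// undup_uniq.
      move=> e; rewrite mem_filter inE eq_sym; case: eqP => //= ->.
      by rewrite mem_undup map_f// mem_filter mem_enum oi.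
    rewrite big1_seq// => e /=; rewrite mem_filter => /andP[/eqP xe /r0P[i' /onP[c xi'] xi'e]].
    by case/negP: noi; apply: (on_of _ c); rewrite -xi' xi'e.
  + by rewrite mem_undup -xi0; apply: map_f; rewrite mem_filter mem_enum andbT; apply/asboolP.
  + by rewrite mulf_neq0 ?(q_neq0 Hq).
- move=> e; rewrite mem_filter mulf_eq0 negb_or => /andP[/andP[te _] /r0P[i oi xi]].
  by split=> //; have [c] := onP _ oi; rewrite xi => ->; exists c.
Qed.

Lemma tcoef_sum (f : 'rV[C]_N -> C) :
  (forall i, tcoef (x i) = 0) -> \sum_i b i * f (x i) = 0.
Proof.
move=> h; transitivity (\sum_(e <- undup (codom x)) \sum_(i | x i == e) b i * f (x i)).
  rewrite (exchange_big_dep predT)//=; apply: eq_bigr => i _.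
  rewrite -big_filter (@perm_big _ _ _ _ _ [:: x i]) ?big_seq1//; apply: uniq_perm => //.
    by rewrite filter_uniq// undup_uniq.
  move=> e; rewrite mem_filter inE eq_sym; case: eqP => //= ->.
  by rewrite mem_undup codom_f.
rewrite big_seq big1// => e; rewrite mem_undup => /codomP[i0 ->].
rewrite -[RHS](mul0r (f (x i0))) -[in RHS](h i0) /tcoef mulr_suml.
by apply: eq_bigr => i /eqP ->.
Qed.

End ExponentialSums.

(** * Counting exponents along the roots *)

Section DisjointIntervals.
Variable I : eqType.
Implicit Types (lt : rel I) (lo hi : I -> int).

(** Remove the interval of p0: those of smaller slope num/den end by [lo p0], those of larger slope
    start from [hi p0], and induction applies to both groups. Slopes are kept as integer numerators
    and denominators and compared by cross-multiplication. *)
Lemma sum_disjoint_intervals (r : seq I) (num den lo hi : I -> int) (l u : int) :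
  uniq r -> l <= u ->
  {in r, forall p, l <= lo p /\ hi p <= u /\ lo p <= hi p /\ 0 < den p} ->
  {in r &, forall p p', num p * den p' = num p' * den p -> p = p'} ->
  {in r &, forall p p', num p * den p' < num p' * den p -> hi p <= lo p'} ->
  \sum_(p <- r) (hi p - lo p) <= u - l.
Proof.
move: {2}(size r) (leqnn (size r)) => s; elim: s r l u => [|s IH] [|p0 r] l u //=;
  rewrite ?big_nil ?subr_ge0// => sr /andP[p0r ur] lu H Hi Hs.
have [b0 [b1 [b2 d0]]] := H p0 (mem_head _ _).
pose before p := num p * den p0 < num p0 * den p.
have spl : \sum_(p <- r) (hi p - lo p) =
   \sum_(p <- [seq p <- r | before p]) (hi p - lo p) +
   \sum_(p <- [seq p <- r | ~~ before p]) (hi p - lo p).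
  by rewrite !big_filter (bigID before).
have inr p : p \in r -> p \in p0 :: r by rewrite inE => ->; rewrite orbT.
have h1 : \sum_(p <- [seq p <- r | before p]) (hi p - lo p) <= lo p0 - l.
  apply: IH => //.
  - by rewrite size_filter (leq_trans (count_size _ _)).
  - exact: filter_uniq.
  - move=> p; rewrite mem_filter => /andP[bp pr]; have [? [? [? ?]]] := H p (inr _ pr).
    by do !split=> //; apply: Hs bp; rewrite ?mem_head ?inr.
  - by move=> p p'; rewrite !mem_filter => /andP[_ pr] /andP[_ pr']; apply: Hi; exact: inr.
  - by move=> p p'; rewrite !mem_filter => /andP[_ pr] /andP[_ pr']; apply: Hs; exact: inr.
have h2 : \sum_(p <- [seq p <- r | ~~ before p]) (hi p - lo p) <= u - hi p0.
  apply: IH => //.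
  - by rewrite size_filter (leq_trans (count_size _ _)).
  - exact: filter_uniq.
  - move=> p; rewrite mem_filter => /andP[bp pr]; have [? [? [? ?]]] := H p (inr _ pr).
    do !split=> //; apply: Hs; rewrite ?mem_head ?inr//.
    rewrite lt_neqAle leNgt bp andbT; apply/eqP => e.
    by move: p0r; rewrite (Hi p0 p (mem_head _ _) (inr _ pr) e) pr.
  - by move=> p p'; rewrite !mem_filter => /andP[_ pr] /andP[_ pr']; apply: Hi; exact: inr.
  - by move=> p p'; rewrite !mem_filter => /andP[_ pr] /andP[_ pr']; apply: Hs; exact: inr.
by rewrite big_cons spl; lia.
Qed.
End DisjointIntervals.

(** The lowest digit is divisible by B and smaller than B in absolute value, hence 0; then divide by
    B. *)
Lemma small_digits_eq0 n (c : 'I_n -> int) (B : nat) :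
  (forall i, (`|c i| < B)%N) -> \sum_i c i * B%:Z ^+ i = 0 -> forall i, c i = 0.
Proof.
elim: n c => [|n IH] c cB; first by move=> _ [].
have eB (i : 'I_n) : B%:Z ^+ (lift (@ord0 n) i) = B%:Z * B%:Z ^+ i.
  by rewrite lift0 exprS.
rewrite big_ord_recl expr0 mulr1 => e.
have e' : c ord0 + (\sum_i c (lift ord0 i) * B%:Z ^+ i) * B%:Z = 0.
  rewrite -[RHS]e mulr_suml; congr (_ + _); apply: eq_bigr => i _.
  by rewrite eB; ring.
have c0 : c ord0 = 0.
  have : (B%:Z %| c ord0)%Z.
    apply/dvdzP; exists (- (\sum_i c (lift ord0 i) * B%:Z ^+ i)).
    by apply/eqP; rewrite -subr_eq0 mulNr opprK e'.
  have /= B0 := cB ord0; move/dvdzP => [k ek].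
  apply/eqP; move: B0; rewrite ek abszM -absz_eq0 abszM; case: `|k|%N => //= x.
  by move=> h; exfalso; move: h; rewrite mulSn ltnNge leq_addr.
move: e'; rewrite c0 add0r => /eqP; rewrite mulf_eq0.
have -> : (B%:Z == 0) = false.
  by apply/negP => /eqP [b0]; move: (cB ord0); rewrite b0 ltn0.
rewrite orbF => /eqP e2 i.
case: (unliftP ord0 i) => [j ->|->//].
exact: (IH (fun i => c (lift ord0 i)) (fun i => cB _) e2 j).
Qed.

Section ReflectionCounting.
Variables (N : nat) (T : finType) (v : T -> 'I_N -> int).
Hypothesis vinj : forall t t', (forall i, v t i = v t' i) -> t = t'.
Variables (S : 'S_N -> {set T}) (L : 'S_N -> 'I_N -> 'I_N -> nat) (wd : 'S_N -> int).

Definition collinear (j k : 'I_N) (t0 t : T) : bool :=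
  [forall i, (i != j) && (i != k) ==> (v t i == v t0 i)] &&
  (v t j + v t k == v t0 j + v t0 k).

(** The pairing with -(0, 1, ..., N-1): a step along e_j - e_k changes it by k - j. *)
Definition hgt (t : T) : int := - \sum_(i < N) (i : nat)%:Z * v t i.

Definition refl j k (w : 'S_N) : 'S_N := (tperm j k * w)%g.

Hypothesis L1 : forall w (j k : 'I_N), (j < k)%N -> (1 <= L w j k)%N.
Hypothesis Lsym : forall w (j k : 'I_N), (j < k)%N -> L (refl j k w) j k = L w j k.
Hypothesis line : forall w (j k : 'I_N) t0, (j < k)%N -> t0 \in S w ->
  ((L w j k).*2 <= #|[set t in S w | collinear j k t0 t]| +
                   #|[set t in S (refl j k w) | collinear j k t0 t]|)%N.
Hypothesis wdP : forall w t t', t \in S w -> t' \in S w -> hgt t - hgt t' <= wd w.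

Let reflK j k w : refl j k (refl j k w) = w.
Proof. by rewrite /refl mulgA tperm2 mul1g. Qed.

(** The i-th base B digit of the difference of the values of [g (j, k)] at t and at t'. *)
Let coef (p : T * T * 'I_N * 'I_N * 'I_N) : int :=
  let: (t, t', j, k, i) := p in
  ((k : nat)%:Z - (j : nat)%:Z) * (v t i - v t' i) +
  ((i == k)%:R - (i == j)%:R) * (hgt t - hgt t').

(** Larger than every integer that is read as a base B digit: the values of [coef], and the digits,
    at most 2N, by which the slopes of two pairs are compared. *)
Let B : nat := ((\max_p `|coef p|)%N + N * 2 + 1)%N.

Let h0 (t : T) : int := \sum_i v t i * B%:Z ^+ i.
Let den (p : 'I_N * 'I_N) : int := (p.2 : nat)%:Z - (p.1 : nat)%:Z.
Let num (p : 'I_N * 'I_N) : int := B%:Z ^+ p.2 - B%:Z ^+ p.1.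
(** For j < k, a positive multiple of h0 + (num/den) hgt at the one slope for which this functional
    is constant along e_j - e_k. By the choice of B, points with equal values lie on such a line. *)
Let g p t := den p * h0 t + num p * hgt t.

Let hgt_sub t t' : hgt t - hgt t' = - \sum_(i < N) (i : nat)%:Z * (v t i - v t' i).
Proof.
rewrite /hgt opprK addrC -opprB -sumrB; congr (- _); apply: eq_bigr => i _; ring.
Qed.

Let delta_sum (k : 'I_N) (F : 'I_N -> int) : \sum_i (i == k)%:R * F i = F k.
Proof.
rewrite (bigD1 k)//= eqxx mul1r big1 ?addr0// => i /negbTE ->; by rewrite mul0r.
Qed.

Let g_collinear (j k : 'I_N) t t' : (j < k)%N -> g (j, k) t = g (j, k) t' -> collinear j k t t'.
Proof.
move=> jk e.
have z : \sum_i coef (t', t, j, k, i) * B%:Z ^+ i = 0.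
  transitivity (g (j, k) t' - g (j, k) t); last by rewrite e subrr.
  rewrite /g /den /num /h0 /=.
  under eq_bigr => i _ do rewrite (mulrDl _ _ (_ ^+ _)) -!mulrA (mulrBl _ (_ == _)%:R).
  rewrite big_split /= sumrB !delta_sum -mulr_sumr.
  have -> : \sum_(i < N) (v t' i - v t i) * B%:Z ^+ i =
     \sum_(i < N) v t' i * B%:Z ^+ i - \sum_(i < N) v t i * B%:Z ^+ i.
    by rewrite -sumrB; apply: eq_bigr => i _; rewrite mulrBl.
  ring.
have lt i : (`|coef (t', t, j, k, i)| < B)%N.
  by rewrite /B addn1 ltnS (leq_trans (leq_bigmax (F := fun p =>
    `|coef p|%N) (t', t, j, k, i)))// leq_addr.
have {}z := small_digits_eq0 lt z.
have kj : ((k : nat)%:Z - (j : nat)%:Z) != 0 by lia.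
have kjn : (k == j) = false by apply/negP => /eqP E; move: jk; rewrite E ltnn.
apply/andP; split.
  apply/forallP => i; apply/implyP => /andP[/negbTE ij /negbTE ik].
  move: (z i); rewrite /coef ij ik /= subrr mul0r addr0 => /eqP.
  by rewrite mulf_eq0 (negbTE kj) /= subr_eq0.
have := z k; have := z j; rewrite /coef !eqxx kjn eq_sym kjn /=.
set H := hgt _ - _ => e1 e2.
have : ((k : nat)%:Z - (j : nat)%:Z) * ((v t' j + v t' k) - (v t j + v t k)) = 0.
  transitivity (0 + 0 : int); last by [].
  by rewrite -{1}e1 -e2; ring.
by move/eqP; rewrite mulf_eq0 (negbTE kj) /= subr_eq0.
Qed.

Let collinear_sub (j k : 'I_N) t t' (F : 'I_N -> int) : (j < k)%N -> collinear j k t t' ->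
  \sum_i F i * (v t' i - v t i) = (F j - F k) * (v t' j - v t j).
Proof.
move=> jk /andP[/forallP h /eqP e].
have kj : k != j by apply/negP => /eqP E; move: jk; rewrite E ltnn.
rewrite (bigD1 j)//= (bigD1 k)//= big1 ?addr0.
  have -> : v t' k - v t k = - (v t' j - v t j) by lia.
  ring.
move=> i /andP[ij ik]; move: (h i); rewrite ij ik /= => /eqP ->.
by rewrite subrr mulr0.
Qed.

Let collinear_hgt (j k : 'I_N) t t' : (j < k)%N -> collinear j k t t' ->
  hgt t' - hgt t = den (j, k) * (v t' j - v t j).
Proof.
by move=> jk c; rewrite hgt_sub (collinear_sub _ jk c) /den /=; ring.
Qed.

Let collinear_g (j k : 'I_N) t t' : (j < k)%N -> collinear j k t t' -> g (j, k) t' = g (j, k) t.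
Proof.
move=> jk c; apply/eqP; rewrite -subr_eq0; apply/eqP.
have -> : g (j, k) t' - g (j, k) t = den (j, k) * (h0 t' - h0 t) + num (j, k) * (hgt t' - hgt t).
  by rewrite /g; ring.
have -> : h0 t' - h0 t = \sum_(i < N) B%:Z ^+ i * (v t' i - v t i).
  by rewrite /h0 -sumrB; apply: eq_bigr => i _; ring.
rewrite (collinear_sub _ jk c) (collinear_hgt jk c) /num /den /=; ring.
Qed.

Let top p (w : 'S_N) (t0 : T) : T := [arg max_(t > t0 in S w) g p t]%O.

Let face p w t0 : {set T} := [set t in S w | g p t == g p (top p w t0)].

Let topP p w t0 : t0 \in S w ->
  top p w t0 \in S w /\ (forall t, t \in S w -> g p t <= g p (top p w t0)).
Proof. by move=> t0S; rewrite /top; case: arg_maxP => //= i iS H. Qed.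

(** The points of the face are collinear and determined by their j-th coordinate, so its extreme
    points are at least #|face| - 1 lattice steps apart, each of height k - j. *)
Let face_card (j k : 'I_N) w t0 : (j < k)%N -> t0 \in S w ->
  exists lo hi : T, [/\ lo \in face (j, k) w t0, hi \in face (j, k) w t0 &
    (#|face (j, k) w t0|%:Z - 1) * den (j, k) <= hgt hi - hgt lo].
Proof.
move=> jk t0S; have [tS tm] := topP (j, k) t0S; set F := face _ _ _.
have tF : top (j, k) w t0 \in F by rewrite inE tS eqxx.
pose lo := [arg min_(t < top (j, k) w t0 in F) v t j]%O.
pose hi := [arg max_(t > top (j, k) w t0 in F) v t j]%O.
have [loF lom] : lo \in F /\ forall t, t \in F -> v lo j <= v t j.
  by rewrite /lo; case: arg_minP.
have [hiF him] : hi \in F /\ forall t, t \in F -> v t j <= v hi j.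
  by rewrite /hi; case: arg_maxP.
have cF t t' : t \in F -> t' \in F -> collinear j k t t'.
  by rewrite !inE => /andP[_ /eqP e] /andP[_ /eqP e']; apply: g_collinear; rewrite // e e'.
exists lo, hi; split => //.
rewrite (collinear_hgt jk (cF _ _ loF hiF)) mulrC.
have d0 : 0 < den (j, k) by rewrite /den /=; lia.
rewrite ler_pM2l// lerBlDr.
pose D := `|v hi j - v lo j|%N.
pose f t : 'I_D.+1 := inord `|v t j - v lo j|%N.
have fi : {in F &, injective f}.
  move=> t t' tF' t'F' /(congr1 val) /=; have := lom _ tF'; have := lom _ t'F'.
  have := him _ tF'; have := him _ t'F'; rewrite /D => a1 a2 a3 a4.
  rewrite !inordK ?ltnS; try lia.
  move=> e; have ej : v t j = v t' j by lia.
  apply: vinj => i; have /andP[/forallP h /eqP e2] := cF _ _ t'F' tF'.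
  have [->//|ij] := eqVneq i j; have [->|ik] := eqVneq i k; first by lia.
  by move: (h i); rewrite ij ik => /eqP.
have := card_in_imset fi; have := max_card [in f @: F]; rewrite card_ord => a1 a2.
have := lom _ hiF; rewrite a2 in a1; rewrite /D in a1; lia.
Qed.

Let pairs := [seq p : 'I_N * 'I_N <- index_enum _ | (p.1 < p.2)%N].

Let slope_inj : {in pairs &, forall p p', num p * den p' = num p' * den p -> p = p'}.
Proof.
move=> [j k] [j' k']; rewrite !mem_filter /= => /andP[jk _] /andP[jk' _].
rewrite /num /den /= => e.
pose c i : int := ((i == k)%:R - (i == j)%:R) * ((k' : nat)%:Z - (j' : nat)%:Z) -
   ((i == k')%:R - (i == j')%:R) * ((k : nat)%:Z - (j : nat)%:Z).
have cB i : (`|c i| < B)%N.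
  rewrite /B; have := ltn_ord k; have := ltn_ord k'; have := ltn_ord j; have := ltn_ord j'.
  have := leq0n (\max_p `|coef p|); set mm := (\max_p _)%N.
  by rewrite /c; do 4 case: eqP => _ /=; lia.
have z : \sum_i c i * B%:Z ^+ i = 0.
  transitivity ((B%:Z ^+ k - B%:Z ^+ j) * ((k' : nat)%:Z - (j' : nat)%:Z) -
     (B%:Z ^+ k' - B%:Z ^+ j') * ((k : nat)%:Z - (j : nat)%:Z)); last by rewrite e subrr.
  under eq_bigr => i _.
    have -> : c i * B%:Z ^+ i = ((k' : nat)%:Z - (j' :
      nat)%:Z) * ((i == k)%:R * B%:Z ^+ i - (i == j)%:R * B%:Z ^+ i) - ((k : nat)%:Z - (j :
        nat)%:Z) * ((i == k')%:R * B%:Z ^+ i - (i == j')%:R * B%:Z ^+ i).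
      by rewrite /c; ring.
    over.
  by rewrite sumrB -!mulr_sumr !sumrB !delta_sum; ring.
have {}z := small_digits_eq0 cB z.
have kk : k = k'.
  have := z k; rewrite /c eqxx; do 3 case: eqP => //=; move=> *; subst; try lia.
subst k'; congr (_, _); apply/eqP/negPn/negP => /negbTE jj.
have := z j; rewrite /c eqxx jj; case: eqP => /= [E|_]; first by subst j; lia.
lia.
Qed.

(** Exchange argument: each point is maximal for its own functional, and the positive combination of
    the two inequalities that eliminates h0 compares the heights. *)
Let face_le p p' w t0 t t' : t0 \in S w -> 0 < den p -> 0 < den p' ->
  num p * den p' < num p' * den p -> t \in face p w t0 -> t' \in face p' w t0 ->
  hgt t <= hgt t'.
Proof.
move=> t0S d0 d0' sl; rewrite !inE => /andP[tS /eqP et] /andP[t'S /eqP et'].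
have [_ m1] := topP p t0S; have [_ m2] := topP p' t0S.
have := m1 _ t'S; have := m2 _ tS; rewrite -et -et' /g => a1 a2.
rewrite -subr_ge0 -(pmulr_rge0 _ (x := num p' * den p - num p * den p')) ?subr_gt0//.
have -> : (num p' * den p - num p * den p') * (hgt t' - hgt t) =
  den p * ((den p' * h0 t' + num p' * hgt t') - (den p' * h0 t + num p' * hgt t)) +
  den p' * ((den p * h0 t + num p * hgt t) - (den p * h0 t' + num p * hgt t')) by ring.
by rewrite addr_ge0// mulr_ge0 ?(ltW d0) ?(ltW d0')// subr_ge0.
Qed.

Let faces_width w t0 : t0 \in S w ->
  \sum_(p <- pairs) (#|face p w t0|%:Z - 1) * den p <= wd w.
Proof.
move=> t0S.
have H p : exists lh : T * T, p \in pairs -> [/\ lh.1 \in face p w t0, lh.2 \in face p w t0 &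
    (#|face p w t0|%:Z - 1) * den p <= hgt lh.2 - hgt lh.1].
  case pp : (p \in pairs); last by exists (t0, t0).
  move: pp; rewrite mem_filter => /andP[jk _]; have [lo [hi h]] := face_card jk t0S.
  by exists (lo, hi) => _; case: p jk h.
have [lh lhP] := choice H.
have fS p t : t \in face p w t0 -> t \in S w by rewrite inE => /andP[].
have dp p : p \in pairs -> 0 < den p.
  by rewrite mem_filter /den => /andP[]; lia.
pose l := hgt [arg min_(t < t0 in S w) hgt t]%O.
pose u := hgt [arg max_(t > t0 in S w) hgt t]%O.
have [lu lP uP] : [/\ u - l <= wd w, forall t, t \in S w -> l <= hgt t & forall t, t \in S w ->
  hgt t <= u].
  by rewrite /u /l; case: arg_minP => //= t tS tm; case: arg_maxP => //= t' tS' tm'; split => //;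
    exact: wdP.
apply: le_trans lu.
apply: (le_trans _ (@sum_disjoint_intervals _ pairs num den (fun p => hgt (lh p).1) (fun p =>
  hgt (lh p).2) l u _ _ _ slope_inj _)).
- rewrite big_seq [X in _ <= X]big_seq; apply: ler_sum => p pp.
  by have [] := lhP p pp.
- by rewrite filter_uniq// index_enum_uniq.
- exact: le_trans (lP _ t0S) (uP _ t0S).
- move=> p pp; have [a1 a2 a3] := lhP p pp; split; first exact/lP/(fS p).
  split; first exact/uP/(fS p).
  split; last exact: dp.
  rewrite -subr_ge0; apply: le_trans a3; apply: mulr_ge0; last exact: ltW (dp _ pp).
  have : (0 < #|face p w t0|)%N by apply/card_gt0P; exists (lh p).1.
  lia.
- move=> p p' pp pp' sl; have [_ a2 _] := lhP p pp; have [b1 _ _] := lhP p' pp'.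
  exact: face_le t0S (dp _ pp) (dp _ pp') sl a2 b1.
Qed.

(** Of the maxima of [g (j, k)] over S w and over S (refl j k w), take the larger, say the one over
    S w. All points on its line share this value; those in the other set cannot exceed the maximum
    there, so they attain it. The line count therefore bounds the two faces together. *)
Let face_pair (j k : 'I_N) w t0 t0' : (j < k)%N -> t0 \in S w -> t0' \in S (refl j k w) ->
  ((L w j k).*2 <= #|face (j, k) w t0| + #|face (j, k) (refl j k w) t0'|)%N.
Proof.
wlog H : w t0 t0' / g (j, k) (top (j, k) (refl j k w) t0') <= g (j, k) (top (j, k) w t0).
  move=> W jk h h'; have [/W|/ltW h2] := leP (g (j, k) (top (j, k) (refl j k w) t0')) (g (j,
    k) (top (j, k) w t0)).
    by apply.
  have := W (refl j k w) t0' t0; rewrite reflK => /(_ h2 jk h' h).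
  by rewrite addnC Lsym.
move=> jk h h'.
have [tS tm] := topP (j, k) h; have [tS' tm'] := topP (j, k) h'.
apply: leq_trans (line jk tS) _.
apply: leq_add; apply: subset_leq_card; apply/fintype.subsetP => t; rewrite !inE => /andP[tt c].
- by rewrite tt /= (collinear_g jk c).
- rewrite tt /= eq_le tm'//= (collinear_g jk c); exact: H.
Qed.

Let face_single (j k : 'I_N) w t0 : (j < k)%N -> t0 \in S w -> S (refl j k w) = finset.set0 ->
  ((L w j k).*2 <= #|face (j, k) w t0|)%N.
Proof.
move=> jk h e; have [tS tm] := topP (j, k) h.
apply: leq_trans (line jk tS) _; rewrite e.
have -> : #|[set t in finset.set0 | collinear j k (top (j, k) w t0) t]| = 0%N.
  by apply: eq_card0 => t; rewrite !inE.
rewrite addn0; apply: subset_leq_card; apply/fintype.subsetP => t; rewrite !inE => /andP[tt c].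
by rewrite tt /= (collinear_g jk c).
Qed.

(* Sweep each S w by the functionals h0 + t hgt, where h0 is a base-B expansion: the maximal face is a
   point, except at the slopes t = num p / den p, where it lies on a line parallel to e_j - e_k. The hgt-ranges of
   these segments do not overlap, so their total length is at most wd w. *)
Lemma reflection_counting :
  \sum_(w | S w != finset.set0) \sum_(p : 'I_N * 'I_N | (p.1 < p.2)%N)
     ((L w p.1 p.2)%:Z - 1 + (S (refl p.1 p.2 w) == finset.set0)%:R) * den p <=
  \sum_(w | S w != finset.set0) wd w.
Proof.
have [t0 t0P] : exists t0 : 'S_N -> option T, forall w, S w != finset.set0 ->
  exists2 t, t0 w = Some t & t \in S w.
  exists (fun w => [pick t in S w]) => w; case: pickP => [t tS|e].
    by exists t.
  by case/finset.set0Pn => t; rewrite e.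
pose FF p w := if t0 w is Some t then #|face p w t| else 0%N.
apply: (@le_trans _ _ (\sum_(w | S w != finset.set0) \sum_(p <- pairs) ((FF p w)%:Z - 1) * den p));
  last first.
  apply: ler_sum => w wW; have [t e tS] := t0P w wW.
  by rewrite /FF e; apply: faces_width.
under [X in _ <= X]eq_bigr => w _ do rewrite big_filter.
rewrite exchange_big [X in _ <= X]exchange_big /=; apply: ler_sum => -[j k] /= jk.
rewrite -!mulr_suml ler_wpM2r//; first by rewrite /den /=; lia.
rewrite -subr_ge0 -sumrB big_mkcond /=; set psi := BIG_F.
(* The faces of w and of its reflection are bounded only jointly, so the sum is doubled and each w
   is paired with [refl j k w]. *)
rewrite -(pmulr_rge0 _ (x := 2))// -[2]/(1 + 1) mulrDl !mul1r.
rewrite {2}(reindex_inj (h := refl j k)); last exact: mulgI.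
rewrite -big_split /=; apply: sumr_ge0 => w _; rewrite /psi reflK.
have := @L1 w j k jk; have := Lsym w jk.
have [e1|n1] := altP (S w =P finset.set0);
  have [e2|n2] := altP (S (refl j k w) =P finset.set0) => /= Le L1'.
- by [].
(* When one of the two sets is empty, a single face carries all 2L points, and 2L - 1 >= (L - 1) + 1
   because L >= 1. *)
- have [t et tS] := t0P _ n2; have := @face_single j k _ t jk tS; rewrite reflK => /(_ e1).
  rewrite /FF et Le; lia.
- have [t et tS] := t0P _ n1; have := @face_single j k _ t jk tS e2.
  rewrite /FF et; lia.
- have [t et tS] := t0P _ n1; have [t' et' tS'] := t0P _ n2.
  by have := @face_pair j k _ t t' jk tS tS'; rewrite /FF et et' Le; lia.
Qed.

End ReflectionCounting.

(** * Sums over pairs of indices, and permutations that nearly agree *)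

Lemma card_ord_gt n (i : 'I_n.+1) : #|[pred k : 'I_n.+1 | (i < k)%N]| = (n - i)%N.
Proof.
rewrite -sum1_card; transitivity (\sum_(i.+1 <= k < n.+1) 1)%N; first by rewrite big_geq_mkord.
by rewrite sum_nat_const_nat muln1 subSS.
Qed.

Lemma card_ord_lt n (i : 'I_n) : #|[pred j : 'I_n | (j < i)%N]| = i.
Proof. by rewrite -sum1_card -(big_ord_widen _ (fun=> 1%N)) ?sum1_card ?card_ord// ltnW. Qed.

Section PairSums.
Variables (V : zmodType) (n : nat) (h : 'I_n.+1 -> V).

Lemma sum_pair_left : \sum_(j < n.+1) \sum_(k < n.+1 | (j < k)%N) h j =
  \sum_(i < n.+1) h i *+ (n - i).
Proof. by apply: eq_bigr => j _; rewrite sumr_const card_ord_gt. Qed.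

Lemma sum_pair_right : \sum_(j < n.+1) \sum_(k < n.+1 | (j < k)%N) h k = \sum_(i < n.+1) h i *+ i.
Proof.
by rewrite (exchange_big_dep predT)//=; apply: eq_bigr => k _; rewrite sumr_const card_ord_lt.
Qed.

Lemma sum_pair_add : \sum_(j < n.+1) \sum_(k < n.+1 | (j < k)%N) (h j + h k) = \sum_i h i *+ n.
Proof.
under eq_bigr => j _ do rewrite big_split.
rewrite big_split sum_pair_left sum_pair_right -big_split; apply: eq_bigr => i _ /=.
by rewrite -mulrnDr subnK// leq_ord.
Qed.

Lemma sum_pair_diff :
  \sum_(j < n.+1) \sum_(k < n.+1 | (j < k)%N) (h j - h k) =
    \sum_(i < n.+1) (h i *+ (n - i) - h i *+ i).
Proof.
by rewrite sumrB; under eq_bigr => j _ do rewrite sumrB;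
  rewrite !sumrB sum_pair_left sum_pair_right.
Qed.
End PairSums.

Section PermutationsAgreeing.
Variables (N : nat).
Implicit Types (u w : 'S_N).

Lemma perm_agree_off_pair u w j k : (forall i, i != j -> i != k -> u i = w i) ->
  u = w \/ u = refl j k w.
Proof.
move=> h.
have mem p : p = j \/ p = k -> u p = w j \/ u p = w k.
  move=> pjk; have [p' e] : exists p', u p = w p' by exists ((w^-1)%g (u p)); rewrite permKV.
  rewrite e; have [pj|pj] := eqVneq p' j; first by rewrite pj; left.
  have [pk|pk] := eqVneq p' k; first by rewrite pk; right.
  have := h _ pj pk; rewrite -e => /perm_inj e'; move: pj pk; rewrite e'.
  by case: pjk => ->; rewrite eqxx.
have hi i : i = j \/ i = k \/ (i != j /\ i != k).
  by have [->|ij] := eqVneq i j; [left|have [->|ik] := eqVneq i k; [right; left|right; right]].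
case: (mem j (or_introl erefl)) => [ej|ej].
  left; apply/permP => i; case: (hi i) => [->//|[->|[ij ik]]]; last exact: h.
  case: (mem k (or_intror erefl)) => // ek.
  by have -> : k = j by apply: (@perm_inj _ u); rewrite ek ej.
right; apply/permP => i; rewrite /refl permM; case: (hi i) => [->|[->|[ij ik]]].
- by rewrite tpermL.
- rewrite tpermR; case: (mem k (or_intror erefl)) => // ek.
  have kj : k = j by apply: (@perm_inj _ u); rewrite ek ej.
  by move: ek; rewrite kj.
- by rewrite tpermD 1?eq_sym// h.
Qed.

Let agree_aux a b u w j k p : p != j -> p != k -> w p = a ->
  (forall i, i != j -> i != k -> u i = w i \/ u i = tperm a b (w i)) ->
  exists2 s, s = 1%g \/ s = tperm a b & (u * s = w \/ u * s = refl j k w)%g.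
Proof.
move=> pj pk wp h.
have [s s1 sp] : exists2 s, s = 1%g \/ s = tperm a b & s (u p) = a.
  case: (h p pj pk); rewrite wp => up; first by exists 1%g; [left|rewrite perm1].
  by exists (tperm a b); [right|rewrite up tpermK].
exists s => //; apply: perm_agree_off_pair => i ij ik; rewrite permM.
have [->|ip] := eqVneq i p; first by rewrite sp wp.
have wa : w i != a by rewrite -wp (inj_eq perm_inj).
have ua : s (u i) != a by rewrite -sp !(inj_eq perm_inj).
have [wb|wb] := eqVneq (w i) b.
  move: ua; case: (h i ij ik) => ->; case: s1 => ->; rewrite ?perm1 wb ?tpermR ?tpermL ?eqxx //.
have tw : tperm a b (w i) = w i by rewrite tpermD // eq_sym.
by case: (h i ij ik) => ->; case: s1 => ->; rewrite ?perm1 ?tw.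
Qed.

(** If w takes the value a or b at some index other than j and k, the value of u there decides which
    s to use; otherwise the transposition fixes all the w i in question and s = 1 works. Then u s
    and w agree off {j, k}. *)
Lemma perm_agree_mod_tperm a b u w j k :
  (forall i, i != j -> i != k -> u i = w i \/ u i = tperm a b (w i)) ->
  exists2 s, s = 1%g \/ s = tperm a b & (u * s = w \/ u * s = refl j k w)%g.
Proof.
move=> h; set pa := (w^-1)%g a; set pb := (w^-1)%g b.
have wa : w pa = a by rewrite permKV.
have wb : w pb = b by rewrite permKV.
have [/andP[aj ak]|na] := boolP ((pa != j) && (pa != k)).
  exact: agree_aux aj ak wa h.
have [/andP[bj bk]|nb] := boolP ((pb != j) && (pb != k)).
  by rewrite tpermC; apply: agree_aux bj bk wb _; rewrite tpermC.
exists 1%g; first by left.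
rewrite mulg1; apply: perm_agree_off_pair => i ij ik.
have ia : w i != a.
  apply: contra na => /eqP e; have -> : pa = i by apply: (@perm_inj _ w); rewrite wa e.
  by rewrite ij ik.
have ib : w i != b.
  apply: contra nb => /eqP e; have -> : pb = i by apply: (@perm_inj _ w); rewrite wb e.
  by rewrite ij ik.
by case: (h i ij ik) => //; rewrite tpermD // eq_sym.
Qed.

Lemma perm_agree_all_mod_tperm a b u w :
  (forall i, u i = w i \/ u i = tperm a b (w i)) -> u = w \/ u = (w * tperm a b)%g.
Proof.
move=> h; set pa := (w^-1)%g a.
have wa : w pa = a by rewrite permKV.
have [s s1 [|]] := @perm_agree_mod_tperm a b u w pa pa (fun i _ _ => h i).
  by case: s1 => -> <-; [left; rewrite mulg1|right; rewrite -mulgA tperm2 mulg1].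
rewrite /refl tperm1 mul1g.
by case: s1 => -> <-; [left; rewrite mulg1|right; rewrite -mulgA tperm2 mulg1].
Qed.
End PermutationsAgreeing.

(** * Weights in the zonotope and their heights *)

Section Weights.
Variables (n M : nat).

Definition box := {ffun 'I_n.+1 -> 'I_(M * n).+1}.

(* The weights z - Mn/2 lying in the zonotope spanned by the (M/2)(e_j - e_k). *)
Definition admissible (z : box) : Prop := forall h : 'I_n.+1 -> int,
  \sum_i h i * ((z i)%:Z *+ 2 - (M * n)%:Z) <=
  M%:Z * \sum_(j < n.+1) \sum_(k < n.+1 | (j < k)%N) `|h j - h k|.

Definition zrho : box := [ffun i : 'I_n.+1 => inord (M * (n - i))].

Lemma zrhoE i : zrho i = (M * (n - i))%N :> nat.
Proof. by rewrite ffunE inordK// ltnS leq_mul2l leq_subr orbT. Qed.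

Definition sumdist : int := \sum_(p : 'I_n.+1 * 'I_n.+1 | (p.1 < p.2)%N) ((p.2 : nat)%:Z - (p.1 :
  nat)%:Z).

Definition height (z : box) : int := - \sum_(i < n.+1) (i : nat)%:Z * (z i)%:Z.

Lemma sumdistE (F : 'I_n.+1 -> 'I_n.+1 -> int) :
  (forall j k : 'I_n.+1, (j < k)%N -> F j k = (k : nat)%:Z - (j : nat)%:Z) ->
  \sum_(j < n.+1) \sum_(k < n.+1 | (j < k)%N) F j k = sumdist.
Proof.
by move=> h; rewrite pair_big_dep /=; apply: eq_bigr => -[j k] /= jk; rewrite h.
Qed.

Let hI : int := \sum_(i < n.+1) (i : nat)%:Z.

Let heightE z : height z *+ 2 + (M * n)%:Z * hI =
  \sum_(i < n.+1) (- (i : nat)%:Z) * ((z i)%:Z *+ 2 - (M * n)%:Z).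
Proof.
rewrite /height /hI mulr_sumr -sumrN -sumrMnl -big_split.
by apply: eq_bigr => i _ /=; ring.
Qed.

Lemma height_bounds z : admissible z ->
  `|height z *+ 2 + (M * n)%:Z * hI| <= M%:Z * sumdist.
Proof.
move=> az; rewrite ler_norml heightE; apply/andP; split.
- have := az (fun i => (i : nat)%:Z); rewrite sumdistE; last by move=> j k jk; lia.
  rewrite lerNl -sumrN; congr (_ <= _).
  by apply: eq_bigr => i _; rewrite mulNr opprK.
- by have := az (fun i => - (i : nat)%:Z); rewrite sumdistE // => j k jk; lia.
Qed.

(** The functional -i is then an equality case of admissibility. Doubled, it drops by 2 at each
    step, so it stays decreasing after adding 1 or -1 at one index, and the bounds for the two
    perturbed functionals fix that coordinate from both sides. *)
Lemma height_zrho z : admissible z ->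
  height z *+ 2 + (M * n)%:Z * hI = M%:Z * sumdist -> z = zrho.
Proof.
move=> az e.
have D (h : 'I_n.+1 -> int) : (forall j k : 'I_n.+1, (j < k)%N -> h k <= h j) ->
    \sum_(i < n.+1) h i * ((z i)%:Z - (M * (n - i))%:Z) <= 0.
  move=> hd; rewrite -(pmulrn_lle0 _ (n := 2))// -sumrMnl.
  have := az h; rewrite -subr_le0.
  have -> : \sum_(j < n.+1) \sum_(k < n.+1 | (j < k)%N) `|h j - h k| =
    \sum_(j < n.+1) \sum_(k < n.+1 | (j < k)%N) (h j - h k).
    by apply: eq_bigr => j _; apply: eq_bigr => k jk; rewrite ger0_norm// subr_ge0 hd.
  rewrite sum_pair_diff mulr_sumr -sumrB; congr (_ <= _); apply: eq_bigr => i _.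
  have := leq_ord i => le; rewrite -[h i *+ i]mulr_natr -[h i *+ (n - i)]mulr_natr natrB//.
  rewrite !natz !PoszM -subzn//; ring.
have D0 : \sum_(i < n.+1) (- (i : nat)%:Z) * ((z i)%:Z - (M * (n - i))%:Z) = 0.
  have : (\sum_(i < n.+1) (- (i : nat)%:Z) * ((z i)%:Z - (M * (n - i))%:Z)) *+ 2 = 0.
    move: e; rewrite -(@sumdistE (fun j k => - (j : nat)%:Z - - (k : nat)%:Z));
      last by move=> j k _; ring.
    rewrite sum_pair_diff => /eqP; rewrite -subr_eq0 => /eqP e; rewrite -[RHS]e.
    rewrite heightE mulr_sumr -sumrB -sumrMnl; apply: eq_bigr => i _ /=.
    have := leq_ord i => le; rewrite -[_ *+ i]mulr_natr -[_ *+ (n - i)]mulr_natr natrB//.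
    rewrite !natz !PoszM -subzn//; ring.
  by move/eqP; rewrite mulrn_eq0 => /eqP.
apply/ffunP => i; apply: val_inj; rewrite /= zrhoE; apply/eqP.
rewrite -eqz_nat eq_le; apply/andP.
have Dp (c : int) : `|c| = 1 -> c * ((z i)%:Z - (M * (n - i))%:Z) <= 0.
  move=> c1; have := D (fun i' => (- (i' : nat)%:Z) *+ 2 + (i' == i)%:R * c).
  under eq_bigr => i' _ do rewrite mulrDl.
  rewrite big_split /=.
  have -> : \sum_(i' < n.+1) (- (i' : nat)%:Z) *+ 2 * ((z i')%:Z - (M * (n - i'))%:Z) = 0.
    transitivity ((\sum_(i' < n.+1) (- (i' : nat)%:Z) * ((z i')%:Z - (M * (n - i'))%:Z)) *+ 2).
      by rewrite -sumrMnl; apply: eq_bigr => i' _; rewrite mulrnAl.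
    by rewrite D0 mul0rn.
  rewrite add0r (bigD1 i)//= eqxx mul1r big1 ?addr0; last by move=> i' /negbTE ->;
    rewrite mul0r mul0r.
  by apply=> j k jk; do 2 case: eqP => _ /=; lia.
split.
- by have := Dp 1 (normr1 _); lia.
- by have := Dp (-1) (normrN1 _); lia.
Qed.
End Weights.

(** * Rigidity of alternating frames of exponents *)

Section Uniqueness.
Variables (R : realType) (q br : R[i] -> R[i]).
Hypothesis Hq : qexponential q br.
Local Notation C := R[i].
Local Notation Im := (@complex.Im R).
Variables (n M : nat).
Local Notation N := n.+1.
Local Notation chq := (chq q).

Definition vec (z : box n M) : 'rV[C]_N := \row_i ((z i)%:R - (M * n)%:R / 2).

(** When X_a0 - X_b0 = r is an integer, a weight of the frame w s rewritten relative to w X moves by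
    at most |r| <= M in a coordinate; the box is widened by M on either side to hold it. *)
Let wbox := {ffun 'I_N -> 'I_(M * n + M.*2).+1}.
Let wvec (t : wbox) : 'rV[C]_N := \row_i ((t i)%:R - M%:R - (M * n)%:R / 2).
Let tv (t : wbox) (i : 'I_N) : int := (t i)%:Z.

Let tv_inj t t' : (forall i, tv t i = tv t' i) -> t = t'.
Proof. by move=> h; apply/ffunP => i; apply: val_inj; case: (h i). Qed.

Let shift (z : box n M) (e : 'I_N -> int) : wbox :=
  [ffun i => inord (absz ((z i)%:Z + M%:Z - e i)%R)].

Let shiftE z e i : (`|e i| <= M)%N -> ((shift z e i : nat)%:Z = (z i)%:Z + M%:Z - e i)%R.
Proof.
move=> le; rewrite ffunE inordK; last by have := ltn_ord (z i); lia.
by have := ltn_ord (z i); lia.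
Qed.

Section Lines.
Variables (I : finType) (b : I -> C) (x : I -> 'rV[C]_N) (X : 'rV[C]_N) (a0 b0 : 'I_N) (r : int).
Local Notation s := (tperm a0 b0).
Hypothesis hIm : forall i i', Im (X 0 i) = Im (X 0 i') -> i' = i \/ i' = s i.
Hypothesis hr : X 0 a0 - X 0 b0 = r%:~R.
Hypothesis rM : (`|r| <= M)%N.
Hypothesis hx : forall i, exists w z, (b i != 0 -> admissible z) /\ x i = col_perm w X + vec z.
Hypothesis van : forall (j k : 'I_N) (t : int) (Y : 'rV[C]_N), (j < k)%N -> (`|t| <= M)%N ->
  Y 0 j - Y 0 k = t%:~R -> \sum_i b i * chq (x i) Y = 0.

Let dd (i : 'I_N) : int := (i == b0)%:R * r - (i == a0)%:R * r.

Let Xs i : X 0 (s i) = X 0 i + (dd i)%:~R.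
Proof.
have Xa : X 0 a0 = X 0 b0 + r%:~R by rewrite -hr; ring.
rewrite /dd; case: tpermP => [->|->|/eqP ia /eqP ib].
- rewrite eqxx; case: eqP => [ab|_]; last by rewrite Xa /= ?mulr0n ?mulr1n mul0r mul1r sub0r
  mulrNz; ring.
  by rewrite mul1r subrr addr0 -ab.
- rewrite eqxx [b0 == a0]eq_sym; case: eqP => [ab|_];
  last by rewrite Xa /= ?mulr0n ?mulr1n mul0r mul1r subr0.
  by rewrite mul1r subrr addr0 ab.
- by rewrite (negbTE ia) (negbTE ib) !mul0r subr0 addr0.
Qed.

(** Two situations are treated together: X generic, as the case a0 = b0 and r = 0, and X generic up
    to one integer difference X_a0 - X_b0. In the second, exponents of the frames w and w s may
    coincide, so supports are defined by the collected coefficients, and one exponent can appear in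
    both. *)
Definition frame_support (w : 'S_N) : {set wbox} :=
  [set t | tcoef b x (col_perm w X + wvec t) != 0]%SET.
Local Notation S := frame_support.

(** If exchanging the positions j and k exchanges a0 and b0, then [refl j k w] = w s and every
    exponent on the line is counted in both supports, which doubles the bound. *)
Definition frame_mult (w : 'S_N) (j k : 'I_N) : nat :=
  (M.+1 * (if tperm (w j) (w k) == s then 2 else 1))%N.

Let frame_change w z sg : sg = 1%g \/ sg = s ->
  exists2 e : 'I_N -> int, (forall i, `|e i| <= M)%N & 
  col_perm w X + vec z = col_perm (w * sg)%g X + wvec (shift z e) /\
  (forall i, e i = if sg == 1%g then 0 else dd (w i)).
Proof.
move=> h; pose e (i : 'I_N) : int := if sg == 1%g then 0 else dd (w i).
have eM i : (`|e i| <= M)%N by rewrite /e; case: ifP => // _; rewrite /dd; do 2 case: eqP => _ /=;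
  lia.
exists e => //; split=> //; apply/rowP => i; rewrite !mxE permM.
have -> : ((shift z e i : nat)%:R : C) = (z i)%:R + M%:R - (e i)%:~R.
  by rewrite [LHS]pmulrn shiftE// intrB intrD -!pmulrn.
rewrite /e.
case: h => ->; first by rewrite eqxx perm1; ring.
case: eqP => [E|_]; last by rewrite Xs; ring.
by rewrite E perm1; ring.
Qed.

(** Along e_j - e_k only the coordinates j and k move; at the others the imaginary parts force the
    frame u of the exponent to agree with w up to s. *)
Let key w (j k : 'I_N) t0 e (c : C) : tcoef b x e != 0 ->
  e = col_perm w X + wvec t0 + c *: root_vec R j k ->
  exists (u : 'S_N) z, [/\ e = col_perm u X + vec z &
    exists2 sg, sg = 1%g \/ sg = s & (u * sg = w \/ u * sg = refl j k w)%g].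
Proof.
move=> te ee; have [i bi xi] := tcoef_neq0 te; have [u [z [_ xi']]] := hx i.
exists u, z; split; first by rewrite -xi'.
apply: perm_agree_mod_tperm => p pj pk; apply: hIm.
have : (col_perm u X + vec z) 0 p = (col_perm w X + wvec t0 + c *: root_vec R j k) 0 p.
  by rewrite -ee -xi' xi.
rewrite !mxE !eqxx /= (negbTE pj) (negbTE pk) subrr mulr0 addr0.
move=> /(congr1 Im); rewrite !(cImD, cImN).
have Imn (m : nat) : Im (m%:R : C) = 0 by rewrite -rc_nat.
have -> : Im ((M * n)%:R / 2 : C) = 0 by rewrite -!rc_nat -rcV -rcM.
by rewrite !Imn !(oppr0, addr0) => ->.
Qed.

Let frame_collinear w w1 (j k : 'I_N) t0 t (c : C) : (j < k)%N ->
  w1 = w \/ w1 = refl j k w ->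
  col_perm w1 X + wvec t = col_perm w X + wvec t0 + c *: root_vec R j k ->
  collinear tv j k t0 t.
Proof.
move=> jk hw e.
have kj : (k == j) = false by apply/negP => /eqP E; move: jk; rewrite E ltnn.
have ei i := congr1 (fun v : 'rV[C]_N => v 0 i) e.
apply/andP; split.
  apply/forallP => i; apply/implyP => /andP[/negbTE ij /negbTE ik].
  have := ei i; rewrite !mxE !eqxx /= ij ik subrr mulr0 addr0.
  have -> : w1 i = w i by case: hw => ->//; rewrite /refl permM tpermD // eq_sym ?ij ?ik.
  by move=> h; rewrite /tv eqz_nat -(eqr_nat C); apply/eqP; move: h => /addrI /addIr /addIr.
have wjk : X 0 (w1 j) + X 0 (w1 k) = X 0 (w j) + X 0 (w k).
  by case: hw => ->//; rewrite /refl !permM tpermL tpermR addrC.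
have := ei j; have := ei k; rewrite !mxE !eqxx /= [j == k]eq_sym kj /= => ek ej.
rewrite /tv -!PoszD eqz_nat -(eqr_nat C) !natrD; apply/eqP.
have E : (X 0 (w1 j) + X 0 (w1 k)) + ((t j)%:R + (t k)%:R) =
  (X 0 (w j) + X 0 (w k)) + ((t0 j)%:R + (t0 k)%:R) :> C.
  transitivity ((X 0 (w1 j) + ((t j)%:R - M%:R - (M * n)%:R / 2)) + (X 0 (w1 k) +
    ((t k)%:R - M%:R - (M * n)%:R / 2)) + (M%:R + M%:R + (M * n)%:R / 2 + (M * n)%:R / 2));
      first by ring.
  rewrite ej ek; ring.
by move: E; rewrite wjk => /addrI.
Qed.

(** Each of the at least 2M+2 exponents on the line has a frame u such that u or u s is w or
    [refl j k w], so together they inject into the two sets; in the doubled case each exponent has a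
    representative in both. *)
Lemma frame_line_count w (j k : 'I_N) t0 : (j < k)%N -> t0 \in S w ->
  ((frame_mult w j k).*2 <= #|[set t in S w | collinear tv j k t0 t]| +
     #|[set t in S (refl j k w) | collinear tv j k t0 t]|)%N.
Proof.
move=> jk; rewrite inE => te0.
have jk' : j != k by apply/eqP => E; move: jk; rewrite E ltnn.
have gen i i' c : x i = x i' + c *: root_vec R j k ->
     complex.Im c != 0 \/ exists s : int, c = s%:~R.
  move=> e; have [u [z [_ xi]]] := hx i; have [u' [z' [_ xi']]] := hx i'.
  have := congr1 (fun v : 'rV[C]_N => v 0 j) e.
  rewrite xi xi' !mxE !eqxx /= (negbTE jk') subr0 mulr1 => ej.
  have ce : c = X 0 (u j) - X 0 (u' j) + ((z j)%:Z - (z' j)%:Z)%:~R.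
    rewrite intrB -!pmulrn; apply: (addrI (X 0 (u' j) + ((z' j)%:R - (M * n)%:R / 2))).
    by rewrite -ej; ring.
  have [ic|] := eqVneq (Im c) 0; [right|by left].
  have : Im (X 0 (u j)) = Im (X 0 (u' j)).
    have : Im c = Im (X 0 (u j)) - Im (X 0 (u' j)).
      by rewrite ce !(cImD, cImN) -(rmorph_int (real_complex R)) /= addr0.
    by rewrite ic => /esym/eqP; rewrite subr_eq0 => /eqP.
  move=> /hIm[E|E]; rewrite ce E ?Xs.
    by exists ((z j)%:Z - (z' j)%:Z); rewrite subrr add0r.
  by exists ((z j)%:Z - (z' j)%:Z - dd (u j)); rewrite !intrB; ring.
have [rr [ur sr hrr]] := exponents_on_line Hq jk' (fun t Y => @van j k t Y jk) gen te0.
set A := [set t in S w | _]%SET; set B := [set t in S _ | _]%SET.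
pose fA t := col_perm w X + wvec t; pose fB t := col_perm (refl j k w) X + wvec t.
have rep e u z w1 sg (c : C) : tcoef b x e != 0 ->
  e = col_perm w X + wvec t0 + c *: root_vec R j k ->
    e = col_perm u X + vec z -> sg = 1%g \/ sg = s -> (u * sg = w1)%g ->
    w1 = w \/ w1 = refl j k w ->
    e \in [seq col_perm w1 X + wvec t | t <- enum [set t in S w1 | collinear tv j k t0 t]%SET].
  move=> te ee eu hsg uw hw1.
  have [e' _ [E _]] := frame_change u z hsg.
  apply/mapP; exists (shift z e'); last by rewrite eu E uw.
  rewrite mem_enum !inE -uw -E -eu te andTb.
  by apply: (frame_collinear jk hw1 (c := c)); rewrite -uw -E -eu.
have sz : (size rr <= #|A| + #|B|)%N.
  have -> : (#|A| + #|B|)%N = size ([seq fA t | t <- enum A] ++ [seq fB t | t <- enum B]).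
    by rewrite size_cat !size_map -!cardE.
  apply: uniq_leq_size ur _ => e /hrr[te [c ee]]; rewrite mem_cat.
  have [u [z [eu [sg hsg hw]]]] := key te ee; apply/orP.
  case: hw => hw; [left|right].
  - by apply: (rep e u z w sg c) => //; left.
  - by apply: (rep e u z (refl j k w) sg c) => //; right.
rewrite /frame_mult; case: eqP => [es|_]; last first.
  by apply: leq_trans sz; rewrite muln1 doubleS.
have ws : (w * s = refl j k w)%g.
  apply/permP => i; rewrite /refl !permM -es.
  case: (tpermP j k i) => [->|->|/eqP ij /eqP ik]; rewrite ?tpermL ?tpermR//.
  by rewrite tpermD // (inj_eq perm_inj) eq_sym.
have both e : e \in rr -> e \in [seq fA t | t <- enum A] /\ e \in [seq fB t | t <- enum B].
  move=> /hrr[te [c ee]]; have [u [z [eu [sg hsg hw]]]] := key te ee.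
  have hsg' : (sg * s = 1 \/ sg * s = s)%g.
    by case: hsg => ->; [right; rewrite mul1g|left; rewrite tperm2].
  case: hw => hw; split.
  - by apply: (rep e u z w sg c) => //; left.
  - by apply: (rep e u z (refl j k w) (sg * s)%g c) => //; [rewrite mulgA hw|right].
  - apply: (rep e u z w (sg * s)%g c) => //; last by left.
    by rewrite mulgA hw -ws -mulgA tperm2 mulg1.
  - by apply: (rep e u z (refl j k w) sg c) => //; right.
have sA : (size rr <= #|A|)%N.
  by rewrite cardE -(size_map fA); apply: uniq_leq_size ur _ => e /both[].
have sB : (size rr <= #|B|)%N.
  by rewrite cardE -(size_map fB); apply: uniq_leq_size ur _ => e /both[].
have := leq_add (leq_trans sr sA) (leq_trans sr sB); lia.
Qed.

Lemma frame_counting (wd : 'S_N -> int) :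
  (forall w t t', t \in S w -> t' \in S w -> hgt tv t - hgt tv t' <= wd w) ->
  \sum_(w | S w != finset.set0) \sum_(p : 'I_N * 'I_N | (p.1 < p.2)%N)
     ((frame_mult w p.1 p.2)%:Z - 1 + (S (refl p.1 p.2 w) == finset.set0)%:R) *
     ((p.2 : nat)%:Z - (p.1 : nat)%:Z) <=
  \sum_(w | S w != finset.set0) wd w.
Proof.
move=> h; apply: (reflection_counting tv_inj _ _ frame_line_count h).
- by move=> w j k jk; rewrite /frame_mult; case: ifP.
- move=> w j k jk; rewrite /frame_mult /refl !permM tpermL tpermR tpermC.
  done.
Qed.

(** The exponent comes from the frame w or, when d holds, from w s; the integer displacement then
    shifts the height by r times the signed distance between the positions of a0 and b0 in w. *)
Lemma frame_heightP w t : t \in S w -> exists z (d : bool), [/\ admissible z,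
  col_perm w X + wvec t = col_perm (if d then w * s else w)%g X + vec z &
  hgt tv t = height z - M%:Z * (\sum_(i < N) (i : nat)%:Z) -
    d%:R * (r * (((w^-1)%g b0 : nat)%:Z - ((w^-1)%g a0 : nat)%:Z))].
Proof.
rewrite inE => te; have [i bi xi] := tcoef_neq0 te; have [u [z [az xi']]] := hx i.
have e : col_perm w X + wvec t = col_perm u X + vec z by rewrite -xi -xi'.
have Imn (m : nat) : Im (m%:R : C) = 0 by rewrite -rc_nat.
have Im2 : Im ((M * n)%:R / 2 : C) = 0 by rewrite -!rc_nat -rcV -rcM.
have uw : u = w \/ u = (w * s)%g.
  apply: perm_agree_all_mod_tperm => p; apply: hIm.
  have := congr1 (fun v : 'rV[C]_N => Im (v 0 p)) e; rewrite !mxE !(cImD, cImN) Im2 !Imn.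
  by rewrite !(oppr0, addr0).
have [d ud] : exists d : bool, u = (if d then w * s else w)%g.
  by case: uw => ->; [exists false|exists true].
exists z, d; split; [exact: az|by rewrite e ud|].
have tz p : (t p : nat)%:Z = (z p)%:Z + M%:Z + d%:R * dd (w p).
  have := congr1 (fun v : 'rV[C]_N => v 0 p) e; rewrite !mxE ud.
  case: (d) => /=; rewrite ?permM ?Xs; move: (dd (w p)) => D E.
    apply/eqP; rewrite -(eqr_int C) mul1r !intrD -!pmulrn; apply/eqP.
    apply: (addrI (X 0 (w p) - M%:R - (M * n)%:R / 2)).
    transitivity (X 0 (w p) + ((t p)%:R - M%:R - (M * n)%:R / 2)); first by ring.
    by rewrite E; ring.
  apply/eqP; rewrite -(eqr_int C) mul0r addr0 !intrD -!pmulrn; apply/eqP.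
  apply: (addrI (X 0 (w p) - M%:R - (M * n)%:R / 2)).
  transitivity (X 0 (w p) + ((t p)%:R - M%:R - (M * n)%:R / 2)); first by ring.
  by rewrite E; ring.
rewrite /hgt /height /tv.
have -> : \sum_(i < N) (i : nat)%:Z * (t i : nat)%:Z = \sum_(i < N) (i : nat)%:Z * (z i : nat)%:Z +
    M%:Z * \sum_(i < N) (i : nat)%:Z + \sum_(i < N) (i : nat)%:Z * (d%:R * dd (w i)).
  by rewrite mulr_sumr -!big_split; apply: eq_bigr => p _ /=; rewrite tz; move: (dd _) => D; ring.
have -> : \sum_(i < N) (i : nat)%:Z * (d%:R * dd (w i)) =
   d%:R * (r * (((w^-1)%g b0 : nat)%:Z - ((w^-1)%g a0 : nat)%:Z)).
  rewrite mulrBr mulrBr.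
  have D c : \sum_(i < N) (i : nat)%:Z * (d%:R * ((w i == c)%:R * r)) =
    d%:R * (r * ((w^-1)%g c : nat)%:Z).
    rewrite (bigD1 ((w^-1)%g c))//= permKV eqxx big1 ?addr0; first by rewrite mul1r;
      move: (d%:R) => D; ring.
    by move=> p ic; rewrite (canF_eq (permK w)) (negbTE ic) mul0r !mulr0.
  by rewrite -!D -sumrB; apply: eq_bigr => p _; rewrite /dd -mulrBr -mulrBr.
ring.
Qed.

End Lines.

Section Frames.
Variables (X : 'rV[C]_N) (c : 'S_N -> box n M -> C).
Hypothesis cadm : forall w z, c w z != 0 -> admissible z.
Hypothesis van : forall (j k : 'I_N) (t : int) (Y : 'rV[C]_N), (j < k)%N -> (`|t| <= M)%N ->
  Y 0 j - Y 0 k = t%:~R -> \sum_w \sum_z c w z * chq (col_perm w X + vec z) Y = 0.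

Let b (p : 'S_N * box n M) := c p.1 p.2.
Let x (p : 'S_N * box n M) := col_perm p.1 X + vec p.2.

Let hx p : exists w z, (b p != 0 -> admissible z) /\ x p = col_perm w X + vec z.
Proof. by exists p.1, p.2; split=> //; exact: cadm. Qed.

Let van' (j k : 'I_N) (t : int) (Y : 'rV[C]_N) : (j < k)%N -> (`|t| <= M)%N ->
  Y 0 j - Y 0 k = t%:~R -> \sum_p b p * chq (x p) Y = 0.
Proof. by move=> jk tM e; rewrite -[RHS](van jk tM e) pair_big. Qed.

Let widen z w : exists2 t : wbox, x (w, z) = col_perm w X + wvec t & forall i, tv t i =
  (z i)%:Z + M%:Z.
Proof.
exists (shift z (fun=> 0)).
  rewrite /x /=; congr (_ + _); apply/rowP => i; rewrite !mxE.
  have -> : ((shift z (fun=> 0) i : nat)%:R : C) = (z i)%:R + M%:R.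
    by rewrite pmulrn shiftE// subr0 intrD -!pmulrn.
  by ring.
by move=> i; rewrite /tv shiftE// subr0.
Qed.

(** All multiplicities are M + 1, so the counted segments use M [sumdist], the whole height
    available. Any excess is therefore excluded: a nonempty support has only nonempty neighbours,
    and the support at 1 is empty, since without rho its height is at least 1 short. Transpositions
    connect every w to 1. *)
Theorem frame_uniqueness : injective (fun i => Im (X 0 i)) -> c 1%g (zrho n M) = 0 ->
  forall w z, c w z = 0.
Proof.
move=> Xinj c1; pose o : 'I_N := ord0.
have hIm i i' : Im (X 0 i) = Im (X 0 i') -> i' = i \/ i' = tperm o o i.
  by move=> /Xinj ->; left.
have hr : X 0 o - X 0 o = (0 : int)%:~R by rewrite subrr.
have Imn (m : nat) : Im (m%:R : C) = 0 by rewrite -rc_nat.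
have Im2 : Im ((M * n)%:R / 2 : C) = 0 by rewrite -!rc_nat -rcV -rcM.
have inj p p' : x p = x p' -> p = p'.
  case: p p' => [w z] [w' z'] e.
  have ww : w = w'.
    apply/permP => i; apply: Xinj => /=.
    have := congr1 (fun v : 'rV[C]_N => Im (v 0 i)) e; rewrite !mxE !(cImD, cImN) Im2 !Imn.
    by rewrite !(oppr0, addr0).
  congr (_, _) => //; apply/ffunP => i; apply: val_inj => /=; apply/eqP.
  rewrite -(eqr_nat C); apply/eqP.
  have := congr1 (fun v : 'rV[C]_N => v 0 i) e; rewrite !mxE ww.
  by move=> /addrI /addIr.
have tc p : tcoef b x (x p) = b p.
  by rewrite /tcoef (big_pred1 p)// => p'; apply/eqP/eqP => [/inj //|->].
pose S := frame_support b x X.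
have SP w t : t \in S w -> exists2 z, c w z != 0 & admissible z /\
    hgt tv t = height z - M%:Z * (\sum_(i < N) (i : nat)%:Z).
  move=> tS; have [z [d [az e hh]]] := frame_heightP hIm hr hx tS.
  have e' : col_perm w X + wvec t = x (w, z).
    by rewrite e /x; case: (d) => //=; rewrite tperm1 mulg1.
  exists z; first by move: tS; rewrite inE e' tc.
  by split=> //; rewrite hh mul0r mulr0 subr0.
have zS w z : c w z != 0 -> S w != finset.set0.
  move=> cz; have [t e _] := widen z w; apply/finset.set0Pn; exists t.
  by rewrite inE -e tc.
pose hI : int := \sum_(i < N) (i : nat)%:Z.
have wdP w t t' : t \in S w -> t' \in S w ->
  hgt tv t - hgt tv t' <= M%:Z * sumdist n - (w == 1%g)%:R.
  move=> /SP[z cz [az ->]] /SP[z' cz' [az' ->]].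
  have := height_bounds az; have := height_bounds az'; rewrite !ler_norml -/hI.
  set D := M%:Z * sumdist n; set K := (M * n)%:Z * hI; set K' := M%:Z * hI.
  case: eqP => [w1|_] /=; last by lia.
  have : height z *+ 2 + K <> D.
    by move=> /(height_zrho az) zz; move: cz; rewrite zz w1 c1 eqxx.
  lia.
have := frame_counting hIm hr (leq0n M) hx van' wdP; rewrite -/S => cnt.
pose dl w := \sum_(p : 'I_N * 'I_N | (p.1 < p.2)%N)
     ((S (refl p.1 p.2 w) == finset.set0)%:R : int) * ((p.2 : nat)%:Z - (p.1 : nat)%:Z).
have dl0 w : 0 <= dl w.
  by apply: sumr_ge0 => p pp; rewrite mulr_ge0 ?ler0n// subr_ge0 lez_nat ltnW.
have cnt0 : \sum_(w | S w != finset.set0) (dl w + (w == 1%g)%:R) <= 0.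
  move: cnt; rewrite -subr_le0 -sumrB; congr (_ <= 0); apply: eq_bigr => w _.
  have -> : \sum_(p : 'I_N * 'I_N | (p.1 < p.2)%N)
     ((frame_mult o o w p.1 p.2)%:Z - 1 + (S (refl p.1 p.2 w) == finset.set0)%:R) *
     ((p.2 : nat)%:Z - (p.1 : nat)%:Z) = M%:Z * sumdist n + dl w.
    rewrite /sumdist mulr_sumr -big_split /=; apply: eq_bigr => p pp.
    have -> : frame_mult o o w p.1 p.2 = M.+1.
      rewrite /frame_mult; case: eqP => [e|_]; last by rewrite muln1.
      have := congr1 (fun g : 'S_N => g (w p.1)) e; rewrite tpermL tperm1 perm1 => /perm_inj e'.
      by move: pp; rewrite e' ltnn.
    rewrite -addn1 PoszD; ring.
  ring.
have t0 w : S w != finset.set0 -> dl w = 0 /\ w != 1%g.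
  move=> Sw; have := cnt0; rewrite (bigD1 w)//= => h.
  have h2 : 0 <= \sum_(i | (S i != finset.set0) && (i != w)) (dl i + (i == 1%g)%:R).
    by apply: sumr_ge0 => i _; rewrite addr_ge0 ?ler0n.
  have := dl0 w; move: h h2; set Q := \sum_(i | _) _; case: (w == 1%g) => /=; lia.
have step w (p : 'I_N * 'I_N) : (p.1 < p.2)%N -> S w != finset.set0 ->
  S (refl p.1 p.2 w) != finset.set0.
  move=> pp /t0[d0 _]; apply/negP => s0; move: d0; rewrite /dl (bigD1 p)//= s0 mul1r => /eqP.
  apply/negP; rewrite gt_eqF// ltr_pwDl//; first by rewrite subr_gt0 ltz_nat.
  by apply: sumr_ge0 => p' /andP[pp' _]; rewrite mulr_ge0 ?ler0n// subr_ge0 lez_nat ltnW.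
move=> w z; apply/eqP/negPn/negP => /zS Sw.
have [ts tw tn] := prod_tpermP (w^-1)%g.
have : S ((\prod_(t <- ts) tperm t.1 t.2) * w)%g != finset.set0.
  rewrite {tw}; elim: ts tn => [_|t ts IH /= /andP[tt tn]]; first by rewrite big_nil mul1g.
  rewrite big_cons -mulgA; case: (ltngtP t.1 t.2) => h.
  - by apply: (step _ t) => //; exact: IH.
  - by rewrite tpermC; apply: (step _ (t.2, t.1)) => //; exact: IH.
  - by case/eqP: tt; exact: val_inj.
by rewrite -tw mulVg => /t0[_]; rewrite eqxx.
Qed.

(** A support now lies in two zonotopes displaced against each other, which adds at most |r| dist w
    to its height; but the pair of positions of a0 and b0 counts double and requires (M + 1) dist w
    more. As |r| <= M and dist w > 0, every support is empty. *)
Theorem frame_vanishing (a0 b0 : 'I_N) (r : int) : a0 != b0 ->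
  X 0 a0 - X 0 b0 = r%:~R -> (`|r| <= M)%N ->
  (forall i i', Im (X 0 i) = Im (X 0 i') -> i' = i \/ i' = tperm a0 b0 i) ->
  forall Y, \sum_w \sum_z c w z * chq (col_perm w X + vec z) Y = 0.
Proof.
move=> ab hr rM hIm Y; rewrite pair_big /=.
pose S := frame_support b x X.
pose dist (w : 'S_N) : int := `|((w^-1)%g b0 : nat)%:Z - ((w^-1)%g a0 : nat)%:Z|.
have wdP w t t' : t \in S w -> t' \in S w ->
  hgt tv t - hgt tv t' <= M%:Z * sumdist n + `|r| * dist w.
  move=> /(frame_heightP hIm hr hx)[z [d [az _ ->]]] /(frame_heightP hIm hr hx)[z' [d' [az' _ ->]]].
  have := height_bounds az; have := height_bounds az'; rewrite !ler_norml /dist -normrM.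
  set hI : int := \sum_(i < N) _.
  set D := M%:Z * sumdist n; set K := (M * n)%:Z * hI; set K' := M%:Z * hI; set rd := r * _.
  by case: d; case: d' => /=; rewrite ?mul1r ?mul0r; lia.
have := frame_counting hIm hr rM hx van' wdP; rewrite -/S => cnt.
have S0 w : S w = finset.set0.
  apply/eqP/negPn/negP => Sw; suff : \sum_(w | S w != finset.set0) dist w * (M.+1%:Z - `|r|) <= 0.
    rewrite (bigD1 w)//=; apply/negP; rewrite -ltNge ltr_pwDl//.
      rewrite mulr_gt0//; last by lia.
      rewrite /dist normr_gt0 subr_eq0 eqz_nat; apply: contra ab => /eqP /val_inj /perm_inj ->.
      exact: eqxx.
    by apply: sumr_ge0 => i _; rewrite mulr_ge0 ?normr_ge0//; lia.
  rewrite -subr_le0 in cnt; apply: le_trans cnt; rewrite -sumrB; apply: ler_sum => {Sw}w _.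
  have fm (p : 'I_N * 'I_N) : (p.1 < p.2)%N -> 0 <= (frame_mult a0 b0 w p.1 p.2)%:Z - 1 - M%:Z.
    by rewrite /frame_mult; case: ifP; lia.
  have pos (p : 'I_N * 'I_N) : (p.1 < p.2)%N -> 0 <= (p.2 : nat)%:Z - (p.1 : nat)%:Z :> int by lia.
  have main : dist w * M.+1%:Z <= \sum_(p : 'I_N * 'I_N | (p.1 < p.2)%N)
     ((frame_mult a0 b0 w p.1 p.2)%:Z - 1 - M%:Z) * ((p.2 : nat)%:Z - (p.1 : nat)%:Z).
    have [p pp [ed es]] : exists2 p : 'I_N * 'I_N, (p.1 < p.2)%N &
        dist w = (p.2 : nat)%:Z - (p.1 : nat)%:Z /\ tperm (w p.1) (w p.2) = tperm a0 b0.
      rewrite /dist; case: (ltngtP ((w^-1)%g a0) ((w^-1)%g b0)) => h.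
      - by exists ((w^-1)%g a0, (w^-1)%g b0) => //=; split; [lia|rewrite !permKV].
      - by exists ((w^-1)%g b0, (w^-1)%g a0) => //=; split; [lia|rewrite !permKV tpermC].
      - by move/val_inj/perm_inj: h => h; rewrite h eqxx in ab.
    rewrite (bigD1 p)//= /frame_mult es eqxx -ed.
    rewrite -[X in X <= _]addr0; apply: lerD; last first.
      by apply: sumr_ge0 => p' /andP[pp' _]; rewrite mulr_ge0 ?fm ?pos.
    rewrite mulrC ler_wpM2r ?normr_ge0//; lia.
  apply: (@le_trans _ _ (\sum_(p : 'I_N * 'I_N | (p.1 < p.2)%N)
     ((frame_mult a0 b0 w p.1 p.2)%:Z - 1) * ((p.2 : nat)%:Z - (p.1 : nat)%:Z) -
       (M%:Z * sumdist n + `|r| * dist w))).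
    rewrite (eq_bigr (fun p : 'I_N * 'I_N => ((frame_mult a0 b0 w p.1 p.2)%:Z - 1 - M%:Z) *
       ((p.2 : nat)%:Z - (p.1 : nat)%:Z) + M%:Z * ((p.2 : nat)%:Z - (p.1 : nat)%:Z))); last first.
      by move=> p _; ring.
    rewrite big_split /= -mulr_sumr -/(sumdist n); move: main; set Q := \sum_(p | _) _; lia.
  rewrite lerD2r; apply: ler_sum => p pp; rewrite ler_wpM2r ?pos// lerDl ler0n//.
apply: (@tcoef_sum _ _ _ b x (fun e => chq e Y)) => -[w z].
have [t -> _] := widen z w; apply/eqP/negPn/negP => h.
have : t \in S w by rewrite inE.
by rewrite S0 inE.
Qed.
End Frames.
End Uniqueness.

(** * Exponential sums at generic points *)

Section CharacterExtension.
Variables (F : fieldType) (V : zmodType) (I : finType) (chi : I -> V -> F).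
Hypothesis chiD : forall i u v, chi i (u + v) = chi i u * chi i v.
Hypothesis chi_neq0 : forall i u, chi i u != 0.
Variables (H G : V -> Prop).
Hypothesis HG : forall h g, H h -> G g -> H (h + g).

(** Group the characters by their restriction to G. Each group sums to 0 at h0, and the last
    hypothesis makes its values at x and at h0 proportional. *)
Lemma character_extension (b : I -> F) (h0 x : V) :
  (forall h, H h -> \sum_i b i * chi i h = 0) -> H h0 ->
  (forall i i', (forall g, G g -> chi i g = chi i' g) ->
     chi i x * chi i' h0 = chi i' x * chi i h0) ->
  \sum_i b i * chi i x = 0.
Proof.
move=> b0 Hh0 hx.
pose E i i' := `[< forall g, G g -> chi i g = chi i' g >].
pose rep i := odflt i [pick i' | E i i'].
have repE i i' : (rep i == rep i') = E i i'.
  have Er k : E k (rep k).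
    rewrite /rep; case: pickP => //= h; have := h k.
    by move=> /asboolP; case.
  apply/eqP/idP => [e|/asboolP e].
    have /asboolP h1 := Er i; have /asboolP h2 := Er i'; apply/asboolP => g Gg.
    by rewrite h1// e -h2.
  have eE : E i =1 E i' by move=> k; apply/asboolP/asboolP => h g Gg; rewrite -h// e.
  rewrite /rep (eq_pick eE); case: pickP => //= h; have := h i.
  by move=> /asboolP; case=> g Gg; rewrite e.
rewrite (partition_big rep predT)//= big1// => j _.
have [i0 /eqP e0|no] := pickP (fun i => rep i == j); last by rewrite big_pred0.
have eE i : (rep i == j) = `[< forall g, G g -> chi i g = chi i0 g >] by rewrite -e0 repE.
rewrite (eq_bigl _ _ eE).
have := @character_component F V I chi chiD H G HG b i0 b0 h0 Hh0.
move/(congr1 (fun z => chi i0 x / chi i0 h0 * z)); rewrite mulr0 => {2}<-.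
rewrite mulr_sumr; apply: eq_bigr => i /asboolP e.
have -> : chi i x = chi i0 x * chi i h0 / chi i0 h0 by rewrite -(hx _ _ e) mulfK.
by ring.
Qed.
End CharacterExtension.

Section RealTranslations.
Variables (R : realType) (q br : R[i] -> R[i]).
Hypothesis Hq : qexponential q br.
Local Notation C := R[i].
Local Notation Im := (@complex.Im R).
Local Notation chq := (chq q).

(** Distinct imaginary parts keep the brackets [X_j - X_k + t], t an integer, away from 0. The
    condition is stable under real translations, which suffice to separate exponents; at X = i x
    with x real it says that the x_j are distinct. *)
Definition generic N (X : 'rV[C]_N) : Prop := injective (fun i => Im (X 0 i)).
Definition real_vec N (g : 'rV[C]_N) : Prop := forall i, Im (g 0 i) = 0.

Lemma generic_real N (h g : 'rV[C]_N) : generic h -> real_vec g -> generic (h + g).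
Proof. by move=> gh rg i j /=; rewrite !mxE !cImD !rg !addr0 => /gh. Qed.

Lemma chq_real_eq N (e e' : 'rV[C]_N) :
  (forall g, real_vec g -> chq e g = chq e' g) -> e = e'.
Proof.
move=> h; apply/rowP => i; apply/eqP; rewrite -subr_eq0; apply/eqP.
have : 2 * (e 0 i - e' 0 i) = 0.
  apply: (q_scale Hq) => t.
  have -> : 2 * (e 0 i - e' 0 i) * t%:C = 2 * bil e (t%:C *: delta_mx 0 i) - 2 * bil e' (t%:C *:
    delta_mx 0 i).
    by rewrite !bilZr !bil_delta; ring.
  have := h (t%:C *: delta_mx 0 i); rewrite /chq (qB Hq) => ->.
    by rewrite mulfV ?(q_neq0 Hq).
  by move=> j; rewrite !mxE -rc_nat -rcM.
by move/eqP; rewrite mulf_eq0 pnatr_eq0 /= => /eqP.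
Qed.

Section ExpSums.
Variables (N : nat) (H : 'rV[C]_N -> Prop) (h0 : 'rV[C]_N).
Hypothesis Hreal : forall h g, H h -> real_vec g -> H (h + g).
Hypothesis Hh0 : H h0.
Variables (I : finType) (b : I -> C) (x : I -> 'rV[C]_N).
Hypothesis sum0 : forall X, H X -> \sum_i b i * chq (x i) X = 0.

Lemma exp_sum_tcoef e : tcoef b x e = 0.
Proof.
have [i0 /eqP e0|no] := pickP (fun i => x i == e); last first.
  by rewrite /tcoef big_pred0.
have := @character_component C _ I (fun i => chq (x i)) (fun i => chqDr Hq (x i)) H (@real_vec N)
  Hreal b i0 sum0 h0 Hh0.
rewrite (eq_bigl (fun i => x i == e)); last first.
  by move=> i; apply/asboolP/eqP => [/chq_real_eq -> //|->]; rewrite e0.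
rewrite (eq_bigr (fun i => b i * chq e h0)); last by move=> i /eqP ->.
by rewrite -mulr_suml => /eqP; rewrite mulf_eq0 (negbTE (q_neq0 Hq _)) orbF => /eqP.
Qed.

Lemma exp_sum_extend X : \sum_i b i * chq (x i) X = 0.
Proof. by apply: (@tcoef_sum _ _ _ b x (fun e => chq e X)) => i; exact: exp_sum_tcoef. Qed.

Lemma exp_sum_coef0 : injective x -> forall i, b i = 0.
Proof.
move=> xi i; have := exp_sum_tcoef (x i); rewrite /tcoef (big_pred1 i)// => j.
by apply/eqP/eqP => [/xi|->].
Qed.
End ExpSums.

Lemma lattice_generic N : generic (\row_i ('i * (- (i.+1)%:R)%:C) : 'rV[C]_N).
Proof.
move=> i j /=; rewrite !mxE !cImM /= !mul0r !mul1r !add0r => /oppr_inj /eqP.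
by rewrite eqr_nat eqSS => /eqP /val_inj.
Qed.

(** * From Laurent polynomials in each variable to a joint expansion *)

Section JointLaurent.
Variables (N d : nat).
Definition lvec (e : {ffun 'I_N -> 'I_d.+1}) : 'rV[C]_N := \row_i ((e i)%:R - d%:R / 2).

Lemma lvec_inj : injective lvec.
Proof.
move=> e e' h; apply/ffunP => i; apply: val_inj; apply/eqP; rewrite /= -(eqr_nat C); apply/eqP.
by have := congr1 (fun v : 'rV[C]_N => v 0 i) h; rewrite !mxE => /addIr.
Qed.

Definition update (X : 'rV[C]_N) i t : 'rV[C]_N := \row_j (if j == i then t else X 0 j).

Definition lterm (s : 'I_d.+1) (t : C) : C := q (2 * ((s%:R - d%:R / 2) * t)).

Lemma lterm_poly (s : 'I_d.+1) t : lterm s t = q (- (d%:R * t)) * q (2 * t) ^+ s.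
Proof. by rewrite /lterm -(qMn Hq) -(qD Hq); congr q; field. Qed.

(** Up to the factor q^(-d t), the sum is a polynomial of degree at most d in q^(2 t); [lam r] holds
    the coefficients of the Lagrange basis at the points T r, the same for all a. *)
Lemma laurent_interpolation (T : 'I_d.+1 -> C) : injective (fun r => q (2 * T r)) ->
  exists lam : 'I_d.+1 -> 'I_d.+1 -> C, forall a : 'I_d.+1 -> C, forall t,
    \sum_s a s * lterm s t = \sum_r (\sum_s a s * lterm s (T r)) * \sum_s lam r s * lterm s t.
Proof.
move=> Tinj; pose v r := q (2 * T r).
pose L r : {poly C} := \prod_(j | j != r) ((v r - v j)^-1 *: ('X - (v j)%:P)).
have sL r : (size (L r) <= d.+1)%N.
  rewrite /L scaler_prod; apply: leq_trans (size_scale_leq _ _) _.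
  by rewrite -big_filter size_prod_XsubC size_index_neq card_ord.
exists (fun r s => q (d%:R * T r) * (L r)`_s) => a t.
pose p : {poly C} := \poly_(s < d.+1) (if insub s is Some s' then a s' else 0).
have pE u : q (- (d%:R * u)) * p.[q (2 * u)] = \sum_s a s * lterm s u.
  rewrite horner_poly mulr_sumr; apply: eq_bigr => s _.
  by rewrite valK lterm_poly mulrCA.
have := @lagrange_interpolation C _ v p Tinj; rewrite card_ord size_poly => /(_ isT) pL.
rewrite -pE {1}pL horner_sum mulr_sumr; apply: eq_bigr => r _; rewrite hornerZ -/(L r).
rewrite -pE (horner_coef_wide _ (sL r)) mulr_sumr mulr_sumr mulr_sumr.
apply: eq_bigr => s _; rewrite lterm_poly.
have e : q (- (d%:R * T r)) * q (d%:R * T r) = 1 by rewrite (qN Hq) mulVf ?(q_neq0 Hq).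
transitivity ((q (- (d%:R * T r)) * q (d%:R * T r)) * (q (- (d%:R * t)) * (p.[v r] * ((L r)`_s * q
  (2 * t) ^+ s)))).
  by rewrite e mul1r.
by rewrite /v; ring.
Qed.

Variable f : 'rV[C]_N -> C.
Hypothesis laurent1 : forall i X, generic X -> exists a : 'I_d.+1 -> C, forall t,
  generic (update X i t) -> f (update X i t) = \sum_s a s * lterm s t.

(** Interpolation points for the variable i. The imaginary part K + i, proper to i and not below K,
    keeps the point generic when one coordinate after another is replaced; the integers r make the
    q^(2 T) distinct. *)
Let T (K : R) (i : 'I_N) (r : 'I_d.+1) : C := 'i * (K + i%:R)%:C + r%:R.

Let ImT K i r : Im (T K i r) = K + i%:R.
Proof. by rewrite /T cImD cImM /= mul0r mul1r add0r -rc_nat /= addr0. Qed.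

Let Tinj K i : injective (fun r => q (2 * T K i r)).
Proof.
move=> r s /= e; apply: val_inj => /=.
have : q ((2 * ((r : nat)%:Z - (s : nat)%:Z))%:~R) = 1.
  rewrite -[RHS](mulfV (q_neq0 Hq (2 * T K i s))) -{1}e -(qB Hq); congr q.
  by rewrite /T intrM intrB -!pmulrn; ring.
by move/(q_int Hq)/eqP; rewrite mulf_eq0 /= subr_eq0 => /eqP [].
Qed.

Let good K X := generic X /\ forall i : 'I_N, Im (X 0 i) < K \/ Im (X 0 i) = K + i%:R.

Let update_good K X i r : good K X -> good K (update X i (T K i r)).
Proof.
move=> [gX bX].
have bU j : Im (update X i (T K i r) 0 j) < K \/ Im (update X i (T K i r) 0 j) = K + j%:R.
  rewrite mxE; case: eqP => [->|_]; last exact: bX.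
  by right; rewrite ImT.
have off j : j != i -> Im (X 0 j) != K + i%:R.
  move=> ji; apply/eqP => e; case: (bX j) => [|e']; first by rewrite e gtrDl ltNge ler0n.
  by move: e'; rewrite e => /addrI/eqP; rewrite eqr_nat => /eqP/val_inj ij; rewrite ij eqxx in ji.
split=> // j k; rewrite !mxE; case: eqP => [->|/eqP ji]; case: eqP => [->//|/eqP ki].
- by rewrite ImT => e; have := off k ki; rewrite -e eqxx.
- by rewrite ImT => e; have := off j ji; rewrite e eqxx.
- exact: gX.
Qed.

(** The first k variables are expanded, with coefficients depending on the others only. To pass to k
    + 1, interpolate in the variable k and apply the previous expansion at the interpolation
    points. *)
Let laurent_step K (k : nat) : (k <= N)%N ->
  exists c : {ffun 'I_N -> 'I_d.+1} -> 'rV[C]_N -> C,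
    (forall e (X X' : 'rV[C]_N), (forall i : 'I_N, (k <= i)%N -> X 0 i = X' 0 i) ->
      c e X = c e X') /\
    forall X, good K X -> f X = \sum_e c e X * \prod_(i < N | (i < k)%N) lterm (e i) (X 0 i).
Proof.
elim: k => [_|k IH kN].
  exists (fun e X => if e == [ffun=> ord0] then f X else 0); split.
    move=> e X X' h; case: ifP => // _; congr f; apply/rowP => i; exact: h.
  move=> X _; rewrite (bigD1 [ffun=> ord0])//= eqxx big_pred0// mulr1 big1 ?addr0// => e /negbTE ->.
  by rewrite mul0r.
have [c [cdep cE]] := IH (ltnW kN); pose i0 := Ordinal kN.
have [lam lamE] := laurent_interpolation (@Tinj K i0).
pose sete (e : {ffun 'I_N -> 'I_d.+1}) s : {ffun 'I_N -> 'I_d.+1} := [ffun i =>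
  if i == i0 then s else e i].
exists (fun e' X => \sum_(p : 'I_d.+1 * 'I_d.+1 * {ffun 'I_N -> 'I_d.+1} | sete p.2 p.1.2 == e')
   lam p.1.1 p.1.2 * c p.2 (update X i0 (T K i0 p.1.1))); split.
  move=> e' X X' h; apply: eq_bigr => p _; congr (_ * _); apply: cdep => i ki; rewrite !mxE.
  by case: eqP => // /eqP ii; apply: h; rewrite ltn_neqAle ki andbT eq_sym.
move=> X gX.
have [a aE] := laurent1 i0 gX.1.
have uX : update X i0 (X 0 i0) = X by apply/rowP => i; rewrite mxE; case: eqP => [->|].
have -> : f X = \sum_r f (update X i0 (T K i0 r)) * \sum_s lam r s * lterm s (X 0 i0).
  rewrite -{1}uX aE ?uX; last exact: gX.1.
  rewrite lamE; apply: eq_bigr => r _; congr (_ * _); rewrite aE//.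
  by have [] := update_good i0 r gX.
transitivity (\sum_(p : 'I_d.+1 * 'I_d.+1 * {ffun 'I_N -> 'I_d.+1}) 
   lam p.1.1 p.1.2 * c p.2 (update X i0 (T K i0 p.1.1)) *
   \prod_(i < N | (i < k.+1)%N) lterm (sete p.2 p.1.2 i) (X 0 i)); last first.
  rewrite (partition_big (fun p : 'I_d.+1 * 'I_d.+1 * {ffun 'I_N -> 'I_d.+1} =>
    sete p.2 p.1.2) predT)//=.
  by apply: eq_bigr => e' _; rewrite mulr_suml; apply: eq_bigr => p /eqP ->.
rewrite -(pair_bigA _ (fun p e => lam p.1 p.2 * c e (update X i0 (T K i0 p.1)) *
   \prod_(i < N | (i < k.+1)%N) lterm (sete e p.2 i) (X 0 i))) /=.
rewrite -(pair_bigA _ (fun r s => \sum_e lam r s * c e (update X i0 (T K i0 r)) *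
   \prod_(i < N | (i < k.+1)%N) lterm (sete e s i) (X 0 i))) /=.
apply: eq_bigr => r _; rewrite mulr_sumr; apply: eq_bigr => s _.
rewrite cE; last exact: update_good.
rewrite mulr_suml; apply: eq_bigr => e _.
rewrite [in RHS](bigD1 i0)//= ffunE eqxx.
rewrite [X in _ * X * _ = _](_ : _ = \prod_(i < N | (i < k.+1)%N && (i != i0)) lterm (sete e s i)
  (X 0 i)).
  by ring.
apply: eq_big => i; last by move=> ik; rewrite ffunE mxE -val_eqE /= (ltn_eqF ik).
by rewrite -val_eqE /= ltnS [(i <= k)%N]leq_eqVlt; case: ltngtP.
Qed.

(** Expansions are available below each bound K on the imaginary parts. For K > 0 the coefficients
    agree with those for K = 0, since both represent f where all imaginary parts are negative, a set
    stable under real translations. *)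
Lemma laurent_joint : exists c : {ffun 'I_N -> 'I_d.+1} -> C, forall X, generic X ->
  f X = \sum_e c e * chq (lvec e) X.
Proof.
have ex K : exists c : {ffun 'I_N -> 'I_d.+1} -> C, forall X, good K X ->
  f X = \sum_e c e * chq (lvec e) X.
  have [c [cdep cE]] := laurent_step K (leqnn N).
  exists (fun e => c e 0) => X gX; rewrite cE//; apply: eq_bigr => e _; congr (_ * _).
    by apply: cdep => i; rewrite leqNgt ltn_ord.
  rewrite /chq /bil mulr_sumr (q_sum Hq); apply: eq_big => i; first by rewrite ltn_ord.
  by move=> _; rewrite /lterm mxE.
have [c cE] := ex 0; exists c => X gX.
pose K : R := 1 + \sum_i `|Im (X 0 i)|.
have ltK i : `|Im (X 0 i)| < K.
  by rewrite /K (bigD1 i)//= addrCA ltrDl ltr_pwDl// sumr_ge0.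
have [c' c'E] := ex K.
have gX' : good K X by split=> // i; left; apply: le_lt_trans (ltK i); exact: ler_norm.
have K0 : 0 < K by rewrite ltr_pwDl// sumr_ge0.
rewrite c'E//; apply: eq_bigr => e _; congr (_ * _); apply/eqP; rewrite -subr_eq0; apply/eqP.
pose H X := generic X /\ forall i : 'I_N, Im (X 0 i) < 0.
have := @exp_sum_coef0 N H (\row_i ('i * (- (i.+1)%:R)%:C)) _ _ _ (fun e => c' e - c e) lvec.
apply.
- move=> h g [gh nh] rg; split; first exact: generic_real.
  by move=> i; rewrite mxE cImD rg addr0.
- split; first exact: lattice_generic.
  by move=> i; rewrite mxE cImM /= mul0r mul1r add0r oppr_lt0 ltr0n.
- move=> Y [gY nY]; under eq_bigr => i _ do rewrite mulrBl.
  rewrite sumrB -c'E ?cE ?subrr//; split=> // i; left => //.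
  exact: lt_trans (nY i) K0.
- exact: lvec_inj.
Qed.
End JointLaurent.
End RealTranslations.

(** * Kernels and their sums over nodes *)

Section Kernels.
Variables (R : realType) (q br : R[i] -> R[i]).
Hypothesis Hq : qexponential q br.
Local Notation C := R[i].
Local Notation Im := (@complex.Im R).
Local Notation chq := (chq q).
Variable M : nat.

(** q^(2 (X, Y)) times a Laurent polynomial in both variables: the shape in which the Baker-Akhiezer
    function is carried through the induction. *)
Definition pol n (c : box n M -> box n M -> C) (X Y : 'rV[C]_n.+1) : C :=
  \sum_e \sum_z c e z * q (2 * (bil X Y + bil (vec R e) X + bil (vec R z) Y)).

Definition altpol n (c : box n M -> box n M -> C) (X Y : 'rV[C]_n.+1) : C :=
  \sum_(w : 'S_n.+1) (-1) ^+ w * pol c (col_perm w X) Y.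

(** The induction hypothesis. The quasi-invariance in y is kept in the weaker form [ker_vanY], on
    the antisymmetrisation, which is what the node sum provides. [ker_vanX] discards tuples of nodes
    over the same x_j; [ker_sum] expresses invariance under translations of X and also fixes a sign
    in the integral. *)
Record BA_kernel n (c : box n M -> box n M -> C) : Prop := BAKernel {
  ker_adm : forall e z, c e z != 0 -> admissible z;
  ker_equiv : forall w X Y, pol c (col_perm w X) (col_perm w Y) = pol c X Y;
  ker_vanY : forall (j k : 'I_n.+1) (s : int) (X Y : 'rV[C]_n.+1), (j < k)%N -> (`|s| <= M)%N ->
    Y 0 j - Y 0 k = s%:~R -> altpol c X Y = 0;
  ker_vanX : forall (j k : 'I_n.+1) (s : int) (X Y : 'rV[C]_n.+1), j != k -> (`|s| <= M)%N ->
    X 0 j - X 0 k = s%:~R -> altpol c X Y = 0;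
  ker_lead : forall X : 'rV[C]_n.+1, generic X -> \sum_e c e (zrho n M) * chq (vec R e) X =
    \prod_(j < n.+1) \prod_(k < n.+1 | (j < k)%N) \prod_(l < M) br (l.+1%:R + X 0 k - X 0 j);
  ker_sum : forall e z, c e z != 0 -> \sum_(i < n.+1) ((e i : nat)%:R - (M * n)%:R / 2) = 0 :> C
}.

Definition vdm n (P : 'rV[C]_n.+1) : C :=
  \prod_(j < n.+1) \prod_(k < n.+1 | (j < k)%N) br (P 0 k - P 0 j).

Lemma vdmE n (P : 'rV[C]_n.+1) :
  vdm P = \sum_(s : 'S_n.+1) (-1) ^+ s * \prod_k q (((s k : nat)%:R *+ 2 - n%:R) * P 0 k).
Proof.
pose u : 'rV[C]_n.+1 := \row_k q (2 * P 0 k).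
have -> : vdm P = q (- \sum_k P 0 k *+ n) * \det (Vandermonde n.+1 u).
  rewrite det_Vandermonde -sum_pair_add -sumrN (q_sum Hq) -big_split; apply: eq_bigr => j _ /=.
  rewrite -sumrN (q_sum Hq) -big_split; apply: eq_bigr => k _ /=.
  by rewrite !mxE (br_subE Hq) opprD addrC.
rewrite -det_tr /determinant mulr_sumr; apply: eq_bigr => s _.
rewrite mulrCA; congr (_ * _); rewrite -sumrN (q_sum Hq) -big_split; apply: eq_bigr => k _ /=.
rewrite !mxE -(qMn Hq) -(qD Hq); congr q; rewrite -[P 0 k *+ n]mulr_natl -[_ *+ 2]mulr_natl; ring.
Qed.

Lemma vdm_perm n (w : 'S_n.+1) (P : 'rV[C]_n.+1) : vdm (col_perm w P) = (-1) ^+ w * vdm P.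
Proof.
rewrite !vdmE mulr_sumr (reindex_inj (mulgI w)); apply: eq_bigr => s _ /=.
rewrite odd_permM signr_addb -mulrA; congr (_ * (_ * _)).
rewrite [RHS](reindex_inj (@perm_inj _ w)); apply: eq_bigr => k _.
by rewrite !mxE permM.
Qed.

(** Each factor shows a difference f - g with f + g + 2 = (n + 2)(M + 1), the number of nodes, as
    the one-dimensional integral requires. The M added to both cancels, but keeps f and g
    nonnegative after a shift by |t| <= M. *)
Lemma vdm_pol_expand n (c : box n M -> box n M -> C) (P Y : 'rV[C]_n.+1) : vdm P * pol c P Y =
  \sum_e \sum_z c e z * q (2 * bil (vec R z) Y) * \sum_(s : 'S_n.+1) (-1) ^+ s *
  \prod_k q (2 * P 0 k * Y 0 k + ((M + s k + e k)%:R - ((n - s k) + (n * M - e k) + M)%:R) * P 0 k).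
Proof.
rewrite vdmE /pol mulr_sumr; apply: eq_bigr => e _; rewrite mulr_sumr; apply: eq_bigr => z _.
rewrite mulr_suml mulr_sumr; apply: eq_bigr => s _.
have -> : q (2 * (bil P Y + bil (vec R e) P + bil (vec R z) Y)) =
   q (2 * bil (vec R z) Y) * \prod_k q (2 * P 0 k * Y 0 k + ((e k)%:R *+ 2 - (M * n)%:R) * P 0 k).
  rewrite -(q_sum Hq) -(qD Hq) addrC mulrDr; congr q; congr (_ + _).
  rewrite -big_split mulr_sumr; apply: eq_bigr => k _ /=; rewrite !mxE.
  by rewrite -[_ *+ 2]mulr_natl; field.
have -> : \prod_k q (2 * P 0 k * Y 0 k + ((M + s k + e k)%:R - ((n - s k) + (n * M - e k) +
  M)%:R) * P 0 k) =
  \prod_k q (((s k : nat)%:R *+ 2 - n%:R) * P 0 k) * \prod_k q (2 * P 0 k * Y 0 k +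
    ((e k)%:R *+ 2 - (M * n)%:R) * P 0 k).
  rewrite -big_split; apply: eq_bigr => k _ /=; rewrite -(qD Hq); congr q.
  have le : (e k <= n * M)%N by apply: leq_trans (leq_ord (e k)) _; rewrite mulnC.
  rewrite !natrD (natrB _ le) (natrB _ (leq_ord (s k))) !natrM -[(s k)%:R *+ 2]mulr_natl -[(e k)%:R
    *+ 2]mulr_natl.
  move: (P 0 k) (Y 0 k) (s k)%:R (e k)%:R (n%:R : C) (M%:R : C) => v1 v2 v3 v4 v5 v6.
  ring.
move: (\prod_(k < n.+1) q _) => A; move: (\prod_(k < n.+1) q _) => B.
move: (c e z) (q _) ((-1) ^+ s) => cc qq sg.
ring.
Qed.

Lemma col_permA n (u w : 'S_n) (X : 'rV[C]_n) : col_perm u (col_perm w X) = col_perm (u * w)%g X.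
Proof. by apply/rowP => i; rewrite !mxE permM. Qed.

Lemma col_perm1 n (X : 'rV[C]_n) : col_perm 1%g X = X.
Proof. by apply/rowP => i; rewrite !mxE perm1. Qed.

Lemma generic_perm n (w : 'S_n) (X : 'rV[C]_n) : generic X -> generic (col_perm w X).
Proof. by move=> gX i j /=; rewrite !mxE => /gX /perm_inj. Qed.

Section Altpol.
Variables (n : nat) (c : box n M -> box n M -> C).
Hypothesis kc : BA_kernel c.

Lemma altpol_permY w X Y : altpol c X (col_perm w Y) = (-1) ^+ w * altpol c X Y.
Proof.
rewrite /altpol mulr_sumr (reindex_inj (mulgI w)); apply: eq_bigr => s _ /=.
by rewrite -col_permA (ker_equiv kc) odd_permM signr_addb mulrA.
Qed.

End Altpol.

Section Nodes.
Variable n : nat.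
Local Notation idx := ('I_n.+1 * 'I_M.+1)%type.

Definition node (X : 'rV[C]_n.+1) (p : idx) : C := X 0 p.1 + p.2%:R - M%:R / 2.
Definition nd (X : 'rV[C]_n.+1) (p : idx) : C := nden br (node X) p.

Lemma node_inj (X : 'rV[C]_n.+1) : generic X -> injective (fun p => q (2 * node X p)).
Proof.
move=> gX [j r] [k s] /= e.
have q1 : q (2 * (X 0 j - X 0 k + ((r : nat)%:Z - (s : nat)%:Z)%:~R)) = 1.
  rewrite -[RHS](mulfV (q_neq0 Hq (2 * node X (k, s)))) -{1}e -(qB Hq); congr q.
  by rewrite /node intrB -!pmulrn /=; ring.
have Imi (t : int) : Im (t%:~R : C) = 0 by rewrite -(rmorph_int (real_complex R)).
have jk : j = k.
  apply: gX; have := q_Im Hq q1.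
  rewrite mulr_natl mulr2n cImD -mulr2n => /eqP; rewrite mulrn_eq0 /= !(cImD, cImN) Imi addr0.
  by rewrite subr_eq0 => /eqP.
congr (_, _) => //; apply: val_inj => /=; move: q1; rewrite jk subrr add0r -[2]/(2%:~R) -intrM.
by move/(q_int Hq)/eqP; rewrite mulf_eq0 /= subr_eq0 => /eqP [].
Qed.

Lemma nd_perm (w : 'S_n.+1) X k r : nd X (w k, r) = nd (col_perm w X) (k, r).
Proof.
rewrite /nd /nden (reindex_inj (h := fun p : idx => (w p.1, p.2))) /=; last first.
  by move=> [j s] [j' s'] [/perm_inj -> ->].
apply: eq_big => [[j s]|[j s] _]; first by rewrite !xpair_eqE (inj_eq perm_inj).
by rewrite /node !mxE.
Qed.

End Nodes.

Section Full.
Variables (n : nat) (c : box n M -> box n M -> C).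
Hypothesis kc : BA_kernel c.
Local Notation idx := ('I_n.+2 * 'I_M.+1)%type.
Definition wd (k : 'I_n.+1) : 'I_n.+2 := widen_ord (leqnSn n.+1) k.

Definition Ydiff (Y : 'rV[C]_n.+2) : 'rV[C]_n.+1 := \row_j (Y 0 (wd j) - Y 0 ord_max).
Definition nodes (X : 'rV[C]_n.+2) (p : {ffun 'I_n.+1 -> idx}) : 'rV[C]_n.+1 := \row_k node X (p k).

(** The finite sum over tuples of nodes produced by the recursion integral, stripped of constants
    and of the sinh factors in y. *)
Definition full (X Y : 'rV[C]_n.+2) : C :=
  q (2 * (Y 0 ord_max * \sum_j X 0 j)) *
  \sum_p vdm (nodes X p) * altpol c (nodes X p) (Ydiff Y) / \prod_k nd X (p k).

Let precomp (w : 'S_n.+1) (p : {ffun 'I_n.+1 -> idx}) : {ffun 'I_n.+1 -> idx} := [ffun k =>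
  p (w k)].

Let precomp_inj w : injective (precomp w).
Proof.
move=> p p' e; apply/ffunP => k; have := congr1 (fun f : {ffun 'I_n.+1 -> idx} => f ((w^-1)%g k)) e.
by rewrite !ffunE permKV.
Qed.

(** [vdm] is alternating in the nodes, so after relabelling the tuple every term of the
    antisymmetrisation contributes equally. *)
Let unsymmetrize (D : pred {ffun 'I_n.+1 -> idx}) X Y : (forall w p, D (precomp w p) = D p) ->
  \sum_(p | D p) vdm (nodes X p) * altpol c (nodes X p) Y / \prod_k nd X (p k) =
  (n.+1)`!%:R * \sum_(p | D p) vdm (nodes X p) * pol c (nodes X p) Y / \prod_k nd X (p k).
Proof.
move=> hD; transitivity (\sum_(w : 'S_n.+1) \sum_(p | D p)
    vdm (nodes X p) * pol c (nodes X p) Y / \prod_k nd X (p k)).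
  rewrite [RHS](eq_bigr (fun w : 'S_n.+1 => \sum_(p | D p) vdm (nodes X p) * ((-1) ^+ w *
     pol c (col_perm w (nodes X p)) Y) / \prod_k nd X (p k))).
    rewrite exchange_big /=; apply: eq_bigr => p _; rewrite /altpol.
    by rewrite -mulr_suml -mulr_sumr.
  move=> w _; rewrite [LHS](reindex_inj (@precomp_inj w)); apply: eq_big => [p|p _];
    first exact: hD.
  have -> : nodes X (precomp w p) = col_perm w (nodes X p) by apply/rowP => k; rewrite !mxE ffunE.
  rewrite vdm_perm mulrCA mulrA; congr (_ / _).
  rewrite [RHS](reindex_inj (@perm_inj _ w)); apply: eq_bigr => k _; by rewrite ffunE.
by rewrite sumr_const card_Sn mulr_natl.
Qed.

Lemma full_pol X Y : full X Y = (n.+1)`!%:R * (q (2 * (Y 0 ord_max * \sum_j X 0 j)) *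
  \sum_p vdm (nodes X p) * pol c (nodes X p) (Ydiff Y) / \prod_k nd X (p k)).
Proof. by rewrite /full (unsymmetrize X (Ydiff Y) (D := predT))// mulrCA. Qed.

Definition frame_nodes (X : 'rV[C]_n.+2) (r : {ffun 'I_n.+1 -> 'I_M.+1}) : 'rV[C]_n.+1 :=
  \row_k node X (wd k, r k).

Definition full_frame (X Y : 'rV[C]_n.+2) : C :=
  q (2 * (Y 0 ord_max * \sum_j X 0 j)) *
  \sum_r vdm (frame_nodes X r) * pol c (frame_nodes X r) (Ydiff Y) / \prod_k nd X (wd k, r k).

(** An injection of n + 1 indices into n + 2 extends uniquely to a permutation; tuples of nodes over
    distinct x_j thus correspond to a permutation together with offsets r. *)
Let fr (x : 'S_n.+2 * {ffun 'I_n.+1 -> 'I_M.+1}) : {ffun 'I_n.+1 -> idx} :=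
  [ffun k => (x.1 (wd k), x.2 k)].

Lemma wd_inj : injective wd.
Proof. by move=> j k /(congr1 val) /= /val_inj. Qed.

Lemma ord_wdP (i : 'I_n.+2) : i = ord_max \/ exists k, i = wd k.
Proof.
case: (ltnP i n.+1) => h; last by left; apply: val_inj => /=; apply/eqP; rewrite eqn_leq leq_ord.
by right; exists (Ordinal h); apply: val_inj.
Qed.

Lemma wd_max k : wd k != ord_max.
Proof. by rewrite -val_eqE /= ltn_eqF. Qed.

Let fr_inj : injective fr.
Proof.
move=> [w r] [w' r'] e.
have h k := congr1 (fun f : {ffun 'I_n.+1 -> idx} => f k) e.
have rr : r = r' by apply/ffunP => k; have := h k; rewrite !ffunE => -[].
have ww k : w (wd k) = w' (wd k) by have := h k; rewrite !ffunE => -[].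
congr (_, _) => //; apply/permP => i; case: (ord_wdP i) => [->|[k ->]]; last exact: ww.
case: (ord_wdP ((w'^-1)%g (w ord_max))) => [e'|[k e']].
  by rewrite -[in RHS]e' permKV.
have := ww k; rewrite -e' permKV => /perm_inj e2.
by move: (wd_max k); rewrite -e' e2 eqxx.
Qed.

Let fr_image : [set fr x | x in predT]%SET = [set p : {ffun 'I_n.+1 -> idx} | injectiveb (fun k =>
  (p k).1)]%SET.
Proof.
apply/setP => p; rewrite inE; apply/imsetP/injectiveP => [[[w r] _ ->] j k|pi].
  by rewrite !ffunE /= => /perm_inj /wd_inj.
have [m0 m0P] : exists m0 : 'I_n.+2, forall k, (p k).1 != m0.
  have [m0 hm|no] := pickP (fun m0 => m0 \notin codom (fun k => (p k).1)).
    by exists m0 => k; apply: contra hm => /eqP <-; apply: (codom_f (fun k => (p k).1)).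
  have : (#|'I_n.+2| <= #|'I_n.+1|)%N.
    rewrite -[X in (_ <= X)%N](card_codom pi); apply: subset_leq_card;
      apply/fintype.subsetP => m0 _.
    exact: negbFE (no m0).
  by rewrite !card_ord ltnn.
pose f (i : 'I_n.+2) := if insub (i : nat) : option 'I_n.+1 is Some k then (p k).1 else m0.
have fwd k : f (wd k) = (p k).1 by rewrite /f /= valK.
have fmax : f ord_max = m0 by rewrite /f /= insubF// ltnn.
have fi : injective f.
  move=> i j; case: (ord_wdP i) => [->|[k ->]]; case: (ord_wdP j) => [->//|[k' ->]];
    rewrite ?fwd ?fmax.
  - by move=> e; case/eqP: (m0P k').
  - by move=> e; case/eqP: (m0P k).
  - by move=> /pi ->.
exists (perm fi, [ffun k => (p k).2]) => //.
by apply/ffunP => k; rewrite !ffunE /= permE fwd; case: (p k).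
Qed.

(** Two nodes over the same x_j differ by an integer of absolute value at most M, so [ker_vanX]
    kills these tuples; the others are permuted copies of those over the first n + 1 of the x_j. *)
Lemma full_frames X Y : generic X ->
  full X Y = (n.+1)`!%:R * \sum_(w : 'S_n.+2) full_frame (col_perm w X) Y.
Proof.
move=> gX; rewrite /full.
rewrite (bigID (fun p : {ffun 'I_n.+1 -> idx} => injectiveb (fun k =>
  (p k).1))) /= [X in _ * (_ + X)]big1; last first.
  move=> p /injectivePn[j [k jk e]].
  rewrite (ker_vanX kc (j := j) (k := k) (s := ((p j).2 : nat)%:Z - ((p k).2 :
    nat)%:Z)) ?mulr0 ?mul0r//.
    have := leq_ord (p j).2; have := leq_ord (p k).2; lia.
  by rewrite !mxE /node e intrB -!pmulrn; ring.
rewrite addr0 unsymmetrize; last first.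
  move=> w p; apply/injectiveP/injectiveP => h j k.
    by move=> e; have := h ((w^-1)%g j) ((w^-1)%g k); rewrite !ffunE !permKV => /(_ e) /perm_inj.
  by rewrite !ffunE => /h /perm_inj.
rewrite mulrCA; congr (_ * _).
transitivity (q (2 * (Y 0 ord_max * \sum_j X 0 j)) * \sum_(x : 'S_n.+2 * {ffun 'I_n.+1 -> 'I_M.+1})
   vdm (nodes X (fr x)) * pol c (nodes X (fr x)) (Ydiff Y) / \prod_k nd X (fr x k)).
  congr (_ * _); transitivity (\sum_(p in [set fr x | x in predT]%SET) vdm (nodes X p) * pol c
    (nodes X p) (Ydiff Y) / \prod_k nd X (p k)).
    by apply: eq_bigl => p; rewrite fr_image inE.
  rewrite big_imset /=; last by move=> x y _ _; exact: fr_inj.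
  by [].
rewrite -(pair_bigA _ (fun w r => vdm (nodes X (fr (w, r))) * pol c (nodes X (fr (w,
  r))) (Ydiff Y) / \prod_k nd X (fr (w, r) k))) /=.
rewrite mulr_sumr; apply: eq_bigr => w _; rewrite /full_frame; congr (q (2 * (_ * _)) * _).
  by rewrite (reindex_inj (@perm_inj _ w)); apply: eq_bigr => j _; rewrite mxE.
apply: eq_bigr => r _.
have -> : nodes X (fr (w, r)) = frame_nodes (col_perm w X) r.
  by apply/rowP => k; rewrite !mxE ffunE /node /= !mxE.
by congr (_ / _); apply: eq_bigr => k _; rewrite ffunE nd_perm.
Qed.

Lemma full_van_inner (j k : 'I_n.+1) (s : int) (X Y : 'rV[C]_n.+2) : (j < k)%N -> (`|s| <= M)%N ->
  Y 0 (wd j) - Y 0 (wd k) = s%:~R -> full X Y = 0.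
Proof.
move=> jk sM e; rewrite /full [X in _ * X]big1 ?mulr0// => p _.
by rewrite (ker_vanY kc (j := j) (k := k) (s := s)) ?mulr0 ?mul0r// !mxE -e; ring.
Qed.

Lemma full_anti_inner (w : 'S_n.+1) (X Y Y' : 'rV[C]_n.+2) : Y' 0 ord_max = Y 0 ord_max ->
  (forall k, Y' 0 (wd k) = Y 0 (wd (w k))) -> full X Y' = (-1) ^+ w * full X Y.
Proof.
move=> em ew; rewrite /full em [RHS]mulrCA; congr (_ * _).
have -> : Ydiff Y' = col_perm w (Ydiff Y) by apply/rowP => k; rewrite !mxE ew em.
rewrite mulr_sumr; apply: eq_bigr => p _.
by rewrite (altpol_permY kc) mulrCA -!mulrA.
Qed.

Lemma full_expand X Y : full X Y = (n.+1)`!%:R * (q (2 * (Y 0 ord_max * \sum_j X 0 j)) *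
  \sum_e \sum_z c e z * q (2 * bil (vec R z) (Ydiff Y)) * \sum_(s : 'S_n.+1) (-1) ^+ s *
  \prod_k \sum_(p : idx) q (2 * node X p * Ydiff Y 0 k + ((M + s k + e k)%:R - ((n - s k) +
    (n * M - e k) + M)%:R) * node X p) / nd X p).
Proof.
rewrite full_pol; congr (_ * (_ * _)).
transitivity (\sum_(p : {ffun 'I_n.+1 -> idx}) \sum_e \sum_z \sum_(s :
  'S_n.+1) c e z * q (2 * bil (vec R z) (Ydiff Y)) * ((-1) ^+ s *
  \prod_k (q (2 * node X (p k) * Ydiff Y 0 k + ((M + s k + e k)%:R - ((n - s k) + (n * M - e k) +
    M)%:R) * node X (p k)) / nd X (p k)))).
  apply: eq_bigr => p _; rewrite (vdm_pol_expand c) mulr_suml; apply: eq_bigr => e _.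
  rewrite mulr_suml; apply: eq_bigr => z _; rewrite mulr_sumr mulr_suml; apply: eq_bigr => s _.
  rewrite -!mulrA; congr (_ * (_ * (_ * _))); rewrite big_split prodfV; congr (_ / _).
  by apply: eq_bigr => k _; rewrite !mxE.
rewrite exchange_big /=; apply: eq_bigr => e _; rewrite exchange_big /=; apply: eq_bigr => z _.
rewrite [LHS]exchange_big [RHS]mulr_sumr; apply: eq_bigr => s _ /=.
by rewrite -!mulr_sumr bigA_distr_bigA.
Qed.

(** On this hyperplane the exponential in the node k0 turns f into f + t and g into g - t, both
    still natural numbers, and the sum over that node is the sum of residues of [nden_sum0]. *)
Lemma full_van_outer (k0 : 'I_n.+1) (t : int) (X Y : 'rV[C]_n.+2) : generic X -> (`|t| <= M)%N ->
  Y 0 (wd k0) - Y 0 ord_max = t%:~R -> full X Y = 0.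
Proof.
move=> gX tM e; rewrite full_expand.
rewrite [X in _ * (_ * X)]big1 ?mulr0// => ee _; rewrite big1// => z _;
  rewrite big1 ?mulr0// => s _.
rewrite (bigD1 k0)//= [X in _ * (X * _)](_ : _ = 0) ?mul0r ?mulr0//.
have le1 : (ee k0 <= n * M)%N by apply: leq_trans (leq_ord (ee k0)) _; rewrite mulnC.
have le2 := leq_ord (s k0).
pose f := absz ((M + s k0 + ee k0)%:Z + t)%R;
  pose g := absz (((n - s k0) + (n * M - ee k0) + M)%:Z - t)%R.
have fE : (f%:R : C) = (M + s k0 + ee k0)%:R + t%:~R.
  have : (f%:Z = (M + s k0 + ee k0)%:Z + t)%R by rewrite /f; lia.
  by move=> h; rewrite pmulrn h intrD -pmulrn.
have gE : (g%:R : C) = ((n - s k0) + (n * M - ee k0) + M)%:R - t%:~R.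
  have : (g%:Z = ((n - s k0) + (n * M - ee k0) + M)%:Z - t)%R by rewrite /g; lia.
  by move=> h; rewrite pmulrn h intrB -pmulrn.
have cI : #|{: idx}| = (f + g + 2)%N.
  rewrite card_prod !card_ord.
  have : (f%:Z = (M + s k0 + ee k0)%:Z + t)%R by rewrite /f; lia.
  have : (g%:Z = ((n - s k0) + (n * M - ee k0) + M)%:Z - t)%R by rewrite /g; lia.
  nia.
rewrite -[RHS](nden_sum0 Hq (node_inj gX) cI); apply: eq_bigr => p _.
congr (q _ / _); rewrite mxE e fE gE; ring.
Qed.

Lemma full_van (j k : 'I_n.+2) (s : int) (X Y : 'rV[C]_n.+2) : generic X -> (j < k)%N ->
  (`|s| <= M)%N ->
  Y 0 j - Y 0 k = s%:~R -> full X Y = 0.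
Proof.
move=> gX jk sM e; case: (ord_wdP j) => [jm|[j' je]].
  by move: jk; rewrite jm ltnNge leq_ord.
case: (ord_wdP k) => [km|[k' ke]]; first by apply: (@full_van_outer j' s) => //; rewrite -je -km.
by apply: (@full_van_inner j' k' s) => //; rewrite -?je -?ke// ; move: jk; rewrite je ke.
Qed.

End Full.

(** With two variables there is no third index for a conjugation, so the exchange of y_1 and y_2 is
    checked directly: P -> x_1 + x_2 - P permutes the nodes and changes the sign of each of the 2M +
    1 brackets in [nd]. *)
Lemma full_reflection (c : box 0 M -> box 0 M -> C) (X Y : 'rV[C]_2) :
  full c X (col_perm (tperm ord0 ord_max) Y) = - full c X Y.
Proof.
have w0 : wd (ord0 : 'I_1) = ord0 by apply: val_inj.
have S2 (Z : 'rV[C]_2) : \sum_j Z 0 j = Z 0 ord0 + Z 0 ord_max.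
  by rewrite big_ord_recr /= big_ord_recr big_ord0 /= add0r; congr (Z 0 _ + _); apply: val_inj.
pose star (p : 'I_2 * 'I_M.+1) : 'I_2 * 'I_M.+1 := (rev_ord p.1, rev_ord p.2).
have starK : involutive star by case=> j r; rewrite /star /= !rev_ordK.
have node_star p : node X (star p) = X 0 ord0 + X 0 ord_max - node X p.
  rewrite /node /= natrB ?ltn_ord// -natr1.
  have -> : X 0 (rev_ord p.1) = X 0 ord0 + X 0 ord_max - X 0 p.1.
    case: p.1 => [[|[|//]] hj].
      have -> : Ordinal hj = ord0 by apply: val_inj.
      have -> : rev_ord (ord0 : 'I_2) = ord_max by apply: val_inj.
      by rewrite [X in X - _]addrC addrK.
    have -> : Ordinal hj = ord_max by apply: val_inj.
    have -> : rev_ord (ord_max : 'I_2) = ord0 by apply: val_inj.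
    by rewrite addrK.
  rewrite -natr1; by field.
have nd_star p : nd X (star p) = - nd X p.
  rewrite /nd /nden (reindex_inj (inv_inj starK)) /=.
  rewrite (eq_bigl (fun p' => p' != p)); last by move=> p'; rewrite (inj_eq (inv_inj starK)).
  rewrite (eq_bigr (fun p' => -1 * br (node X p' - node X p))); last first.
    by move=> p' _; rewrite mulN1r -(brN Hq) !node_star; congr br; ring.
  rewrite big_split /= prodr_const cardC1 card_prod !card_ord mul2n doubleS /= -signr_odd /=
    odd_double /= expr1.
  by rewrite mulN1r.
rewrite (full_expand c X (col_perm _ Y)) (full_expand c X Y) (S2 X).
rewrite -mulrN; congr (_ * _).
rewrite -mulrN -!sumrN !mulr_sumr; apply: eq_bigr => e _; rewrite -sumrN !mulr_sumr;
  apply: eq_bigr => z _.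
have v0 (v : box 0 M) Z : bil (vec R v) Z = 0.
  rewrite /bil big_ord1 mxE.
  have -> : (v ord0 : nat) = 0%N by apply/eqP; rewrite -leqn0 (leq_trans (leq_ord _))// muln0.
  by rewrite muln0 mul0r subr0 mul0r.
rewrite !v0 -mulrN mulrCA [RHS]mulrCA; congr (_ * _).
rewrite -sumrN !mulr_sumr; apply: eq_bigr => s _.
rewrite !big_ord1 -!mulrN mulrCA [RHS]mulrCA; congr (_ * _).
rewrite -sumrN !mulr_sumr (reindex_inj (inv_inj starK)); apply: eq_bigr => p _.
rewrite nd_star invrN !mulrN; congr (- _); rewrite !mulrA -!(qD Hq); congr (q _ / _).
have -> : (e ord0 : nat) = 0%N by apply/eqP; rewrite -leqn0 (leq_trans (leq_ord _))// muln0.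
have -> : (s ord0 : nat) = 0%N by apply/eqP; rewrite -leqn0 leq_ord.
rewrite node_star !mxE w0 tpermL tpermR !addn0 !subn0 !add0n subrr; ring.
Qed.
End Kernels.

(** * The coefficients of the next kernel *)

Lemma big_offdiag (T : Type) (idx : T) (op : Monoid.com_law idx) n (f : 'I_n -> 'I_n -> T) :
  \big[op/idx]_k \big[op/idx]_(j | j != k) f k j =
  \big[op/idx]_(j < n) \big[op/idx]_(k < n | (j < k)%N) op (f j k) (f k j).
Proof.
transitivity (op (\big[op/idx]_(k < n) \big[op/idx]_(j < n | (k < j)%N) f k j)
  (\big[op/idx]_(k < n) \big[op/idx]_(j < n | (j < k)%N) f k j)).
  rewrite -big_split; apply: eq_bigr => k _ /=.
  rewrite (bigID (fun j : 'I_n => (k < j)%N)) /=; congr (op _ _); apply: eq_bigl => j.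
    by rewrite -val_eqE /=; case: ltngtP.
  by rewrite -val_eqE /=; case: ltngtP.
rewrite [X in op _ X](exchange_big_dep predT)//= -big_split; apply: eq_bigr => j _ /=.
by rewrite -big_split.
Qed.

Section Step.
Variables (R : realType) (q br : R[i] -> R[i]).
Hypothesis Hq : qexponential q br.
Local Notation C := R[i].
Local Notation Im := (@complex.Im R).
Local Notation chq := (chq q).
Local Notation vdm := (vdm br).
Local Notation nd := (nd br).
Variable M : nat.

Lemma br_generic n (X : 'rV[C]_n) j k (t : int) : generic X -> j != k ->
  br (X 0 j - X 0 k + t%:~R) != 0.
Proof.
move=> gX jk; apply: (br_Im Hq); rewrite !(cImD,
  cImN) -(rmorph_int (real_complex R)) /= addr0 subr_eq0.
by apply: contra jk => /eqP /gX ->.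
Qed.

Lemma br_generic0 n (X : 'rV[C]_n) j k : generic X -> j != k -> br (X 0 j - X 0 k) != 0.
Proof. by move=> gX jk; have := br_generic 0 gX jk; rewrite addr0. Qed.

Definition symp n (X : 'rV[C]_n) : C :=
  \prod_j \prod_(k | k != j) \prod_(l < M) br (X 0 k - X 0 j + l.+1%:R).

Lemma symp_perm n (w : 'S_n) (X : 'rV[C]_n) : symp (col_perm w X) = symp X.
Proof.
rewrite /symp [RHS](reindex_inj (@perm_inj _ w)); apply: eq_bigr => j _.
rewrite [RHS](reindex_inj (@perm_inj _ w)); apply: eq_big => k; first by rewrite (inj_eq perm_inj).
by move=> _; apply: eq_bigr => l _; rewrite !mxE.
Qed.

Lemma symp_neq0 n (X : 'rV[C]_n) : generic X -> symp X != 0.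
Proof.
move=> gX; apply/prodf_neq0 => j _; apply/prodf_neq0 => k kj; apply/prodf_neq0 => l _.
by rewrite pmulrn; apply: br_generic.
Qed.

Lemma vdm_neq0 n (X : 'rV[C]_n.+1) : generic X -> vdm X != 0.
Proof.
move=> gX; apply/prodf_neq0 => j _; apply/prodf_neq0 => k kj; apply: br_generic0 => //.
by apply/eqP => e; move: kj; rewrite e ltnn.
Qed.

(* [br d * prod_(l <= M) br (d + l) br (l - d)] is, up to sign, the product of the [br (d + i)] over
   [-M <= i <= M]; dividing by those with [-r <= i <= M - r] leaves M factors. *)
Definition gap (r i : nat) : int := if (i < M - r)%N then i%:Z - M%:Z else i.+1%:Z.

Definition gfac (r : nat) (d : C) : C :=
  br d * (\prod_(l < M) (br (d + l.+1%:R) * br (- d + l.+1%:R))) / \prod_(s < M.+1) br (d +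
    s%:R - r%:R).

Lemma gfacE (r : nat) d : (r <= M)%N -> (forall t : int, br (d + t%:~R) != 0) ->
  gfac r d = (-1) ^+ M * \prod_(i < M) br (d + (gap r i)%:~R).
Proof.
move=> rM d0; pose b i := br (d + (i%:Z - M%:Z)%:~R).
have num : br d * (\prod_(l < M) (br (d + l.+1%:R) * br (- d + l.+1%:R))) =
    (-1) ^+ M * \prod_(0 <= i < M.*2.+1) b i.
  rewrite big_split /= [X in _ * (_ * X)](_ : _ = (-1) ^+ M * \prod_(0 <= i < M) b i); last first.
    transitivity (\prod_(i < M) (-1 * b (rev_ord i))).
      apply: eq_bigr => i _; rewrite mulN1r -(brN Hq) /b; congr br.
      by rewrite opprD -mulrNz opprB intrB -!pmulrn /= natrB//; ring.
    rewrite big_split /= prodr_const card_ord; congr (_ * _).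
    by rewrite big_mkord [RHS](reindex_inj rev_ord_inj).
  have -> : \prod_(l < M) br (d + l.+1%:R) = \prod_(M.+1 <= i < M.*2.+1) b i.
    rewrite -addnn -addSn -{1}[M.+1]add0n big_addn addnC addnK big_mkord; apply: eq_bigr => i _.
    rewrite /b; have -> : ((i + M.+1)%N%:Z - M%:Z = i.+1%:Z)%R by lia.
    by rewrite -pmulrn.
  rewrite [in RHS](big_cat_nat (n := M.+1)) //=; last by rewrite ltnS -addnn leq_addr.
  rewrite [\prod_(0 <= i < M.+1) _]big_nat_recr //=.
  have -> : b M = br d by rewrite /b subrr addr0.
  ring.
have den : \prod_(s < M.+1) br (d + s%:R - r%:R) = \prod_(M - r <= i < M.*2.+1 - r) b i.
  rewrite -{1}[(M - r)%N]add0n big_addn.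
  have -> : (M.*2.+1 - r - (M - r) = M.+1)%N by lia.
  rewrite big_mkord; apply: eq_bigr => s _; rewrite /b; congr br.
  by rewrite PoszD -subzn// intrB !intrD mulrNz -!pmulrn; ring.
have fin : \prod_(i < M) br (d + (gap r i)%:~R) =
   \prod_(0 <= i < M - r) b i * \prod_(M.*2.+1 - r <= i < M.*2.+1) b i.
  rewrite -(big_mkord predT (fun i => br (d +
    (gap r i)%:~R))) (big_cat_nat (n := M - r)) ?leq_subr//=.
  congr (_ * _).
    by rewrite !big_mkord; apply: eq_bigr => i _; rewrite /gap ltn_ord.
  rewrite -{1}[(M - r)%N]add0n big_addn -[X in \prod_(X <= i < _) b i]add0n big_addn.
  have -> : (M - (M - r) = M.*2.+1 - (M.*2.+1 - r))%N by lia.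
  rewrite !big_mkord; apply: eq_bigr => i _; rewrite /gap /b.
  have -> : ((i + (M - r) < M - r) = false)%N by lia.
  by congr (br (d + _%:~R)); lia.
rewrite /gfac num den fin -mulrA; congr (_ * _).
have b0 m1 m2 : \prod_(m1 <= i < m2) b i != 0.
  by rewrite prodf_seq_neq0; apply/allP => i _; exact: d0.
rewrite (big_cat_nat (n := (M - r)%N)) //=; last by lia.
rewrite [X in _ * X / _](big_cat_nat (n := (M.*2.+1 - r)%N)) /=; [|by lia|by lia].
by rewrite -mulrA; congr (_ * _); rewrite mulrAC mulfV ?b0// mul1r.
Qed.

Section LastVariable.
Variable n : nat.
Implicit Types X : 'rV[C]_n.+2.

Definition restr X : 'rV[C]_n.+1 := \row_k X 0 (wd k).

Lemma restr_generic X : generic X -> generic (restr X).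
Proof. by move=> gX j k /=; rewrite !mxE => /gX /wd_inj. Qed.

Lemma vdm_last X : vdm X = vdm (restr X) * \prod_k br (X 0 ord_max - X 0 (wd k)).
Proof.
rewrite /vdm big_ord_recr /= [X in _ * X]big1 ?mulr1; last first.
  by move=> k; rewrite ltnNge -ltnS ltn_ord.
rewrite -big_split; apply: eq_bigr => j _ /=; rewrite big_mkcond big_ord_recr /= ltn_ord.
by congr (_ * _); rewrite [RHS]big_mkcond; apply: eq_bigr => k _; rewrite /= !mxE.
Qed.

Lemma symp_last X : symp X = symp (restr X) *
  \prod_k \prod_(l < M) (br (X 0 ord_max - X 0 (wd k) +
    l.+1%:R) * br (- (X 0 ord_max - X 0 (wd k)) + l.+1%:R)).
Proof.
rewrite /symp big_ord_recr /= [X in _ * X](_ : _ =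
  \prod_k \prod_(l < M) br (- (X 0 ord_max - X 0 (wd k)) + l.+1%:R)); last first.
  rewrite big_mkcond big_ord_recr /= eqxx mulr1; apply: eq_bigr => k _.
  by rewrite (wd_max k); apply: eq_bigr => l _; congr br; rewrite opprB.
have -> : \prod_k \prod_(l < M) (br (X 0 ord_max - X 0 (wd k) +
  l.+1%:R) * br (- (X 0 ord_max - X 0 (wd k)) + l.+1%:R)) =
  (\prod_k \prod_(l < M) br (X 0 ord_max - X 0 (wd k) +
    l.+1%:R)) * (\prod_k \prod_(l < M) br (- (X 0 ord_max - X 0 (wd k)) + l.+1%:R)).
  by rewrite -big_split; apply: eq_bigr => k _; rewrite big_split.
rewrite mulrA; congr (_ * _); rewrite -big_split; apply: eq_bigr => j _ /=.
rewrite big_mkcond big_ord_recr /= eq_sym (wd_max j); congr (_ * _).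
rewrite [RHS]big_mkcond; apply: eq_bigr => k _ /=; rewrite (inj_eq (@wd_inj n)).
by case: ifP => // _; apply: eq_bigr => l _; rewrite !mxE.
Qed.

Lemma nd_split m (X : 'rV[C]_m.+1) j r : nd X (j, r) =
  \prod_k \prod_(s < M.+1 | (k, s) != (j, r)) br (X 0 k + s%:R - (X 0 j + r%:R)).
Proof.
rewrite /nd /nden (pair_big_dep predT (fun k s => (k, s) != (j, r)) (fun k s =>
  br (X 0 k + s%:R - (X 0 j + r%:R)))) /=.
apply: eq_big => [[k s]//|[k s] _]; congr br; rewrite /node /=; ring.
Qed.

Lemma nd_last X k (r : 'I_M.+1) : nd X (wd k, r) = nd (restr X) (k, r) *
  \prod_(s < M.+1) br (X 0 ord_max - X 0 (wd k) + s%:R - r%:R).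
Proof.
rewrite !nd_split big_ord_recr /=; congr (_ * _).
  apply: eq_bigr => j _; apply: eq_big => s; last by rewrite !mxE.
  by rewrite !xpair_eqE (inj_eq (@wd_inj n)).
apply: eq_big => s; last by move=> _; congr br; ring.
by rewrite xpair_eqE eq_sym (negbTE (wd_max k)).
Qed.

(** Up to sign, at X = i x, the product of the [sinh_prod] factors in x. Multiplication by it clears
    the denominators [nd] in the last variable: by [pref_last] that variable survives only in the
    factors [gfac]. *)
Definition pref m (X : 'rV[C]_m.+1) : C := vdm X * symp X.

Lemma pref_last X (r : {ffun 'I_n.+1 -> 'I_M.+1}) :
  pref X / \prod_k nd X (wd k, r k) =
  pref (restr X) / \prod_k nd (restr X) (k, r k) * \prod_k gfac (r k) (X 0 ord_max - X 0 (wd k)).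
Proof.
rewrite /pref vdm_last symp_last (eq_bigr _ (fun k _ => nd_last X k (r k))) big_split /=.
rewrite /gfac [X in _ = _ * X]big_split prodfV [X in _ = _ * (X * _)]big_split /= invfM.
ring.
Qed.

(** For the top offset M the brackets over one index give [1] ... [M] up to sign, and the others
    assemble into [vdm]^2 and [symp]. This evaluates the leading coefficient. *)
Lemma nd_top (X : 'rV[C]_n.+1) : \prod_k nd X (k, ord_max : 'I_M.+1) =
  ((-1) ^+ M * \prod_(l < M) br l.+1%:R) ^+ n.+1 *
  ((\prod_(j < n.+1) \prod_(k < n.+1 | (j < k)%N) (-1)) * vdm X ^+ 2 * symp X).
Proof.
have e k : nd X (k, ord_max : 'I_M.+1) = ((-1) ^+ M * \prod_(l < M) br l.+1%:R) *
    \prod_(j | j != k) (br (X 0 j - X 0 k) * ((-1) ^+ M * \prod_(l < M) br (X 0 k - X 0 j +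
      l.+1%:R))).
  have rv (z : C) : \prod_(s < M) br (z + s%:R - M%:R) =
    (-1) ^+ M * \prod_(l < M) br (- z + l.+1%:R).
    transitivity (\prod_(i < M) (-1 * br (- z + i.+1%:R))).
      rewrite (reindex_inj rev_ord_inj); apply: eq_bigr => i _ /=; rewrite mulN1r -(brN Hq);
        congr br.
      by rewrite natrB//; ring.
    by rewrite big_split /= prodr_const card_ord.
  rewrite nd_split (bigD1 k)//=; congr (_ * _).
    rewrite big_mkcond big_ord_recr /= xpair_eqE !eqxx /= mulr1.
    transitivity (\prod_(s < M) br (0 + s%:R - M%:R)).
      apply: eq_bigr => s _; rewrite xpair_eqE eqxx /= -val_eqE /= ltn_eqF//; congr br; ring.
    by rewrite rv oppr0; congr (_ * _); apply: eq_bigr => l _; rewrite add0r.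
  apply: eq_bigr => j jk.
  rewrite (eq_bigl predT); last by move=> s; rewrite xpair_eqE (negbTE jk).
  rewrite big_ord_recr /= mulrC; congr (_ * _); first by congr br; ring.
  rewrite -[X 0 k - X 0 j]opprB -rv; apply: eq_bigr => s _; congr br; ring.
rewrite (eq_bigr _ (fun k _ => e k)) big_split /= prodr_const card_ord; congr (_ * _).
under eq_bigr => k _ do rewrite big_split /=.
rewrite big_split /=; congr (_ * _).
  rewrite big_offdiag expr2 /vdm -big_split -big_split /=; apply: eq_bigr => j _.
  rewrite -!big_split; apply: eq_bigr => k _ /=.
  by rewrite -[X 0 j - X 0 k]opprB (brN Hq); ring.
under eq_bigr => k _ do rewrite big_split /=.
rewrite big_split /= [X in X * _](_ : _ = 1) ?mul1r.
  rewrite /symp !big_offdiag; apply: eq_bigr => j _; apply: eq_bigr => k _; exact: mulrC.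
rewrite big_offdiag big1// => j _; rewrite big1// => k _.
by rewrite /= -exprMn mulN1r opprK expr1n.
Qed.

End LastVariable.
End Step.

Section Coefficients.
Variables (R : realType) (q br : R[i] -> R[i]).
Hypothesis Hq : qexponential q br.
Local Notation C := R[i].
Local Notation Im := (@complex.Im R).
Local Notation chq := (chq q).
Local Notation vdm := (vdm br).
Local Notation nd := (nd br).
Variable M : nat.
Local Notation pref := (pref br M).

(** Admissibility is tested on the constant functionals 1 and -1, for which the bound is 0. *)
Lemma admissible_sum n (z : box n M) : admissible z ->
  \sum_i ((z i : nat)%:R - (M * n)%:R / 2) = 0 :> C.
Proof.
move=> az.
have z0 (h : int) : \sum_(j < n.+1) \sum_(k < n.+1 | (j < k)%N) `|h - h| = 0.
  by rewrite big1// => j _; rewrite big1// => k _; rewrite subrr normr0.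
have h1 := az (fun=> 1); have h2 := az (fun=> -1); move: h1 h2; rewrite !z0 !mulr0.
have -> : \sum_i -1 * ((z i : nat)%:Z *+ 2 - (M * n)%:Z) =
  - \sum_i 1 * ((z i : nat)%:Z *+ 2 - (M * n)%:Z).
  by rewrite -sumrN; apply: eq_bigr => i _; rewrite mulN1r mul1r.
rewrite oppr_le0 => h1 h2.
have e : \sum_i 1 * ((z i : nat)%:Z *+ 2 - (M * n)%:Z) = 0 by apply/eqP; rewrite eq_le h1 h2.
transitivity ((\sum_i 1 * ((z i : nat)%:Z *+ 2 - (M * n)%:Z))%:~R / 2 : C); last by rewrite e mul0r.
rewrite (big_morph (fun x : int => x%:~R : C) (@intrD C) (mulr0z 1)) mulr_suml;
  apply: eq_bigr => i _.
by rewrite mul1r -[(z i : nat)%:Z *+ 2]mulr_natr natz intrB intrM -!pmulrn; field.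
Qed.

Section Shift.
Variable n : nat.
Implicit Types (z : box n M) (r : {ffun 'I_n.+1 -> 'I_M.+1}).

(** Adds to the weight z the vector sum over k of (r_k - M/2)(e_k - e_max); when [insub] fails, the
    coordinate is the last one. *)
Definition znew z r : box n.+1 M := [ffun i : 'I_n.+2 =>
  inord (if insub (i : nat) : option 'I_n.+1 is Some k then z k + r k else \sum_k (M - r k))%N].

Lemma znew_wd z r k : znew z r (wd k) = (z k + r k)%N :> nat.
Proof.
rewrite ffunE /= valK inordK// ltnS mulnS addnC leq_add//; exact: leq_ord.
Qed.

Lemma znew_max z r : znew z r ord_max = (\sum_k (M - r k))%N :> nat.
Proof.
rewrite ffunE /= insubF ?ltnn// inordK// ltnS.
rewrite [leqRHS](_ : _ = \sum_(k < n.+1) M)%N; last by rewrite sum_nat_const card_ord mulnC.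
by apply: leq_sum => k _; exact: leq_subr.
Qed.

Lemma natr_sub_sum r : ((\sum_k (M - r k))%N)%:R = \sum_k (M%:R - (r k : nat)%:R) :> C.
Proof. by rewrite natr_sum; apply: eq_bigr => k _; rewrite natrB ?leq_ord. Qed.

Lemma znew_adm z r : admissible z -> admissible (znew z r).
Proof.
move=> az h; rewrite big_ord_recr /= [X in _ <= _ * X]big_ord_recr /=.
rewrite [X in M%:Z * (_ + X)]big1; last by move=> k; rewrite ltnNge -ltnS ltn_ord.
rewrite addr0.
have -> : \sum_(j < n.+1) \sum_(k < n.+2 | (widen_ord (leqnSn n.+1) j < k)%N) `|h (widen_ord
  (leqnSn n.+1) j) - h k| =
   \sum_(j < n.+1) \sum_(k < n.+1 | (j < k)%N) `|h (wd j) - h (wd k)| +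
     \sum_(j < n.+1) `|h (wd j) - h ord_max|.
  rewrite -big_split; apply: eq_bigr => j _ /=; rewrite big_mkcond big_ord_recr /= ltn_ord.
  by congr (_ + _); rewrite [RHS]big_mkcond; apply: eq_bigr.
rewrite [X in _ <= X]mulrDr.
have -> : \sum_(i < n.+1) h (widen_ord (leqnSn n.+1) i) * ((znew z r (widen_ord (leqnSn n.+1) i) :
  nat)%:Z *+ 2 - (M * n.+1)%:Z) +
    h ord_max * ((znew z r ord_max : nat)%:Z *+ 2 - (M * n.+1)%:Z) =
   \sum_(i < n.+1) h (wd i) * ((z i : nat)%:Z *+ 2 - (M * n)%:Z) +
   \sum_(i < n.+1) (h (wd i) - h ord_max) * ((r i : nat)%:Z *+ 2 - M%:Z).
  have -> : (znew z r ord_max : nat)%:Z *+ 2 - (M * n.+1)%:Z =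
    \sum_(k < n.+1) (M%:Z - (r k : nat)%:Z *+ 2).
    have -> : (M * n.+1)%:Z = \sum_(k < n.+1) M%:Z by rewrite sumr_const card_ord -mulr_natr natz
      PoszM.
    rewrite znew_max (big_morph Posz PoszD (erefl : Posz 0%N = 0)) -sumrMnl -sumrB.
    apply: eq_bigr => k _; rewrite -subzn ?leq_ord//; ring.
  rewrite mulr_sumr -!big_split; apply: eq_bigr => k _ /=; rewrite znew_wd !mulnS !PoszD; ring.
apply: lerD; first exact: az (fun k => h (wd k)).
rewrite mulr_sumr; apply: ler_sum => k _; rewrite mulrC.
apply: le_trans (ler_norm _) _; rewrite normrM ler_wpM2r ?normr_ge0//.
by have := leq_ord (r k); lia.
Qed.

Lemma znew_rho z r : (znew z r == zrho n.+1 M) = (r == [ffun=> ord_max]) && (z == zrho n M).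
Proof.
apply/eqP/andP => [e|[/eqP -> /eqP ->]]; last first.
  apply/ffunP => i; apply: val_inj; rewrite /= zrhoE; case: (ord_wdP i) => [->|[k ->]].
    by rewrite znew_max subnn muln0 big1// => k _; rewrite ffunE subnn.
  rewrite znew_wd zrhoE ffunE /= -mulnSr subSn//; exact: leq_ord.
have h i := congr1 (fun v : box n.+1 M => (v i : nat)) e.
have rM : r = [ffun=> ord_max].
  apply/ffunP => k; rewrite ffunE; apply: val_inj => /=; apply/eqP.
  have := h ord_max; rewrite znew_max zrhoE subnn muln0 => /eqP.
  rewrite sum_nat_eq0 => /forallP /(_ k) /=; rewrite subn_eq0 => rk.
  by rewrite eqn_leq leq_ord.
split; first by rewrite rM.
apply/eqP/ffunP => k; apply: val_inj; rewrite /= zrhoE.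
have := h (wd k); rewrite znew_wd zrhoE rM ffunE /= subSn ?leq_ord// mulnS addnC => /eqP.
by rewrite eqn_add2l => /eqP.
Qed.

End Shift.

Section Frame.
Variables (n : nat) (c : box n M -> box n M -> C).
Hypothesis kc : BA_kernel q br c.
Implicit Types X Y : 'rV[C]_n.+2.
Local Notation fnodes := (@frame_nodes R M n).

(** Normalisation compensating the constants of [nd_top], so that the coefficient at the highest
    weight becomes the product required of a Baker-Akhiezer function. *)
Definition kap : C := (\prod_(l < M) br l.+1%:R) ^+ n.+1 *
  \prod_(j < n.+1) \prod_(k < n.+1 | (j < k)%N) (-1).

Definition tpsi X Y : C := kap * pref X * full_frame q br c X Y.

(** The coefficients of [tpsi] in y. As functions of X they are quotients of brackets at first; they
    turn out to be Laurent polynomials, in the last variable by cancellation and in the others by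
    symmetry. *)
Definition cf (z : box n.+1 M) X : C := kap * pref X *
  \sum_r vdm (fnodes X r) / \prod_k nd X (wd k, r k) *
    \sum_e \sum_(z' | znew z' r == z) c e z' * chq (vec R e) (fnodes X r).

(** The two sides differ by a multiple of the sum of the coordinates of [vec R z'], which is 0 by
    admissibility. *)
Lemma tpsi_exponent X Y r z' : admissible z' ->
  Y 0 ord_max * \sum_j X 0 j + (bil (fnodes X r) (Ydiff Y) + bil (vec R z') (Ydiff Y)) =
  bil X Y + bil (vec R (znew z' r)) Y.
Proof.
move=> /admissible_sum az.
have BR (F : 'I_n.+2 -> C) : \sum_i F i = \sum_(k < n.+1) F (wd k) +
  F ord_max by rewrite big_ord_recr.
rewrite /bil (BR (fun i => X 0 i)) (BR (fun i => X 0 i * Y 0 i)) (BR (fun i =>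
  vec R (znew z' r) 0 i * Y 0 i)).
have e1 : vec R (znew z' r) 0 ord_max = \sum_k (M%:R - (r k : nat)%:R - M%:R / 2).
  rewrite mxE znew_max natr_sub_sum [RHS]sumrB; congr (_ - _).
  by rewrite sumr_const card_ord -mulr_natr natrM; ring.
have e2 : \sum_(i < n.+1) vec R (znew z' r) 0 (wd i) * Y 0 (wd i) =
    \sum_i ((z' i)%:R + (r i)%:R - (M * n)%:R / 2 - M%:R / 2) * Y 0 (wd i).
  by apply: eq_bigr => i _; rewrite mxE znew_wd natrD mulnS natrD; congr (_ * _); ring.
rewrite e1 e2 mulrDr mulr_sumr mulr_suml.
set S1 := \sum_(i < n.+1) Y 0 ord_max * _; set S2 := \sum_i fnodes X r 0 i * _;
  set S3 := \sum_i vec R z' 0 i * _.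
set T1 := \sum_(i < n.+1) X 0 _ * _; set T2 := \sum_i _ * Y 0 (wd i);
  set T3 := \sum_i _ * Y 0 ord_max.
have key : S1 + S2 + S3 - (T1 + T2 + T3) = - Y 0 ord_max * \sum_i ((z' i)%:R - (M * n)%:R / 2).
  rewrite /S1 /S2 /S3 /T1 /T2 /T3 -!big_split -sumrB mulr_sumr; apply: eq_bigr => i _ /=.
  by rewrite !mxE /node /=; field.
move: key; rewrite az mulr0 => /eqP; rewrite subr_eq0 => /eqP key.
transitivity ((S1 + S2 + S3) + Y 0 ord_max * X 0 ord_max); first by ring.
by rewrite key; ring.
Qed.

Lemma tpsiE X Y : tpsi X Y = \sum_z cf z X * q (2 * (bil X Y + bil (vec R z) Y)).
Proof.
pose G (z : box n.+1 M) := q (2 * (bil X Y + bil (vec R z) Y)).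
rewrite /tpsi /full_frame.
transitivity (kap * pref X * \sum_r vdm (fnodes X r) / \prod_k nd X (wd k, r k) *
   \sum_e \sum_z' c e z' * chq (vec R e) (fnodes X r) * G (znew z' r)).
  congr (_ * _); rewrite mulr_sumr; apply: eq_bigr => r _.
  rewrite /pol mulrCA mulrAC -!mulrA; congr (_ * _); rewrite mulrCA; congr (_ * _).
  rewrite mulr_sumr; apply: eq_bigr => e _; rewrite mulr_sumr; apply: eq_bigr => z' _.
  have [->|cz] := eqVneq (c e z') 0; first by rewrite !mul0r mulr0.
  rewrite mulrCA -mulrA; congr (_ * _); rewrite /chq /G -(tpsi_exponent X Y r (ker_adm kc cz))
    -!(qD Hq).
  congr q; ring.
rewrite /cf; under [RHS]eq_bigr => z _ do rewrite -mulrA mulr_suml.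
rewrite -[RHS]mulr_sumr; congr (_ * _); rewrite [RHS]exchange_big /=; apply: eq_bigr => r _.
under [RHS]eq_bigr => z _ do rewrite -mulrA mulr_suml.
rewrite -[RHS]mulr_sumr; congr (_ * _); rewrite [RHS]exchange_big /=; apply: eq_bigr => e _.
rewrite (partition_big (fun z' => znew z' r) predT)//=; apply: eq_bigr => z _.
by rewrite mulr_suml; apply: eq_bigr => z' /eqP ->.
Qed.

Lemma cf_adm z X : cf z X != 0 -> admissible z.
Proof.
move=> h; have [//|na] := pselect (admissible z); case/eqP: h.
rewrite /cf [X in _ * X]big1 ?mulr0// => r _; rewrite [X in _ * X]big1 ?mulr0// => e _;
  rewrite big1// => z' /eqP zz.
have [->|cz] := eqVneq (c e z') 0; first by rewrite mul0r.
by case: na; rewrite -zz; apply: znew_adm; exact: (ker_adm kc cz).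
Qed.

Lemma kap_neq0 : kap != 0.
Proof.
rewrite mulf_neq0// ?expf_neq0//.
  by apply/prodf_neq0 => l _; rewrite pmulrn; apply: (br_int Hq).
by apply/prodf_neq0 => j _; apply/prodf_neq0 => k _; rewrite oppr_eq0 oner_eq0.
Qed.

Lemma pref_neq0 X : generic X -> pref X != 0.
Proof. by move=> gX; rewrite mulf_neq0// ?(vdm_neq0 Hq)// (symp_neq0 Hq). Qed.

Lemma pref_perm w X : pref (col_perm w X) = (-1) ^+ w * pref X.
Proof. by rewrite /pref (vdm_perm Hq) symp_perm mulrA. Qed.

Lemma generic_gap X k (t : int) : generic X -> br (X 0 ord_max - X 0 (wd k) + t%:~R) != 0.
Proof. by move=> gX; apply: (br_generic Hq) => //; rewrite eq_sym wd_max. Qed.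

Lemma frame_nodes_restr X X' r : restr X = restr X' -> fnodes X r = fnodes X' r.
Proof.
move=> e; apply/rowP => k; rewrite !mxE /node /=.
by have := congr1 (fun v : 'rV[C]_n.+1 => v 0 k) e; rewrite !mxE => ->.
Qed.

(** Only the offsets r = (M, ..., M) and z' = rho reach the new weight rho, so a single term remains
    and [nd_top] evaluates it. *)
Lemma cf_lead X : generic X -> cf (zrho n.+1 M) X =
  \prod_(j < n.+2) \prod_(k < n.+2 | (j < k)%N) \prod_(l < M) br (l.+1%:R + X 0 k - X 0 j).
Proof.
move=> gX; set rM : {ffun 'I_n.+1 -> 'I_M.+1} := [ffun=> ord_max].
have -> : cf (zrho n.+1 M) X = kap * pref X * (vdm (fnodes X rM) / \prod_k nd X (wd k, rM k) *
    \sum_e c e (zrho n M) * chq (vec R e) (fnodes X rM)).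
  rewrite /cf (bigD1 rM)//= [X in _ * (_ + X)]big1 ?addr0; last first.
    move=> r rr; rewrite [X in _ * X]big1 ?mulr0// => e _; rewrite big_pred0// => z'.
    by rewrite znew_rho (negbTE rr).
  congr (_ * (_ * _)); apply: eq_bigr => e _.
  by rewrite (big_pred1 (zrho n M))// => z'; rewrite znew_rho eqxx.
have gf : generic (fnodes X rM).
  move=> j k /=; rewrite !mxE /node /= !ffunE !(cImD, cImN) => /addIr /addIr /gX.
  exact: wd_inj.
have gr := restr_generic gX.
rewrite (ker_lead kc gf).
have df j k : fnodes X rM 0 k - fnodes X rM 0 j = X 0 (wd k) - X 0 (wd j).
  by rewrite !mxE /node !ffunE /=; ring.
have -> : vdm (fnodes X rM) = vdm (restr X).
  by apply: eq_bigr => j _; apply: eq_bigr => k _; rewrite df !mxE.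
have B0 : (\prod_(l < M) br l.+1%:R) != 0.
  by apply/prodf_neq0 => l _; rewrite pmulrn; apply: (br_int Hq).
have main : kap * pref X * (vdm (restr X) / \prod_k nd X (wd k, rM k)) =
   \prod_(k < n.+1) \prod_(l < M) br (l.+1%:R + X 0 ord_max - X 0 (wd k)).
  transitivity (kap * (pref X / \prod_k nd X (wd k, rM k)) * vdm (restr X)); first by ring.
  rewrite pref_last.
  have -> : \prod_k gfac br M (rM k) (X 0 ord_max - X 0 (wd k)) =
      ((-1) ^+ M) ^+ n.+1 * \prod_(k < n.+1) \prod_(l < M) br (l.+1%:R + X 0 ord_max - X 0 (wd k)).
    rewrite -[in X in _ = X * _](card_ord n.+1) -prodr_const -big_split; apply: eq_bigr => k _ /=.
    rewrite ffunE (gfacE Hq)//; last by move=> t; exact: generic_gap.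
    congr (_ * _); apply: eq_bigr => l _; rewrite /gap subnn ltn0 -pmulrn; congr br; ring.
  have -> : \prod_k nd (restr X) (k, rM k) = \prod_k nd (restr X) (k, ord_max : 'I_M.+1).
    by apply: eq_bigr => k _; rewrite ffunE.
  rewrite (nd_top Hq) /kap /pref !exprMn.
  have v0 := vdm_neq0 Hq gr; have s0 := @symp_neq0 _ _ _ Hq M _ _ gr.
  set sg := \prod_(j < n.+1) _; set B := (\prod_(l < M) _) ^+ n.+1.
  set P := \prod_(k < n.+1) \prod_(l < M) _; set eps := ((-1) ^+ M) ^+ n.+1.
  have sg0 : sg != 0 by apply/prodf_neq0 => j _; apply/prodf_neq0 => k _; rewrite oppr_eq0 oner_eq0.
  have eps0 : eps != 0 by rewrite !expf_neq0// oppr_eq0 oner_eq0.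
  have B0' : B != 0 by rewrite expf_neq0.
  move: (vdm _) (symp _ _ _) v0 s0 => v s v0 s0;
    move: sg B P eps sg0 eps0 B0' => sg B P eps sg0 eps0 B0'.
  by field; rewrite ?sg0 ?eps0 ?B0' ?v0 ?s0.
rewrite mulrA main [RHS]big_ord_recr /= [X in _ = _ * X]big1 ?mulr1; last first.
  by move=> k; rewrite ltnNge -ltnS ltn_ord.
rewrite -big_split; apply: eq_bigr => j _ /=; rewrite [RHS]big_mkcond big_ord_recr /= ltn_ord mulrC.
congr (_ * _); rewrite big_mkcond; apply: eq_bigr => k _ /=; case: ifP => // _.
by apply: eq_bigr => l _; congr br; rewrite -!addrA df.
Qed.

Lemma prod_br_laurent (I : finType) (cc : I -> C) (d : nat) : #|I| = d ->
  exists a : 'I_d.+1 -> C, forall t, \prod_i br (t + cc i) = \sum_s a s * lterm q s t.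
Proof.
move=> cI; pose p : {poly C} := \prod_i ('X - (q (2 * - cc i))%:P).
have sp : size p = d.+1 by rewrite size_prod_XsubC /index_enum -enumT -cardE cI.
exists (fun s => (\prod_i q (cc i)) * p`_s) => t.
transitivity ((\prod_i q (cc i)) * (q (- (d%:R * t)) * p.[q (2 * t)])).
  rewrite horner_prod -cI (qN Hq) (qMn Hq) -prodr_const -prodfV -!big_split;
    apply: eq_bigr => i _ /=.
  rewrite hornerXsubC; have -> : br (t + cc i) = q (- t + cc i) * (q (2 * t) - q (2 * - cc i)).
    by rewrite -[cc i in LHS]opprK (br_subE Hq) opprK.
  by rewrite (qD Hq) (qN Hq); ring.
rewrite (horner_coef_wide _ (eq_leq sp)) !mulr_sumr; apply: eq_bigr => s _.
by rewrite (lterm_poly Hq); ring.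
Qed.

(** By [pref_last] and [gfacE] the last variable enters each term only through a product of M (n +
    1) brackets. *)
Lemma cf_laurent z X : generic X -> exists a : 'I_(M * n.+1).+1 -> C, forall t,
  generic (update X ord_max t) -> cf z (update X ord_max t) = \sum_s a s * lterm q s t.
Proof.
move=> gX.
have ex (r : {ffun 'I_n.+1 -> 'I_M.+1}) : exists a : 'I_(M * n.+1).+1 -> C, forall t,
    \prod_(p : 'I_n.+1 * 'I_M) br (t + ((gap M (r p.1) p.2)%:~R - X 0 (wd p.1))) =
      \sum_s a s * lterm q s t.
  by apply: prod_br_laurent; rewrite card_prod !card_ord mulnC.
have [al alE] := choice ex.
pose K (r : {ffun 'I_n.+1 -> 'I_M.+1}) := pref (restr X) / \prod_k nd (restr X) (k,
  r k) * ((-1) ^+ M) ^+ n.+1 * vdm (fnodes X r) *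
    \sum_e \sum_(z' | znew z' r == z) c e z' * chq (vec R e) (fnodes X r).
exists (fun s => kap * \sum_r K r * al r s) => t gU; set U := update _ _ _ in gU *.
have rU : restr U = restr X by apply/rowP => k; rewrite !mxE (negbTE (wd_max k)).
transitivity (kap * \sum_r K r * \prod_(p :
  'I_n.+1 * 'I_M) br (t + ((gap M (r p.1) p.2)%:~R - X 0 (wd p.1)))); last first.
  rewrite [RHS](eq_bigr (fun s => kap * \sum_r K r * (al r s * lterm q s t))); last first.
    by move=> s _; rewrite -mulrA mulr_suml; congr (_ * _); apply: eq_bigr => r _; rewrite mulrA.
  rewrite -mulr_sumr exchange_big /=; congr (_ * _); apply: eq_bigr => r _.
  by rewrite alE mulr_sumr.
rewrite /cf -mulrA; congr (_ * _); rewrite mulr_sumr; apply: eq_bigr => r _.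
rewrite (frame_nodes_restr r rU) /K.
set W := \sum_e _.
transitivity (pref U / \prod_k nd U (wd k, r k) * vdm (fnodes X r) * W); first by ring.
rewrite pref_last rU.
have -> : \prod_k gfac br M (r k) (U 0 ord_max - U 0 (wd k)) = ((-1) ^+ M) ^+ n.+1 *
    \prod_(p : 'I_n.+1 * 'I_M) br (t + ((gap M (r p.1) p.2)%:~R - X 0 (wd p.1))).
  rewrite -[in X in _ = X * _](card_ord n.+1) -prodr_const.
  rewrite -(pair_bigA _ (fun (k : 'I_n.+1) (i : 'I_M) =>
    br (t + ((gap M (r k) i)%:~R - X 0 (wd k))))) -big_split.
  apply: eq_bigr => k _ /=; rewrite (gfacE Hq) ?leq_ord//; last by move=> t'; exact: generic_gap.
  congr (_ * _); apply: eq_bigr => i _; rewrite !mxE eqxx (negbTE (wd_max k)); congr br; ring.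
ring.
Qed.

(** Everything depends on differences of the X_j except the characters [chq (vec R e)], which are
    invariant by [ker_sum]. *)
Lemma cf_translate z X (t : C) : generic X -> cf z (X + const_mx t) = cf z X.
Proof.
move=> gX; rewrite /cf.
have dX j k : (X + const_mx t) 0 k - (X + const_mx t) 0 j = X 0 k - X 0 j by rewrite !mxE; ring.
have -> : pref (X + const_mx t) = pref X.
  congr (_ * _); first by apply: eq_bigr => j _; apply: eq_bigr => k _; rewrite dX.
  by apply: eq_bigr => j _; apply: eq_bigr => k _; apply: eq_bigr => l _; rewrite dX.
congr (_ * _); apply: eq_bigr => r _.
have fE : fnodes (X + const_mx t) r = fnodes X r + const_mx t.
  by apply/rowP => k; rewrite !mxE /node !mxE /=; ring.
rewrite fE; congr (_ / _ * _).
- by apply: eq_bigr => j _; apply: eq_bigr => k _; congr br; rewrite !mxE; ring.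
- apply: eq_bigr => k _; apply: eq_bigr => p _; congr br; rewrite /node !mxE; ring.
- apply: eq_bigr => e _; apply: eq_bigr => z' _.
  have [->|cz] := eqVneq (c e z') 0; first by rewrite !mul0r.
  congr (_ * _); rewrite /chq bilDr; congr (q (2 * _)).
  rewrite -[RHS]addr0; congr (_ + _); rewrite /bil.
  rewrite (eq_bigr (fun i => ((e i : nat)%:R - (M * n)%:R / 2) * t)); last by move=> i _;
    rewrite !mxE.
  by rewrite -mulr_suml (ker_sum kc cz) mul0r.
Qed.

End Frame.
End Coefficients.

(** * The induction step *)

Section ExponentialSumsClosure.
Variables (R : realType) (q br : R[i] -> R[i]).
Hypothesis Hq : qexponential q br.
Local Notation C := R[i].
Local Notation Im := (@complex.Im R).
Local Notation chq := (chq q).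

Definition expsum N (f : 'rV[C]_N -> C) : Prop := exists (I : finType) (b : I -> C) (x : I ->
  'rV[C]_N),
  forall X, f X = \sum_i b i * chq (x i) X.

Lemma expsum_ext N (f g : 'rV[C]_N -> C) : f =1 g -> expsum f -> expsum g.
Proof. by move=> fg [I [b [x h]]]; exists I, b, x => X; rewrite -fg. Qed.

Lemma expsum_chq N (b : C) (e : 'rV[C]_N) : expsum (fun X => b * chq e X).
Proof. by exists 'I_1, (fun=> b), (fun=> e) => X; rewrite big_ord1. Qed.

Lemma expsum_sum N (J : Type) (r : seq J) (f : J -> 'rV[C]_N -> C) :
  (forall j, expsum (f j)) -> expsum (fun X => \sum_(j <- r) f j X).
Proof.
move=> h; elim: r => [|j r [I [b [x e]]]].
  by exists 'I_0, (fun=> 0), (fun=> 0) => X; rewrite big_nil big_ord0.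
have [I' [b' [x' e']]] := h j.
exists (I' + I)%type, (fun s => match s with inl i => b' i | inr i => b i end),
  (fun s => match s with inl i => x' i | inr i => x i end) => X.
by rewrite big_cons e e' big_sumType.
Qed.

Lemma expsumZ N a (f : 'rV[C]_N -> C) : expsum f -> expsum (fun X => a * f X).
Proof.
move=> [I [b [x e]]]; exists I, (fun i => a * b i), x => X.
by rewrite e mulr_sumr; apply: eq_bigr => i _; rewrite mulrA.
Qed.

Lemma expsumB N (f g : 'rV[C]_N -> C) : expsum f -> expsum g -> expsum (fun X => f X - g X).
Proof.
move=> hf hg; apply: (@expsum_ext _ (fun X => \sum_(j <- [:: true;
  false]) (if j then f X else -1 * g X))).
  by move=> X; rewrite big_cons big_seq1 mulN1r.
by apply: (@expsum_sum _ _ _ (fun (j : bool) X => if j then f X else -1 * g X)) => -[//|];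
  apply: expsumZ.
Qed.

Lemma expsum_perm N (w : 'S_N) (f : 'rV[C]_N -> C) : expsum f -> expsum (fun X => f (col_perm w X)).
Proof.
move=> [I [b [x e]]]; exists I, b, (fun i => col_perm (w^-1)%g (x i)) => X.
rewrite e; apply: eq_bigr => i _; rewrite /chq -[in RHS](bil_col_perm w).
by rewrite col_permA mulgV col_perm1.
Qed.

Lemma expsum_generic0 N (f : 'rV[C]_N -> C) : expsum f -> (forall X, generic X -> f X = 0) ->
  forall X, f X = 0.
Proof.
move=> [I [b [x e]]] f0 X; rewrite e.
apply: (exp_sum_extend Hq (H := @generic R N) (h0 := \row_i ('i * (- (i.+1)%:R)%:C))).
- exact: generic_real.
- exact: lattice_generic.
- by move=> Y gY; rewrite -e f0.
Qed.

(** Real translations inside the hyperplane separate exponents modulo e_j - e_k, and on the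
    hyperplane the character of a multiple of e_j - e_k is constant; exponents that are not
    separated therefore contribute proportionally at all its points. *)
Lemma expsum_hyperplane0 N (f : 'rV[C]_N -> C) (j k : 'I_N) (s : int) : expsum f -> j != k ->
  (forall X : 'rV[C]_N, X 0 j - X 0 k = s%:~R ->
     (forall i i', Im (X 0 i) = Im (X 0 i') -> i' = i \/ i' = tperm j k i) -> f X = 0) ->
  forall X : 'rV[C]_N, X 0 j - X 0 k = s%:~R -> f X = 0.
Proof.
move=> [I [b [x e]]] jk f0 X Xs; rewrite e.
pose H (X : 'rV[C]_N) := X 0 j - X 0 k = s%:~R /\
  forall i i', Im (X 0 i) = Im (X 0 i') -> i' = i \/ i' = tperm j k i.
pose G (g : 'rV[C]_N) := real_vec g /\ g 0 j = g 0 k.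
(* A point of the hyperplane whose only coincidence of imaginary parts is between j and k. *)
pose h0 : 'rV[C]_N := \row_i (if i == j then 'i * (k%:R)%:C + s%:~R else 'i * ((i : nat)%:R)%:C).
have Imh0 i : Im (h0 0 i) = (if i == j then (k : nat)%:R else (i : nat)%:R).
  rewrite mxE; case: eqP => _; rewrite ?cImD cImM /= mul0r mul1r add0r//.
  by rewrite -(rmorph_int (real_complex R)) /= addr0.
apply: (@character_extension _ _ I (fun i => chq (x i)) (fun i => chqDr Hq (x i)) (fun i Y =>
  q_neq0 Hq _) H G _ b h0 X).
- move=> h g [hs hI] [rg gjk]; split; first by rewrite !mxE gjk -hs; ring.
  by move=> i i'; rewrite !mxE !cImD !rg !addr0; exact: hI.
- by move=> h [hs hI]; rewrite -e f0.
- split; first by rewrite !mxE eqxx eq_sym (negbTE jk); ring.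
  move=> i i'; rewrite !Imh0.
  have [->|ij] := eqVneq i j; have [->|i'j] := eqVneq i' j; rewrite ?tpermL.
  + by left.
  + by move/eqP; rewrite eqr_nat => /eqP/val_inj ->; right.
  + by move/eqP; rewrite eqr_nat => /eqP/val_inj ->; right; rewrite tpermR.
  + by move/eqP; rewrite eqr_nat => /eqP/val_inj ->; left.
- move=> i i' h.
  have hx : x i = x i' + (x i 0 j - x i' 0 j) *: root_vec R j k.
    by apply: (chq_line_eq Hq jk) => Y rY Yjk; apply: h; split.
  have ev (Y : 'rV[C]_N) : Y 0 j - Y 0 k = s%:~R ->
    chq (x i) Y = chq (x i') Y * q (2 * ((x i 0 j - x i' 0 j) * s%:~R)).
    move=> Ys; rewrite {1}hx /chq bilDl bilZl [bil (root_vec _ _ _) _]bilC bil_root_vec Ys.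
    by rewrite mulrDr (qD Hq).
  rewrite !ev//; first by ring.
  by rewrite !mxE eqxx eq_sym (negbTE jk); ring.
Qed.

End ExponentialSumsClosure.

(** * Permutation symmetry of the coefficients, and the new kernel *)

Section Symmetry.
Variables (R : realType) (q br : R[i] -> R[i]).
Hypothesis Hq : qexponential q br.
Local Notation C := R[i].
Local Notation Im := (@complex.Im R).
Local Notation chq := (chq q).
Variable M : nat.

Definition zperm n (u : 'S_n.+1) (z : box n M) : box n M := [ffun i => z (u i)].

Lemma vec_zperm n (u : 'S_n.+1) z : vec R (zperm u z) = col_perm u (vec R z).
Proof. by apply/rowP => i; rewrite !mxE ffunE. Qed.

Lemma zpermM n (u v : 'S_n.+1) z : zperm (u * v)%g z = zperm u (zperm v z).
Proof. by apply/ffunP => i; rewrite !ffunE permM. Qed.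

Lemma zperm1 n z : zperm (1%g : 'S_n.+1) z = z.
Proof. by apply/ffunP => i; rewrite !ffunE perm1. Qed.

Lemma zperm_adm n (u : 'S_n.+1) z : admissible z -> admissible (zperm u z).
Proof.
move=> az h; have := az (fun i => h ((u^-1)%g i)).
have -> : \sum_i h ((u^-1)%g i) * ((z i : nat)%:Z *+ 2 - (M * n)%:Z) =
   \sum_i h i * ((zperm u z i : nat)%:Z *+ 2 - (M * n)%:Z).
  by rewrite (reindex_inj (@perm_inj _ u)); apply: eq_bigr => i _; rewrite permK ffunE.
have dbl (g : 'I_n.+1 -> int) : (\sum_(j < n.+1) \sum_(k < n.+1 | (j < k)%N) `|g j - g k|) *+ 2 =
   \sum_j \sum_(k | k != j) `|g j - g k|.
  rewrite big_offdiag -sumrMnl; apply: eq_bigr => j _; rewrite -sumrMnl; apply: eq_bigr => k _ /=.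
  by rewrite mulr2n [X in _ = _ + X]distrC.
have -> // : \sum_(j < n.+1) \sum_(k < n.+1 | (j < k)%N) `|h ((u^-1)%g j) - h ((u^-1)%g k)| =
   \sum_(j < n.+1) \sum_(k < n.+1 | (j < k)%N) `|h j - h k|.
apply/eqP; rewrite -(eqr_pMn2r (ltn0Sn 1)); apply/eqP; rewrite (dbl (fun i => h ((u^-1)%g i))) dbl.
rewrite [RHS](reindex_inj (@perm_inj _ (u^-1)%g)); apply: eq_bigr => j _.
by rewrite [RHS](reindex_inj (@perm_inj _ (u^-1)%g)); apply: eq_bigl => k;
  rewrite (inj_eq perm_inj).
Qed.

Lemma frame_exponent_inj n (X : 'rV[C]_n.+1) : generic X ->
  injective (fun p : 'S_n.+1 * box n M => col_perm p.1 X + vec R p.2).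
Proof.
have Imn (m : nat) : Im (m%:R : C) = 0 by rewrite -rc_nat.
have Im2 : Im ((M * n)%:R / 2 : C) = 0 by rewrite -!rc_nat -rcV -rcM.
move=> gX [w z] [w' z'] /= e.
have ww : w = w'.
  apply/permP => i; apply: gX => /=.
  have := congr1 (fun v : 'rV[C]_n.+1 => Im (v 0 i)) e; rewrite !mxE !(cImD, cImN) Im2 !Imn.
  by rewrite !(oppr0, addr0).
congr (_, _) => //; apply/ffunP => i; apply: val_inj => /=; apply/eqP.
rewrite -(eqr_nat C); apply/eqP.
have := congr1 (fun v : 'rV[C]_n.+1 => v 0 i) e; rewrite !mxE ww.
by move=> /addrI /addIr.
Qed.

Lemma expsum_pol n (c : box n M -> box n M -> C) Y : expsum q (fun X => pol q c X Y).
Proof.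
apply: expsum_sum => e; apply: expsum_sum => z.
apply: expsum_ext (expsum_chq q (c e z * q (2 * bil (vec R z) Y)) (Y + vec R e)) => X.
rewrite /chq -mulrA -(qD Hq) bilDl [bil Y X]bilC; congr (_ * q _); ring.
Qed.

Lemma expsum_altpol n (c : box n M -> box n M -> C) Y : expsum q (fun X => altpol q c X Y).
Proof.
by apply: expsum_sum => w; apply: expsumZ; apply: (@expsum_perm _ _ _ w (fun X => pol q c X Y));
  exact: expsum_pol.
Qed.

Section Frame.
Variables (n : nat) (c : box n M -> box n M -> C).
Hypothesis kc : BA_kernel q br c.
Implicit Types (X Y : 'rV[C]_n.+2) (u w : 'S_n.+2) (z : box n.+1 M).
Local Notation cf := (cf q br c).
Local Notation tpsi := (tpsi q br c).
Local Notation full := (full q br c).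
Local Notation kap := (kap br M n).
Local Notation pref := (pref br M).

Definition altpsi X Y : C := \sum_(w : 'S_n.+2) (-1) ^+ w * tpsi (col_perm w X) Y.

(** [pref] is alternating, which turns the unsigned sum over frames of [full_frames] into the signed
    one. *)
Lemma altpsi_full X Y : generic X -> (n.+1)`!%:R * altpsi X Y = kap * pref X * full X Y.
Proof.
move=> gX; rewrite (full_frames Hq kc)// mulrCA; congr (_ * _).
rewrite mulr_sumr; apply: eq_bigr => w _; rewrite /tpsi (pref_perm Hq).
have : (-1) ^+ w * (-1) ^+ w = 1 :> C by rewrite -signr_addb addbb.
move: ((-1) ^+ w) (full_frame _ _ _ _ _) (pref X) kap => s f p k s2.
by transitivity (s * s * (k * p * f)); [ring|rewrite s2 mul1r].
Qed.

Lemma tpsi_chq w X Y : tpsi (col_perm w X) Y =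
  \sum_z cf z (col_perm w X) * chq (col_perm w X + vec R z) Y.
Proof.
by rewrite (tpsiE Hq kc); apply: eq_bigr => z _; rewrite /chq bilDl.
Qed.

(** Permuting Y is rewritten as a change of coefficients on the same exponents w X + vec z, so that
    rigidity can compare the result with [altpsi X Y]. *)
Lemma altpsi_permuted u X Y :
  \sum_(w : 'S_n.+2) \sum_z (-1) ^+ w * cf (zperm u z) (col_perm (u * w)%g X) * chq (col_perm w X +
    vec R z) Y =
  (-1) ^+ u * altpsi X (col_perm u Y).
Proof.
rewrite /altpsi (reindex_inj (mulgI (u^-1)%g)) mulr_sumr; apply: eq_bigr => w _ /=.
rewrite tpsi_chq !mulr_sumr [RHS](reindex_inj (h := zperm u)); last first.
  by move=> z z' e; rewrite -[z]zperm1 -[z']zperm1 -(mulVg u) !zpermM e.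
apply: eq_bigr => z _; rewrite mulKVg odd_permM odd_permV signr_addb !mulrA; congr (_ * _).
rewrite /chq -(bil_col_perm u) vec_zperm; congr (q (2 * bil _ _)).
by apply/rowP => i; rewrite !mxE permM permK.
Qed.

Lemma full_zero_perm u (j k : 'I_n.+2) (s : int) X Y : generic X -> (j < k)%N -> (`|s| <= M)%N ->
  Y 0 j - Y 0 k = s%:~R -> full X (col_perm u Y) = 0.
Proof.
move=> gX jk sM e; set j' := (u^-1)%g j; set k' := (u^-1)%g k.
case: (ltngtP j' k') => h.
- by apply: (full_van Hq kc gX h sM); rewrite !mxE !permKV.
- apply: (full_van Hq kc (s := - s) gX h); first by rewrite abszN.
  by rewrite !mxE !permKV -opprB e mulrNz.
- by move/val_inj/perm_inj: h => h; move: jk; rewrite h ltnn.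
Qed.

Lemma altpsi_zero_perm u (j k : 'I_n.+2) (s : int) X Y : generic X -> (j < k)%N -> (`|s| <= M)%N ->
  Y 0 j - Y 0 k = s%:~R -> altpsi X (col_perm u Y) = 0.
Proof.
move=> gX jk sM e; have := altpsi_full (col_perm u Y) gX.
rewrite (full_zero_perm u gX jk sM e) mulr0 => /eqP; rewrite mulf_eq0 pnatr_eq0.
by rewrite -leqn0 leqNgt fact_gt0 /= => /eqP.
Qed.

Lemma altpsi_chq X Y : altpsi X Y =
  \sum_(w : 'S_n.+2) \sum_z (-1) ^+ w * cf z (col_perm w X) * chq (col_perm w X + vec R z) Y.
Proof.
by apply: eq_bigr => w _; rewrite tpsi_chq mulr_sumr; apply: eq_bigr => z _; rewrite mulrA.
Qed.

(** The family of hyperplanes is stable under u, so both families of coefficients come from sums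
    vanishing on it. The combination that is 0 at w = 1 and rho is then 0 throughout by rigidity;
    lam is the ratio of the two values there, the leading coefficient being nonzero at generic X. *)
Lemma cf_perm_scalar u X : generic X -> exists lam : C, forall w z,
  cf (zperm u z) (col_perm (u * w)%g X) = lam * cf z (col_perm w X).
Proof.
move=> gX; set lam := cf (zperm u (zrho n.+1 M)) (col_perm u X) / cf (zrho n.+1 M) X; exists lam.
have l0 : cf (zrho n.+1 M) X != 0.
  rewrite (cf_lead Hq kc)//; apply/prodf_neq0 => j _; apply/prodf_neq0 => k jk;
    apply/prodf_neq0 => l _.
  have -> : l.+1%:R + X 0 k - X 0 j = X 0 k - X 0 j + l.+1%:Z%:~R by rewrite -pmulrn; ring.
  by apply: (br_generic Hq) => //; apply/eqP => e; move: jk; rewrite e ltnn.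
have := @frame_uniqueness R q br Hq n.+1 M X
  (fun w z => (-1) ^+ w * (cf (zperm u z) (col_perm (u * w)%g X) - lam * cf z (col_perm w X))).
move=> U; suff h : forall w z, (-1) ^+ w * (cf (zperm u z) (col_perm (u * w)%g X) - lam * cf z
  (col_perm w X)) = 0.
  by move=> w z; have /eqP := h w z; rewrite mulf_eq0 signr_eq0 /= subr_eq0 => /eqP.
apply: U.
- move=> w z; rewrite mulf_eq0 negb_or => /andP[_ h].
  have [|az] := eqVneq (cf z (col_perm w X)) 0; last exact: (cf_adm kc az).
  move=> e; move: h; rewrite e mulr0 subr0 => /(cf_adm kc)/(zperm_adm (u^-1)%g).
  by rewrite -zpermM mulVg zperm1.
- move=> j k t Y jk tM e.
  transitivity ((-1) ^+ u * altpsi X (col_perm u Y) - lam * altpsi X Y); last first.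
    rewrite (altpsi_zero_perm u gX jk tM e) -[Y in X in _ - X]col_perm1.
    by rewrite (altpsi_zero_perm 1%g gX jk tM e) !mulr0 subrr.
  rewrite -altpsi_permuted altpsi_chq mulr_sumr -sumrB; apply: eq_bigr => w _.
  rewrite mulr_sumr -sumrB; apply: eq_bigr => z _.
  by move: (cf (zperm u z) _) (cf z _) (chq _ _) ((-1) ^+ w) => a1 a2 a3 a4; ring.
- exact: gX.
- by rewrite mulg1 col_perm1 /lam divfK// subrr mulr0.
Qed.

(** At generic X the exponents w X + vec z are distinct, so the identity between the sums is one
    between coefficients. *)
Lemma cf_perm_anti u X : generic X -> (forall Y, full X (col_perm u Y) = (-1) ^+ u * full X Y) ->
  forall w z, cf (zperm u z) (col_perm (u * w)%g X) = cf z (col_perm w X).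
Proof.
move=> gX hu w z.
have f0 : ((n.+1)`!%:R : C) != 0 by rewrite pnatr_eq0 -lt0n fact_gt0.
have a Y : altpsi X (col_perm u Y) = (-1) ^+ u * altpsi X Y.
  apply: (mulfI f0); rewrite altpsi_full// hu mulrCA [RHS]mulrCA altpsi_full//.
have := @exp_sum_coef0 R q br Hq n.+2 (fun=> True) 0 (fun _ _ _ _ => I) I _
  (fun p : 'S_n.+2 * box n.+1 M => (-1) ^+ p.1 * (cf (zperm u p.2) (col_perm (u * p.1)%g X) - cf
    p.2 (col_perm p.1 X)))
  (fun p => col_perm p.1 X + vec R p.2) _ (frame_exponent_inj gX) (w, z).
move=> h; have /eqP : (-1) ^+ w * (cf (zperm u z) (col_perm (u * w)%g X) - cf z (col_perm w X)) = 0.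
  apply: h => Y _; transitivity ((-1) ^+ u * altpsi X (col_perm u Y) - altpsi X Y); last first.
    by rewrite a mulrA -signr_addb addbb mul1r subrr.
  rewrite -altpsi_permuted altpsi_chq -sumrB -(pair_bigA _ (fun w z =>
     (-1) ^+ w * (cf (zperm u z) (col_perm (u * w)%g X) - cf z (col_perm w X)) * chq (col_perm w X
       + vec R z) Y)) /=.
  apply: eq_bigr => w' _; rewrite -sumrB; apply: eq_bigr => z' _.
  by move: (cf (zperm u z') _) (cf z' _) (chq _ _) ((-1) ^+ w') => a1 a2 a3 a4; ring.
by rewrite mulf_eq0 signr_eq0 /= subr_eq0 => /eqP.
Qed.

Lemma cf_inner (i j : 'I_n.+1) X : generic X ->
  forall w z, cf (zperm (tperm (wd i) (wd j)) z) (col_perm (tperm (wd i) (wd j) * w)%g X) =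
    cf z (col_perm w X).
Proof.
move=> gX; apply: cf_perm_anti => // Y.
have [->|ij] := eqVneq i j; first by rewrite tperm1 col_perm1 odd_perm1 mul1r.
rewrite odd_tperm (inj_eq (@wd_inj n)) ij -(_ : tperm i j = true :> bool);
  last by rewrite odd_tperm ij.
apply: (full_anti_inner kc).
- by rewrite mxE tpermD // wd_max.
- by move=> k; rewrite mxE (inj_tperm _ _ _ (@wd_inj n)).
Qed.
End Frame.

(** Beyond two variables, the transposition (i max) is the conjugate a b' a of b' = (i k), whose
    symmetry is visible, by a = (k max). The unknown scalar of a enters twice, and its square acts
    as 1 because a is an involution. *)
Lemma cf_outer n (c : box n M -> box n M -> C) (i : 'I_n.+1) (X : 'rV[C]_n.+2) :
  BA_kernel q br c -> generic X -> forall w z,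
  cf q br c (zperm (tperm (wd i) ord_max) z) (col_perm (tperm (wd i) ord_max * w)%g X) =
    cf q br c z (col_perm w X).
Proof.
case: n c i X => [|n] c i X kc gX.
  have -> : wd i = ord0 by apply: val_inj; rewrite /= (ord1 i).
  apply: cf_perm_anti => // Y; rewrite (full_reflection Hq) odd_tperm.
  by rewrite mulN1r.
have [k ki] : exists k : 'I_n.+2, k != i.
  by have [->|i0] := eqVneq i ord0; [exists ord_max|exists ord0; rewrite eq_sym].
move=> w z; pose a := tperm (wd k) (ord_max : 'I_n.+3); pose b' := tperm (wd i) (wd k).
have wk : wd k != ord_max := wd_max k.
have wi : wd i != ord_max := wd_max i.
have -> : tperm (wd i) ord_max = (a * b' * a)%g.
  rewrite -[X in (X * _ * _)%g](tpermV (wd k) ord_max) -mulgA -/(conjg b' a) tpermJ -/a.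
  by rewrite /a tpermL tpermD // eq_sym.
have [lam lamE] := cf_perm_scalar kc a gX.
have lam2 w' z' : lam * (lam * cf q br c z' (col_perm w' X)) = cf q br c z' (col_perm w' X).
  by rewrite -!lamE mulgA -zpermM tperm2 zperm1 mul1g.
rewrite !zpermM -!mulgA lamE (cf_inner kc)// lamE lam2//.
Qed.

Lemma cf_tperm n (c : box n M -> box n M -> C) (i j : 'I_n.+2) (X : 'rV[C]_n.+2) z :
  BA_kernel q br c -> generic X ->
  cf q br c (zperm (tperm i j) z) (col_perm (tperm i j) X) = cf q br c z X.
Proof.
move=> kc gX; rewrite -[in RHS](col_perm1 X) -[X in col_perm X _](mulg1 (tperm i j)).
case: (ord_wdP i) => [->|[i' ->]]; case: (ord_wdP j) => [->|[j' ->]].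
- by rewrite tperm1 zperm1 mul1g.
- by rewrite tpermC; apply: cf_outer.
- exact: cf_outer.
- exact: (cf_inner kc).
Qed.

(** The [cf] are Laurent polynomials in the last variable, by symmetry in each variable, hence
    jointly, and their expansion is the new kernel. Identities obtained at generic X extend to all X
    because they are between exponential sums in X. *)
Theorem kernel_step n (c : box n M -> box n M -> C) : BA_kernel q br c ->
  exists2 c' : box n.+1 M -> box n.+1 M -> C, BA_kernel q br c' &
    forall X Y, generic X -> kap br M n * pref br M X * full q br c X Y =
      (n.+1)`!%:R * altpol q c' X Y.
Proof.
move=> kc.
have ex (z : box n.+1 M) : exists cz : box n.+1 M -> C, forall X, generic X ->
    cf q br c z X = \sum_e cz e * chq (vec R e) X.
  apply: (@laurent_joint R q br Hq n.+2 (M * n.+1)) => i X gX.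
  have [->|im] := eqVneq i ord_max; first exact: (cf_laurent Hq c z gX).
  have [a aE] := cf_laurent Hq c (zperm (tperm i ord_max) z) (@generic_perm _ _ (tperm i ord_max) _
    gX).
  exists a => t gU; rewrite -(cf_tperm i ord_max z kc gU).
  have e : col_perm (tperm i ord_max) (update X i t) =
    update (col_perm (tperm i ord_max) X) ord_max t.
    apply/rowP => j; rewrite !mxE; case: tpermP => [->|->|/eqP ji /eqP jm].
    - by rewrite [ord_max == i]eq_sym.
    - by rewrite !eqxx.
    - by rewrite (negbTE ji) (negbTE jm).
  by rewrite e aE -?e//; apply: generic_perm.
have [c0 c0E] := choice ex.
pose c' e z := c0 z e; exists c'.
  have tE X Y : generic X -> tpsi q br c X Y = pol q c' X Y.
    move=> gX; rewrite (tpsiE Hq kc) /pol exchange_big; apply: eq_bigr => z _ /=.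
    rewrite c0E// mulr_suml; apply: eq_bigr => e _.
    by rewrite -mulrA /chq -(qD Hq); congr (_ * q _); ring.
  have aE X Y : generic X -> altpsi c X Y = altpol q c' X Y.
    by move=> gX; apply: eq_bigr => w _; rewrite tE//; apply: generic_perm.
  have c'0 (P : box n.+1 M -> C) : (forall X, generic X -> \sum_e P e * chq (vec R e) X = 0) ->
    forall e, P e = 0.
    move=> h; apply: (@exp_sum_coef0 R q br Hq n.+2 (@generic R n.+2) _ (@generic_real R n.+2)
      (@lattice_generic R n.+2) _ P (@vec R n.+1 M) h).
    exact: (@lvec_inj R n.+2 (M * n.+1)).
  have adm e z : c' e z != 0 -> admissible z.
    move=> h; have [//|na] := pselect (admissible z); case/eqP: h; move: e.
    apply: (c'0 (c'^~ z)) => X gX; rewrite -c0E//; apply/eqP/negPn/negP => h; apply: na;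
      exact: (cf_adm kc h).
  have equiv1 i j X Y : pol q c' (col_perm (tperm i j) X) (col_perm (tperm i j) Y) = pol q c' X Y.
    set t := tperm i j; apply/eqP; rewrite -subr_eq0; apply/eqP; move: X.
    apply: (expsum_generic0 Hq (f := fun X => pol q c' (col_perm t X) (col_perm t Y) - pol q c' X
      Y)).
      apply: expsumB; last exact: expsum_pol.
      by apply: (@expsum_perm _ _ _ t (fun X => pol q c' X (col_perm t Y))); exact: expsum_pol.
    move=> X gX; have gt := @generic_perm _ _ t _ gX; rewrite -!tE//; apply/eqP; rewrite subr_eq0;
      apply/eqP.
    rewrite !(tpsiE Hq kc) (reindex_inj (h := zperm t)); last first.
      by move=> z z' e; rewrite -[z]zperm1 -[z']zperm1 -(mulVg t) !zpermM e.
    by apply: eq_bigr => z _; rewrite cf_tperm// vec_zperm !bil_col_perm.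
  have equiv w X Y : pol q c' (col_perm w X) (col_perm w Y) = pol q c' X Y.
    have [ts -> _] := prod_tpermP w; elim: ts X Y => [|t ts IH] X Y;
      first by rewrite big_nil !col_perm1.
    by rewrite big_cons -!col_permA equiv1 IH.
  have vanY (j k : 'I_n.+2) (s : int) (X Y : 'rV[C]_n.+2) : (j < k)%N -> (`|s| <= M)%N ->
      Y 0 j - Y 0 k = s%:~R -> altpol q c' X Y = 0.
    move=> jk sM e; move: X; apply: (expsum_generic0 Hq (expsum_altpol c' Y)) => X gX.
    by rewrite -aE// -[Y]col_perm1; apply: (altpsi_zero_perm kc 1%g gX jk sM e).
  split.
  - exact: adm.
  - exact: equiv.
  - exact: vanY.
  (* It is enough to treat points of the hyperplane X_j - X_k = s without further coincidences;
     there the signed coefficients form a family to which [frame_vanishing] applies. *)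
  - move=> j k s X Y jk sM Xs; move: X Xs; apply:
    (expsum_hyperplane0 Hq (expsum_altpol c' Y) jk) => X Xs hI.
    pose d (w : 'S_n.+2) z := (-1) ^+ w * \sum_e c' e z * chq (vec R e) (col_perm w X).
    have eqa (Y' : 'rV[C]_n.+2) : \sum_(w : 'S_n.+2) \sum_(z :
      box n.+1 M) d w z * chq (col_perm w X + vec R z) Y' = altpol q c' X Y'.
      apply: eq_bigr => w _; rewrite /pol exchange_big mulr_sumr; apply: eq_bigr => z _ /=.
      rewrite -mulrA mulr_suml; congr (_ * _); apply: eq_bigr => e _.
      by rewrite -mulrA /chq -(qD Hq); congr (_ * q _); rewrite bilDl; ring.
    have d_adm w z : d w z != 0 -> admissible z.
      rewrite mulf_eq0 negb_or => /andP[_ h].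
      have [e he|no] := pickP (fun e => c' e z != 0); first exact: (adm e).
      by case/eqP: h; apply: big1 => e _; have := no e; move/negbFE/eqP => ->; rewrite mul0r.
    have d_van (j' k' : 'I_n.+2) (t : int) (Y' : 'rV[C]_n.+2) : (j' < k')%N -> (`|t| <= M)%N ->
      Y' 0 j' - Y' 0 k' = t%:~R ->
        \sum_(w : 'S_n.+2) \sum_(z : box n.+1 M) d w z * chq (col_perm w X + vec R z) Y' = 0.
      by move=> jk' tM e; rewrite eqa; apply: vanY jk' tM e.
    by rewrite -eqa; exact: (frame_vanishing Hq d_adm d_van jk Xs sM hI).
  - by move=> X gX; rewrite -(cf_lead Hq kc gX) c0E.
  (* The expansions of [cf] at X and at X + t agree by [cf_translate]; comparing coefficients gives
     q^(2 S t) = 1 for all real t, hence S = 0. *)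
  - move=> e z cez; set S := \sum_i _.
    have hS (t : R) : q (2 * (S * t%:C)) = 1.
      have := c'0 (fun e => c' e z * (q (2 * ((\sum_i ((e i :
        nat)%:R - (M * n.+1)%:R / 2)) * t%:C)) - 1)).
      move=> h; suff /h/(_ e)/eqP : forall X : 'rV[C]_n.+2, generic X -> \sum_e0 c' e0 z *
          (q (2 * ((\sum_i ((e0 i : nat)%:R - (M * n.+1)%:R / 2)) * t%:C)) - 1) * chq (vec R e0) X
            = 0.
        by rewrite mulf_eq0 (negbTE cez) subr_eq0 => /eqP.
      move=> X gX; have gXt : generic (X + const_mx t%:C).
        by apply: generic_real => // j; rewrite mxE.
      transitivity (cf q br c z (X + const_mx t%:C) - cf q br c z X); last first.
        by rewrite (cf_translate kc)// subrr.
      rewrite !c0E// -sumrB; apply: eq_bigr => e' _; rewrite (chqDr Hq).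
      have -> : chq (vec R e') (const_mx t%:C) = q (2 * ((\sum_i ((e' i :
        nat)%:R - (M * n.+1)%:R / 2)) * t%:C)).
        by rewrite /chq /bil mulr_suml; congr (q (2 * _)); apply: eq_bigr => j _; rewrite !mxE.
      by rewrite /c'; ring.
    have : 2 * S = 0 by apply: (q_scale Hq) => t; rewrite -mulrA hS.
    by move/eqP; rewrite mulf_eq0 pnatr_eq0 /= => /eqP.
move=> X Y gX; rewrite -(altpsi_full kc)//; congr (_ * _).
apply: eq_bigr => w _; congr (_ * _).
rewrite (tpsiE Hq kc) /pol exchange_big; apply: eq_bigr => z _ /=.
rewrite c0E; last exact: generic_perm.
rewrite mulr_suml; apply: eq_bigr => e _.
by rewrite -mulrA /chq -(qD Hq); congr (_ * q _); ring.
Qed.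

Lemma box0_val (z : box 0 M) i : (z i : nat) = 0%N.
Proof. by apply/eqP; rewrite -leqn0 (leq_trans (leq_ord _))// muln0. Qed.

Lemma box0_zrho (z : box 0 M) : z = zrho 0 M.
Proof. by apply/ffunP => i; apply: val_inj => /=; rewrite (box0_val z) (box0_val (zrho 0 M)). Qed.

Lemma vec_box0 (z : box 0 M) : vec R z = 0.
Proof. by apply/rowP => i; rewrite !mxE box0_val muln0 mul0r subr0. Qed.

Lemma kernel_base : BA_kernel q br (fun _ _ : box 0 M => 1).
Proof.
split.
- by move=> _ z _ h; rewrite !big_ord1 box0_val muln0 subrr mulr0 big_pred0 ?mulr0// => k;
  rewrite (ord1 k).
- by move=> w X Y; congr pol; apply/rowP => i; rewrite !mxE !(ord1 (w i)) !(ord1 i).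
- by move=> j k s X Y; rewrite (ord1 j) (ord1 k).
- by move=> j k s X Y; rewrite (ord1 j) (ord1 k) eqxx.
- move=> X _; rewrite [RHS]big_ord1 [RHS]big_pred0; last by move=> k; rewrite (ord1 k).
  rewrite (big_pred1 (zrho 0 M)); last by move=> z; rewrite (box0_zrho z) /= eqxx.
  by rewrite mul1r /chq vec_box0 /bil big_ord1 mxE mul0r mulr0 (q0 Hq).
- by move=> e _ _; rewrite big_ord1 box0_val muln0 mul0r subrr.
Qed.

End Symmetry.

(** * The integral over the nodes *)

Section HyperbolicFactors.
Variables (R : realType) (a : R).
Hypothesis a0 : 0 < a.
Hypothesis hq : forall k : nat, (0 < k)%N -> ~~ k.-unity_root (qpow a 1).
Local Notation C := R[i].
Local Notation q := (qpow a).
Local Notation br := (qnum a).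
Let Hq := qpow_exponential a0 hq.

Lemma qpow_ii (t : C) : q ('i * t) = expC ((pi / a)%:C * t).
Proof.
rewrite /qpow; congr expC; transitivity (- ('i * 'i) * ((pi / a)%:C * t) : C); first by ring.
by rewrite ii_m1 opprK mul1r.
Qed.

Lemma sinhC_qnum (t : C) : 2 * sinhC ((pi / a)%:C * t) = br ('i * t).
Proof.
have n2 : (2 : C) != 0 by rewrite pnatr_eq0.
by rewrite /sinhC [LHS]mulrC divfK// (brE Hq) -[- ('i * t)]mulrN !qpow_ii mulrN.
Qed.

Lemma coshC_qpow (t : C) : 2 * coshC ((pi / a)%:C * t) = q ('i * t) + q (- ('i * t)).
Proof.
have n2 : (2 : C) != 0 by rewrite pnatr_eq0.
by rewrite /coshC [LHS]mulrC divfK// -[- ('i * t)]mulrN !qpow_ii mulrN.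
Qed.

Lemma imulE n (x : 'rV[R]_n) j : imul x 0 j = 'i * (x 0 j)%:C.
Proof. by rewrite mxE. Qed.

Lemma imul_sub n (x : 'rV[R]_n) j k : imul x 0 j - imul x 0 k = 'i * (x 0 j - x 0 k)%:C.
Proof. by rewrite !mxE rcB mulrBr. Qed.

Lemma imul_generic n (x : 'rV[R]_n) : (forall j k : 'I_n, (j < k)%N -> x 0 j != x 0 k) ->
  generic (imul x).
Proof.
move=> hx j k /=; rewrite !imulE !cImM /= !mul0r !add0r !mul1r => e; apply: val_inj => /=.
by case: (ltngtP j k) => // h; have := hx _ _ h; rewrite e eqxx.
Qed.

Variable M : nat.

(** Induction on M, splitting off the two outermost factors M and -M, the second with a change of
    sign. *)
Lemma sinh_prodE t : sinh_prod a M.+1 t =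
  (-1) ^+ M * br ('i * t%:C) * \prod_(l < M) (br ('i * t%:C + l.+1%:R) * br (- ('i * t%:C) +
    l.+1%:R)).
Proof.
transitivity (\prod_(k < M.*2.+1) br ('i * t%:C + (M%:R - k%:R))).
  rewrite /sinh_prod doubleS; apply: eq_bigr => k _; rewrite sinhC_qnum; congr br.
  transitivity ('i * t%:C + ('i * 'i) * (k%:R - (M.+1%:R - 1)) : C); first by ring.
  by rewrite ii_m1 -natr1; ring.
elim: M => [|m IH].
  by rewrite big_ord_recl !big_ord0 !mulr1 mul1r subrr addr0.
rewrite doubleS big_ord_recl big_ord_recr /=.
rewrite (eq_bigr (fun k : 'I_m.*2.+1 => br ('i * t%:C + (m%:R - k%:R)))); last first.
  by move=> k _; congr br; rewrite /bump /= add1n -!natr1; ring.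
rewrite IH exprS subr0.
have -> : br ('i * t%:C + (m.+1%:R - (bump 0 m.*2.+1)%:R)) = - br (- ('i * t%:C) + m.+1%:R).
  by rewrite -(brN Hq); congr br; rewrite /bump add1n -!natr1 -addnn natrD; ring.
rewrite big_ord_recr /=.
move: (\prod_(i < m) _) ((-1) ^+ m) => p s.
by move: (br ('i * t%:C)) (br ('i * t%:C + m.+1%:R)) (br _) => b1 b2 b3; ring.
Qed.

Lemma sinh_prod_neq0 t : t != 0 -> sinh_prod a M.+1 t != 0.
Proof.
move=> t0; have Im1 (s : C) (l : nat) : complex.Im (s + l%:R) =
  complex.Im s by rewrite -rc_nat cImD /= addr0.
have It : complex.Im ('i * t%:C) = t by rewrite cImM /=; ring.
rewrite sinh_prodE !mulf_neq0 ?expf_neq0 ?oppr_eq0 ?oner_eq0//.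
  by apply: (br_Im Hq); rewrite It.
by apply/prodf_neq0 => l _; rewrite mulf_neq0//; apply: (br_Im Hq); rewrite Im1 ?cImN It// oppr_eq0.
Qed.

Lemma prod_sinh_prodE n (x : 'rV[R]_n.+1) :
  \prod_(j < n.+1) \prod_(k < n.+1 | (j < k)%N) sinh_prod a M.+1 (x 0 k - x 0 j) =
  (\prod_(j < n.+1) \prod_(k < n.+1 | (j < k)%N) (-1) ^+ M) * pref br M (imul x).
Proof.
rewrite /pref /vdm /symp big_offdiag -!big_split; apply: eq_bigr => j _ /=.
rewrite -!big_split; apply: eq_bigr => k _ /=; rewrite sinh_prodE imul_sub -mulrA;
  congr (_ * (_ * _)).
rewrite -big_split; apply: eq_bigr => l _ /=.
by have -> : imul x 0 j - imul x 0 k = - ('i * (x 0 k - x 0 j)%:C) by rewrite imul_sub -opprB rcN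
  mulrN.
Qed.

Lemma WE n (z : 'rV[R]_n.+1) : W a M.+1 z = vdm br (imul z) *
  \prod_(j < n.+1) \prod_(k < n.+1 | (j < k)%N) sinh_prod a M.+1 (z 0 k - z 0 j).
Proof.
rewrite /W /vdm -big_split; apply: eq_bigr => j _ /=; rewrite -big_split; apply: eq_bigr => k _ /=.
by rewrite rcM sinhC_qnum imul_sub.
Qed.

Lemma cosh_prodE n n' (x : 'rV[R]_n.+1) (z : 'rV[R]_n') : cosh_prod a M.+1 x z =
  \prod_k \prod_(p : 'I_n.+1 * 'I_M.+1) (q (node (imul x) p - 'i * (z 0 k)%:C) +
    q ('i * (z 0 k)%:C - node (imul x) p)).
Proof.
rewrite /cosh_prod exchange_big; apply: eq_bigr => k _ /=; rewrite pair_bigA;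
  apply: eq_bigr => -[j l] _ /=.
rewrite coshC_qpow /node /= imulE -[in RHS](opprB _ ('i * (z 0 k)%:C)).
have -> : 'i * ((x 0 j - z 0 k)%:C + 'i / 2 * (M.+1%:R - 2 * l%:R - 1)) =
  'i * (x 0 j)%:C + l%:R - M%:R / 2 - 'i * (z 0 k)%:C.
  rewrite rcB; transitivity ('i * ((x 0 j)%:C - (z 0 k)%:C) +
    ('i * 'i) / 2 * (M.+1%:R - 2 * l%:R - 1) : C); first by ring.
  by rewrite ii_m1 -natr1; field.
by [].
Qed.

End HyperbolicFactors.

Section KernelIntegral.
Variables (R : realType) (a : R) (M : nat).
Hypothesis aM : M%:R < a.
Hypothesis hq : forall k : nat, (0 < k)%N -> ~~ k.-unity_root (qpow a 1).
Local Notation C := R[i].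
Local Notation q := (qpow a).
Local Notation br := (qnum a).
Let a0 : 0 < a := le_lt_trans (ler0n _ _) aM.
Let Hq := qpow_exponential a0 hq.
Variables (n : nat) (c : box n M -> box n M -> C).
Hypothesis kc : BA_kernel q br c.
Local Notation idx := ('I_n.+2 * 'I_M.+1)%type.

(** An index collects a permutation from [altpol], a pair of exponents of the kernel and a
    permutation from the Vandermonde expansion. *)
Let T := ('S_n.+1 * (box n M * box n M * 'S_n.+1))%type.
Let f (t : T) k := (M + t.2.2 k + t.2.1.1 k)%N.
Let g (t : T) k := ((n - t.2.2 k) + (n * M - t.2.1.1 k) + M)%N.
Let b (t : T) Y := (-1) ^+ t.1 * (c t.2.1.1 t.2.1.2 * q (2 * bil (vec R t.2.1.2) (col_perm t.1 Y))
  * (-1) ^+ t.2.2).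
Let E (t : T) k (Y : 'rV[C]_n.+1) (P : C) := q (2 * P * Y 0 (t.1 k) +
  ((f t k)%:R - (g t k)%:R) * P).

(** By [ker_equiv] the permutation is moved from P to Y; every term is then a product of functions
    of the single entries of P. *)
Let expand P Y : vdm br P * altpol q c P Y = \sum_t b t Y * \prod_k E t k Y (P 0 k).
Proof.
transitivity (vdm br P * \sum_(w : 'S_n.+1) (-1) ^+ w * pol q c P (col_perm w Y)).
  congr (_ * _); rewrite /altpol (reindex_inj invg_inj); apply: eq_bigr => w _ /=.
  by rewrite odd_permV -[in RHS](ker_equiv kc (w^-1)%g) col_permA mulVg col_perm1.
rewrite mulr_sumr -(pair_bigA _ (fun w u => b (w, u) Y * \prod_k E (w, u) k Y (P 0 k))) /=.
apply: eq_bigr => w _; rewrite mulrCA (vdm_pol_expand Hq) pair_bigA mulr_sumr.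
rewrite -(pair_bigA _ (fun u s => b (w, (u, s)) Y * \prod_k E (w, (u, s)) k Y (P 0 k))) /=.
apply: eq_bigr => u _; rewrite mulrA mulr_sumr; apply: eq_bigr => s _ /=.
rewrite mulrA /b /= -!mulrA; congr (_ * (_ * (_ * (_ * _)))).
congr (_ * _); apply: eq_bigr => k _; by rewrite /E mxE.
Qed.

(** By [ker_sum] the entries of e add up to M n (n + 1)/2. Hence the signs (-1)^f of the
    one-dimensional integrals multiply to the same sign in every term. *)
Let f_sum t Y : b t Y != 0 -> (\sum_k f t k = n.+1 * M + 'C(n.+1, 2) + M * 'C(n.+1, 2))%N.
Proof.
case: t => w [[e z] s] /=; rewrite /b /= !mulf_eq0 !negb_or => /andP[_ /andP[/andP[h _] _]].
rewrite /f /= !big_split /= sum_nat_const card_ord; congr (_ + _ + _)%N.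
  by rewrite -triangular_sum big_mkord [RHS](reindex_inj (@perm_inj _ s)).
apply/eqP; rewrite -(@eqn_pmul2r 2)// -mulnA.
have -> : ('C(n.+1, 2) * 2 = n.+1 * n)%N by have := bin_ffact n.+1 2;
  rewrite !factS fact0 muln1 => ->; rewrite !ffactnS ffactn0 muln1.
rewrite -(eqr_nat C) !natrM natr_sum.
have := ker_sum kc h; rewrite sumrB sumr_const card_ord => /eqP; rewrite subr_eq0 => /eqP ->.
by rewrite -mulr_natr natrM -natr1; apply/eqP; field.
Qed.

Let den (x : 'rV[R]_n.+2) (u : R) := \prod_(p :
  idx) (q (node (imul x) p - 'i * u%:C) + q ('i * u%:C - node (imul x) p)).

Lemma integral_kernel (b0 : C) (x : 'rV[R]_n.+2) (y : 'rV[R]_n.+1) : generic (imul x) ->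
  (forall k, y 0 k != 0) ->
  integralC (fun z => b0 * (vdm br (imul z) * altpol q c (imul z) (imul y) / cosh_prod a M.+1 x z))
    =
  b0 * ((-1) ^+ (n.+1 * M + 'C(n.+1, 2) + M * 'C(n.+1, 2)) *
  (\prod_k ('i * a%:C / (expR (pi * y 0 k) - expR (- (pi * y 0 k)))%:C)) *
  \sum_(p : {ffun 'I_n.+1 -> idx}) vdm br (nodes (imul x) p) * altpol q c (nodes (imul x) p) (imul
    y) / \prod_k nd br (imul x) (p k)).
Proof.
move=> gx y0; pose X := imul x; pose Y := imul y.
pose h (t : T) k (u : R) := q (2 * ('i * u%:C) * ('i * (y 0 (t.1 k))%:C) +
  ((f t k)%:R - (g t k)%:R) * ('i * u%:C)) / den x u.
(* Here the hypothesis a > M places the nodes, of real part r - M/2, in the strip where the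
   one-dimensional integral has been evaluated. *)
have nodeRe (p : idx) : `|complex.Re (node X p)| < a / 2.
  have -> : complex.Re (node X p) = (p.2 : nat)%:R - M%:R / 2.
    rewrite /node imulE -!rc_nat -rcV -rcM !(cReD, cReN, cReM) /=; ring.
  have := leq_ord p.2; rewrite -(ler_nat R) => h1; have h2 := ler0n R p.2.
  rewrite ltr_norml; move: aM; lra.
have cI t k : #|{: idx}| = (f t k + g t k + 2)%N.
  rewrite card_prod !card_ord /f /g; have := leq_ord (t.2.1.1 k); have := leq_ord (t.2.2 k); nia.
have hint t k : integrableC (@lebesgue_measure R) (h t k).
  exact: (integrable_basic a0 hq (y 0 (t.1 k)) (node_inj Hq gx) nodeRe (cI t k)).
transitivity (integralC (fun z : 'rV[R]_n.+1 => \sum_t (b0 * b t Y) * \prod_k h t k (z 0 k))).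
  congr integralC; apply/funext => z; rewrite expand mulr_suml mulr_sumr cosh_prodE;
    apply: eq_bigr => t _.
  rewrite -[RHS]mulrA -[X in _ * X = _]mulrA; congr (_ * (_ * _)); rewrite -prodfV -big_split;
    apply: eq_bigr => k _ /=.
  by rewrite /h /den /E !imulE.
rewrite (integralC_sum_prod _ hint).
have -> : \sum_(p : {ffun 'I_n.+1 -> idx}) vdm br (nodes X p) * altpol q c (nodes X p) Y / \prod_k
  nd br X (p k) =
    \sum_t b t Y * \prod_k \sum_(p : idx) E t k Y (node X p) / nd br X p.
  under eq_bigr => p _ do rewrite expand mulr_suml.
  rewrite exchange_big; apply: eq_bigr => t _ /=; rewrite bigA_distr_bigA /= mulr_sumr;
    apply: eq_bigr => p _.
  by rewrite -mulrA -prodfV -big_split; congr (_ * _); apply: eq_bigr => k _; rewrite mxE.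
rewrite mulr_sumr mulr_sumr; apply: eq_bigr => t _; rewrite -mulrA; congr (_ * _).
have [->|bt] := eqVneq (b t Y) 0; first by rewrite !mul0r mulr0.
rewrite [RHS]mulrCA; congr (_ * _).
transitivity (\prod_k (('i * a%:C / (expR (pi * y 0 (t.1 k)) - expR (- (pi * y 0 (t.1 k))))%:C) *
  (-1) ^+ f t k *
   \sum_(p : idx) E t k Y (node X p) / nd br X p)).
  apply: eq_bigr => k _; rewrite (intC_basic a0 hq (node_inj Hq gx) nodeRe (y0 _) (cI t k)).
  by congr (_ * _); apply: eq_bigr => p _; rewrite /E imulE.
rewrite -(f_sum bt) -prodrXr [X in _ = _ * X * _](reindex_inj (@perm_inj _ t.1)) -!big_split.
by apply: eq_bigr => k _ /=; rewrite [X in X * _ = _]mulrC.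
Qed.

End KernelIntegral.

(** Bookkeeping of the constants in one step: s is [sin_prod], and U, U + n stand for the binomials
    C(n, 2), C(n+1, 2). On the left are the prefactor of the recursion, the previous constant and
    the factors of the integral; on the right, the new constant, [kap] and the sign from the
    [sinh_prod]. *)
Lemma constant_step (F : fieldType) (i s a : F) (M n U : nat) : i * i = -1 -> s != 0 -> a != 0 ->
  s / a * ((i ^+ M.+1) ^+ (U + n) * (a / s) ^+ U) *
    ((-1) ^+ (n.+1 * M + (U + n) + M * (U + n)) * (i * a) ^+ n.+1) =
  (i ^+ M.+1) ^+ (U + n + n.+1) * (a / s) ^+ (U + n) *
    (((- i) ^+ M * s) ^+ n.+1 * (-1) ^+ (U + n)) * (-1) ^+ (M * (U + n + n.+1)).
Proof.
move=> ii s0 a0.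
have sq k : (-1) ^+ k * (-1) ^+ k = 1 :> F by rewrite -exprMn mulrN1 opprK expr1n.
have e1 : (i ^+ M.+1) ^+ n.+1 * ((- i) ^+ M * s) ^+ n.+1 = i ^+ n.+1 * s ^+ n.+1.
  rewrite -!exprMn; congr (_ ^+ _); rewrite (exprNn i) exprS.
  transitivity (i * (((i * i) ^+ M * (-1) ^+ M)) * s); first by rewrite exprMn; ring.
  by rewrite ii sq mulr1.
have e2 : s / a * a ^+ n.+1 = (a / s) ^+ n * s ^+ n.+1.
  rewrite expr_div_n [a ^+ _]exprS [s ^+ n.+1]exprS; field; rewrite ?expf_neq0 ?s0 ?a0//.
rewrite (exprD (i ^+ _) (U + n)) (exprD (a / s)) (exprMn n.+1 i a) (mulnDr M (U +
  n)%N) [(M * n.+1)%N]mulnC.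
rewrite [(n.+1 * M + (U + n) + _)%N]addnAC [in RHS](addnC (M * _)%N) (exprD (-1) (n.+1 * M + _)%N).
move: ((-1) ^+ (n.+1 * M + M * (U + n))) ((-1) ^+ (U + n)) => v1 v2.
set w := (i ^+ _) ^+ (U + n); set x := (a / s) ^+ U.
transitivity (w * x * (s / a * a ^+ n.+1) * i ^+ n.+1 * v1 * v2); first by ring.
rewrite e2 -!mulrA; transitivity (w * x * (a / s) ^+ n * (i ^+ n.+1 * s ^+ n.+1) * v1 * v2);
  first by ring.
by rewrite -e1; ring.
Qed.

Lemma prod_pairs_const (V : comNzRingType) n (v : V) :
  \prod_(j < n) \prod_(k < n | (j < k)%N) v = v ^+ 'C(n, 2).
Proof.
rewrite (exchange_big_dep predT)//= -triangular_sum big_mkord -prodrXr; apply: eq_bigr => k _.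
by rewrite prodr_const card_ord_lt.
Qed.

(** * The formula for Phi in terms of a kernel *)

Section PhiFormula.
Variables (R : realType) (a : R) (M : nat).
Hypothesis aM : M%:R < a.
Hypothesis hq : forall k : nat, (0 < k)%N -> ~~ k.-unity_root (qpow a 1).
Local Notation C := R[i].
Local Notation q := (qpow a).
Local Notation br := (qnum a).
Let a0 : 0 < a := le_lt_trans (ler0n _ _) aM.
Let Hq := qpow_exponential a0 hq.
Local Notation s := (sin_prod a M.+1).

(** Factor by factor, [l] = -2 i sin(pi l / a). *)
Lemma qnum_prod : \prod_(l < M) br l.+1%:R = (- 'i) ^+ M * s%:C.
Proof.
rewrite /sin_prod big_add1 /= big_mkord rmorph_prod -[X in _ ^+ X]card_ord -prodr_const -big_split.
apply: eq_bigr => l _ /=; rewrite (brE Hq).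
have qE (r : R) : q r%:C = expC ('i * (- (pi / a * r))%:C).
  by rewrite /qpow rcN rcM; congr expC; ring.
rewrite -rc_nat -rcN !qE; apply: eqReIm.
  rewrite !(cReD, cReN, cReM, cImN, Re_expC, Im_expC, Re_iR, Im_iR) mulrN opprK cosN subrr /=; ring.
rewrite !(cImD, cImN, cImM, cReN, Re_expC, Im_expC, Re_iR, Im_iR) mulrN opprK sinN /= expR0 mulrAC;
  ring.
Qed.

Lemma sin_prod_neq0 : s != 0.
Proof.
have := @kap_neq0 R q br Hq M 0; rewrite /kap mulf_eq0 negb_or => /andP[h _].
by move: h; rewrite expr1 qnum_prod mulf_eq0 negb_or rc_eq0 => /andP[].
Qed.

Definition sinh_pairs n (y : 'rV[R]_n) : C :=
  \prod_(j < n) \prod_(k < n | (j < k)%N) (2 * sinhC ((pi * (y 0 j - y 0 k))%:C)).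

Definition ydiff n (y : 'rV[R]_n.+2) : 'rV[R]_n.+1 := \row_j (y 0 (wd j) - y 0 ord_max).

Lemma sinhC_real (r : R) : 2 * sinhC r%:C = (expR r - expR (- r))%:C.
Proof.
by rewrite /sinhC [LHS]mulrC divfK// -rcN !expC_real rcB.
Qed.

Lemma sinh_pairs_last n (y : 'rV[R]_n.+2) : sinh_pairs y =
  sinh_pairs (ydiff y) * \prod_k (expR (pi * ydiff y 0 k) - expR (- (pi * ydiff y 0 k)))%:C.
Proof.
rewrite {1}/sinh_pairs big_ord_recr /= [X in _ * X]big1 ?mulr1; last first.
  by move=> k; rewrite ltnNge -ltnS ltn_ord.
rewrite -big_split; apply: eq_bigr => j _ /=; rewrite big_mkcond big_ord_recr /= ltn_ord.
congr (_ * _); last by rewrite sinhC_real mxE.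
rewrite [RHS]big_mkcond; apply: eq_bigr => k _; rewrite /= !mxE; case: ifP => // _.
by congr (_ * sinhC (_ * _)%:C); ring.
Qed.

Lemma CconstE n : Cconst a M.+1 n.+1 = ('i ^+ M.+1) ^+ 'C(n.+1, 2) * ((a / s)%:C) ^+ 'C(n, 2).
Proof. by rewrite /Cconst !bin2 subn1 subn2. Qed.

(** In the step, the [sinh_prod] factors of [W] cancel those in the denominator of the induction
    hypothesis. The integrand becomes [vdm] times [altpol] over the cosh product, which
    [integral_kernel] turns into [full] and [kernel_step] into the next kernel. *)
Theorem Phi_kernel n : exists2 c : box n M -> box n M -> C, BA_kernel q br c &
  forall x y : 'rV[R]_n.+1, (forall j k : 'I_n.+1, (j < k)%N -> x 0 j != x 0 k) ->
    (forall j k : 'I_n.+1, (j < k)%N -> y 0 j != y 0 k) ->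
    Phi a M.+1 x y = Cconst a M.+1 n.+1 * altpol q c (imul x) (imul y) /
      (sinh_pairs y * \prod_(j < n.+1) \prod_(k < n.+1 | (j < k)%N) sinh_prod a M.+1 (x 0 k - x 0
        j)).
Proof.
elim: n => [|n [c kc IH]].
  exists (fun _ _ => 1); first exact: kernel_base.
  move=> x y _ _; rewrite CconstE !expr0 mul1r mul1r /sinh_pairs !big_ord1 !big_pred0 ?mulr1
    ?divr1; last 2 first.
  - by move=> k; rewrite (ord1 k).
  - by move=> k; rewrite (ord1 k).
  rewrite /altpol (big_pred1 1%g); last by move=> w; rewrite /= [w](_ : _ = 1%g) ?eqxx//;
    apply/permP => i; rewrite !(ord1 (_ i)).
  rewrite odd_perm1 mul1r col_perm1 /pol (big_pred1 (zrho 0 M)); last by move=> z;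
    rewrite (box0_zrho z) /= eqxx.
  rewrite (big_pred1 (zrho 0 M)); last by move=> z; rewrite (box0_zrho z) /= eqxx.
  rewrite mul1r vec_box0 {2 3}/bil !big_ord1 !mxE !mul0r !addr0 /bil big_ord1 !imulE /= /qpow;
    congr expC.
  rewrite !rcM rc_nat; transitivity (- ('i * 'i) * 'i * (2 * pi%:C * (a^-1)%:C * ((x 0 0)%:C * (y 0
    0)%:C)) : C); last by ring.
  by rewrite ii_m1 opprK mul1r.
have [c' kc' cE] := kernel_step Hq kc; exists c' => // x y hx hy.
pose K := Cconst a M.+1 n.+1; pose y' := ydiff y; pose X := imul x.
have gX : generic X := imul_generic hx.
have y'0 k : y' 0 k != 0 by rewrite mxE subr_eq0; apply: hy => /=.
have y'd (j k : 'I_n.+1) : (j < k)%N -> y' 0 j != y' 0 k.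
  by move=> jk; rewrite !mxE (inj_eq (addIr _)); apply: hy.
set D' := sinh_pairs y'.
(* The induction hypothesis covers distinct z_k only. Where two coincide both sides are 0, through
   [vdm] on the left and [ker_vanX] on the right, so the identity holds at every z. *)
have integrandE (z : 'rV[R]_n.+1) : W a M.+1 z * Phi a M.+1 z y' / cosh_prod a M.+1 x z =
    K / D' * (vdm br (imul z) * altpol q c (imul z) (imul y') / cosh_prod a M.+1 x z).
  have [zd|] := pselect (forall j k : 'I_n.+1, (j < k)%N -> z 0 j != z 0 k).
    rewrite (IH _ _ zd y'd) (WE a0 hq) invfM.
    set S := \prod_(j < n.+1) _; have S0 : S != 0.
      apply/prodf_neq0 => j _; apply/prodf_neq0 => k jk; apply: (sinh_prod_neq0 a0 hq).
      by rewrite subr_eq0 eq_sym zd.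
    rewrite -/K -/D'; move: (vdm _ _) (altpol _ _ _ _) (cosh_prod _ _ _ _) D' => v1 v2 v3 v4.
    by transitivity (S / S * (K / v4 * (v1 * v2 / v3))); [ring|rewrite mulfV// mul1r].
  move=> /existsNP[j /existsNP[k /not_implyP[jk /negP]]]; rewrite negbK => /eqP zjk.
  have jk' : j != k by apply/eqP => e; move: jk; rewrite e ltnn.
  rewrite (ker_vanX kc (j := j) (k := k) (s := 0)) ?imulE ?zjk ?subrr//.
  by rewrite (WE a0 hq) /vdm (bigD1 j)//= (bigD1 k)//= !imulE zjk subrr (br0 Hq) !(mul0r, mulr0).
have e1 : Phi a M.+1 x y = (s / (a * (n.+1)`!%:R))%:C * q (2 * (imul y 0 ord_max * \sum_j X 0 j)) *
    (K / D' * ((-1) ^+ (n.+1 * M + 'C(n.+1, 2) + M * 'C(n.+1, 2)) *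
     \prod_k ('i * a%:C / (expR (pi * y' 0 k) - expR (- (pi * y' 0 k)))%:C) *
     \sum_(p : {ffun 'I_n.+1 -> 'I_n.+2 * 'I_M.+1}) vdm br (nodes X p) * altpol q c (nodes X p)
       (imul y') / \prod_k nd br X (p k))).
  rewrite -(integral_kernel aM hq kc _ gX y'0) /= -/y'; congr (_ * _ * _); last first.
    by congr integralC; apply/funext => z; rewrite integrandE.
  have -> : \sum_j X 0 j = 'i * (\sum_j x 0 j)%:C.
    by rewrite rmorph_sum mulr_sumr; apply: eq_bigr => j _; rewrite imulE.
  rewrite imulE /qpow; congr expC; rewrite !rcM rc_nat.
  move: ((\sum_j x 0 j)%:C) => sx.
  transitivity (- ('i * 'i) * 'i * (2 * pi%:C * (a^-1)%:C * ((y 0 ord_max)%:C * sx)) : C);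
    last by ring.
  by rewrite ii_m1 opprK mul1r.
have Yd : Ydiff (imul y) = imul y'.
  by apply/rowP => k; rewrite !mxE rcB mulrBr.
set Eps := \prod_k (expR (pi * y' 0 k) - expR (- (pi * y' 0 k)))%:C.
have e2 : Phi a M.+1 x y = (s / (a * (n.+1)`!%:R))%:C *
    (K / D' * ((-1) ^+ (n.+1 * M + 'C(n.+1, 2) + M * 'C(n.+1, 2)) * (('i * a%:C) ^+ n.+1 / Eps))) *
    full q br c X (imul y).
  rewrite e1 /full Yd; set S := \sum_(p : {ffun 'I_n.+1 -> 'I_n.+2 * 'I_M.+1}) _.
  rewrite big_split prodr_const card_ord prodfV /= -/Eps.
  clearbody S Eps; move: ((s / _)%:C) ((-1) ^+ _) (('i * _) ^+ _) (q _) (K / D') => v1 v2 v3 v4 v5;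
    ring.
rewrite e2 sinh_pairs_last -/y' -/D' -/Eps (prod_sinh_prodE a0 hq) prod_pairs_const -/X -exprM.
have -> : altpol q c' X (imul y) = kap br M n * pref br M X * full q br c X (imul y) / (n.+1)`!%:R.
  by rewrite cE// mulrC mulKf.
have ac : a%:C != 0 :> C by rewrite rc_eq0 gt_eqF.
have sc : s%:C != 0 :> C by rewrite rc_eq0 sin_prod_neq0.
have := constant_step M n 'C(n, 2) (@ii_m1 R) sc ac.
have -> : ('C(n, 2) + n = 'C(n.+1, 2))%N by rewrite binS bin1 addnC.
have -> : ('C(n.+1, 2) + n.+1 = 'C(n.+2, 2))%N by rewrite [RHS]binS bin1 addnC.
have kE : kap br M n = ((- 'i) ^+ M * s%:C) ^+ n.+1 * (-1) ^+ 'C(n.+1, 2).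
  by rewrite /kap qnum_prod prod_pairs_const.
rewrite -kE /K !CconstE !rcM !rcV !rcM rc_nat.
set K0 := _ * _ ^+ 'C(n, 2); set K1 := _ * _ ^+ 'C(n.+1, 2) => h.
have sq k : (-1) ^+ k * (-1) ^+ k = 1 :> C by rewrite -exprMn mulrN1 opprK expr1n.
move: h (sq (M * 'C(n.+2, 2))%N) (pref_neq0 Hq M gX).
move: ((-1) ^+ (M * 'C(n.+2, 2))) ((-1) ^+ (_ +
  _)) (('i * a%:C) ^+ n.+1) (kap _ _ _) (pref _ _ _) (full _ _ _ _ _) => sg2 sg I k P F h h2 P0.
have sg20 : sg2 != 0 by apply/eqP => e; move: h2; rewrite e mul0r => /esym/eqP; rewrite oner_eq0.
have -> : K1 * (k * P * F / (n.+1)`!%:R) / (D' * Eps * (sg2 * P)) =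
    (K1 * k * sg2) * (P / P) / (sg2 * sg2) * (F / (n.+1)`!%:R / D' / Eps).
  by rewrite !invfM; transitivity (K1 * k * (P / P) * (sg2 / sg2) / sg2 * (F / (n.+1)`!%:R / D' /
    Eps)); [|ring];
    rewrite (mulfV sg20); ring.
rewrite h2 (mulfV P0) -h invr1 !mulr1 !invfM.
ring.
Qed.
End PhiFormula.

(** * Comparison with the Baker-Akhiezer function *)

Section Weights.
Variables n M : nat.
Implicit Types (l : {ffun 'I_n.+1 * 'I_n.+1 -> 'I_M.+1}) (i j k : 'I_n.+1).

Lemma sum_pairs_incidence (V : comNzRingType) (G : 'I_n.+1 -> 'I_n.+1 -> V) (h : 'I_n.+1 -> V) :
  \sum_(j < n.+1) \sum_(k < n.+1 | (j < k)%N) G j k * (h j - h k) =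
  \sum_i h i * (\sum_(k < n.+1 | (i < k)%N) G i k - \sum_(j < n.+1 | (j < i)%N) G j i).
Proof.
transitivity (\sum_(j < n.+1) \sum_(k < n.+1 | (j < k)%N) G j k * h j -
   \sum_(j < n.+1) \sum_(k < n.+1 | (j < k)%N) G j k * h k).
  by rewrite -sumrB; apply: eq_bigr => j _; rewrite -sumrB; apply: eq_bigr => k _; rewrite mulrBr.
rewrite [X in _ - X](exchange_big_dep predT)//= -sumrB; apply: eq_bigr => i _.
by rewrite mulrBr !mulr_sumr; congr (_ - _); apply: eq_bigr => k _; rewrite mulrC.
Qed.

(** Entry i adds M - l over the roots e_i - e_k and l over the roots e_j - e_i: the coordinate of
    the weight, shifted by Mn/2 into the naturals. *)
Definition box_weight l : box n M := [ffun i : 'I_n.+1 =>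
  inord (\sum_(k < n.+1 | i < k) (M - l (i, k)) + \sum_(j < n.+1 | j < i) l (j, i))%N].

Lemma box_weightE l i : (box_weight l i : nat)%:Z *+ 2 - (M * n)%:Z =
  \sum_(k < n.+1 | (i < k)%N) (M%:Z - (l (i, k) : nat)%:Z *+ 2) -
  \sum_(j < n.+1 | (j < i)%N) (M%:Z - (l (j, i) : nat)%:Z *+ 2).
Proof.
rewrite ffunE inordK; last first.
  rewrite ltnS; apply: (@leq_trans ((n - i) * M + i * M)%N);
    last by rewrite -mulnDl subnK ?leq_ord// mulnC.
  apply: leq_add.
    by rewrite -card_ord_gt -sum_nat_const; apply: leq_sum => k _; exact: leq_subr.
  by rewrite -[X in (_ <= X * M)%N]card_ord_lt -sum_nat_const; apply: leq_sum => j _;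
    exact: leq_ord.
have -> : (M * n)%:Z = M%:Z *+ (n - i) + M%:Z *+ i.
  by rewrite -mulrnDr subnK ?leq_ord// -mulr_natr natz PoszM.
rewrite -[in M%:Z *+ (n - i)]card_ord_gt -[in M%:Z *+ i]card_ord_lt -!sumr_const.
rewrite PoszD -!natz !natr_sum mulrnDl -!sumrMnl opprD addrACA -!sumrB -sumrN; congr (_ + _);
  apply: eq_bigr => k _.
  by rewrite natrB ?leq_ord// !natz; ring.
by rewrite !natz; ring.
Qed.

Lemma box_weight_adm l : admissible (box_weight l).
Proof.
move=> h; under eq_bigr => i _ do rewrite box_weightE.
rewrite -sum_pairs_incidence mulr_sumr; apply: ler_sum => j _; rewrite mulr_sumr;
  apply: ler_sum => k _.
apply: le_trans (ler_norm _) _; rewrite normrM ler_wpM2r//.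
have := leq_ord (l (j, k)); move: (nat_of_ord (l (j, k))) => u uM.
by rewrite mulr2n ler_norml; apply/andP; split; lia.
Qed.

Lemma vec_box_weight (R : realType) l : vec R (box_weight l) = BA_weight R l.
Proof.
apply/rowP => i; rewrite mxE /BA_weight summxE.
have -> : (box_weight l i : nat)%:R - (M * n)%:R / 2 =
  ((box_weight l i : nat)%:Z *+ 2 - (M * n)%:Z)%:~R / 2 :> R[i].
  by rewrite rmorphB rmorphMn /= -!pmulrn; field.
rewrite box_weightE rmorphB !rmorph_sum /=.
transitivity (\sum_(j < n.+1) \sum_(k < n.+1 | (j < k)%N) (M%:R / 2 - (l (j, k) : nat)%:R :
  R[i]) * ((j == i)%:R - (k == i)%:R)).
  rewrite sum_pairs_incidence [RHS](bigD1 i)//= eqxx mul1r [X in _ = _ + X]big1 ?addr0; last first.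
    by move=> j /negbTE ->; rewrite mul0r.
  rewrite mulrBl !mulr_suml; congr (_ - _); apply: eq_bigr => k _;
    rewrite rmorphB rmorphMn /= -!pmulrn; by field.
apply: eq_bigr => j _; rewrite summxE; apply: eq_bigr => k _; rewrite !mxE eqxx /=.
by rewrite [i == j]eq_sym [i == k]eq_sym.
Qed.

Lemma vec_zrho (R : realType) : vec R (zrho n M) = rho R n.+1 M.
Proof.
pose l0 : {ffun 'I_n.+1 * 'I_n.+1 -> 'I_M.+1} := [ffun=> ord0].
have -> : zrho n M = box_weight l0.
  apply/ffunP => i; rewrite !ffunE; congr inord; rewrite [X in (_ = _ + X)%N]big1 ?addn0;
    last by move=> j _; rewrite ffunE.
  rewrite mulnC -card_ord_gt -sum_nat_const; apply: eq_bigr => k _; by rewrite ffunE subn0.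
rewrite vec_box_weight /BA_weight /rho scaler_sumr; apply: eq_bigr => j _.
by rewrite scaler_sumr; apply: eq_bigr => k _; rewrite ffunE subr0.
Qed.
End Weights.

Section BakerAkhiezerKernel.
Variables (R : realType) (a : R) (M : nat).
Hypothesis a0 : 0 < a.
Hypothesis hq : forall k : nat, (0 < k)%N -> ~~ k.-unity_root (qpow a 1).
Local Notation C := R[i].
Local Notation q := (qpow a).
Local Notation br := (qnum a).
Let Hq := qpow_exponential a0 hq.
Variables (n : nat) (psi : 'rV[C]_n.+1 -> 'rV[C]_n.+1 -> C).
Hypothesis hpsi : is_Baker_Akhiezer a M psi.

(** For s > 0, Y and its reflection are y + (s/2)(e_j - e_k) and y - (s/2)(e_j - e_k) for a point y
    with y_j = y_k, and quasi-invariance at y identifies the two values. *)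
Lemma psi_reflection (j k : 'I_n.+1) (s : int) (X Y : 'rV[C]_n.+1) : (`|s| <= M)%N ->
  Y 0 j - Y 0 k = s%:~R ->
  psi X (col_perm (tperm j k) Y) = psi X Y.
Proof.
wlog jk : j k s / (j < k)%N.
  move=> h; case: (ltngtP j k) => [jk|kj|/val_inj ->]; first exact: h.
    rewrite tpermC => sM e; apply: (h k j (- s)) => //; first by rewrite abszN.
    by rewrite -opprB e mulrNz.
  by rewrite tperm1 col_perm1.
wlog s0 : s Y / (0 <= s)%R.
  move=> h sM e; case: (lerP 0 s) => s0; first exact: (h s).
  rewrite -(h (- s) (col_perm (tperm j k) Y)) ?col_permA ?tperm2 ?col_perm1 ?abszN//.
    by rewrite oppr_ge0 ltW.
  by rewrite !mxE tpermL tpermR -opprB e mulrNz.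
case: s s0 => // s _ sM e.
case: s sM e => [|s] sM e.
  congr psi; apply/rowP => i; rewrite mxE; case: tpermP => // ->; last by apply/eqP;
    rewrite -subr_eq0 e.
  by apply/esym/eqP; rewrite -subr_eq0 e.
have Yk : Y 0 k = Y 0 j - s.+1%:R by rewrite -[s.+1%:R]/(s.+1%:Z%:~R) -e; ring.
have jk' : (k == j) = false by apply/negbTE/eqP => h; move: jk; rewrite h ltnn.
have rE i : root_vec R j k 0 i = (i == j)%:R - (i == k)%:R by rewrite !mxE eqxx.
pose y := Y - (s.+1%:R / 2) *: root_vec R j k.
have yE i : y 0 i = Y 0 i - s.+1%:R / 2 * ((i == j)%:R - (i == k)%:R) by rewrite !mxE eqxx.
have := @BA_quasi_invariance _ _ _ _ _ hpsi j k s.+1 X y jk.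
rewrite subrK => h; rewrite h //; last first.
  rewrite !yE Yk !eqxx [j == k]eq_sym jk' -[RHS](q0 Hq) mulr1n mulr0n; congr q.
  by field.
congr psi; apply/rowP => i; rewrite [LHS]mxE [RHS]mxE yE [X in _ = _ + X]mxE [X in _ = _ - X]mxE rE.
case: tpermP => [->|->|/eqP/negbTE -> /eqP/negbTE ->].
- by rewrite eqxx [j == k]eq_sym jk' Yk mulr1n mulr0n; field.
- by rewrite eqxx jk' Yk mulr1n mulr0n; field.
- by ring.
Qed.

(** Pairing w with its product by the transposition gives equal values of psi with opposite
    signs. *)
Lemma psi_alternating_zero (j k : 'I_n.+1) (s : int) (X Y : 'rV[C]_n.+1) : j != k ->
  (`|s| <= M)%N ->
  Y 0 j - Y 0 k = s%:~R -> \sum_(w : 'S_n.+1) (-1) ^+ w * psi X (col_perm w Y) = 0.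
Proof.
move=> jk sM e; set S := \sum_w _.
have : S = - S.
  rewrite {1}/S (reindex_inj (mulIg (tperm j k))) -sumrN; apply: eq_bigr => w _ /=.
  rewrite odd_permM odd_tperm jk addbT signrN mulNr; congr (- (_ * _)).
  have -> : (w * tperm j k = tperm ((w^-1)%g j) ((w^-1)%g k) * w)%g.
    by rewrite -tpermJ /conjg invgK mulgA mulgKV.
  by rewrite -col_permA (psi_reflection (s := s))// !mxE !permKV.
by move/eqP; rewrite -subr_eq0 opprK -mulr2n mulrn_eq0 /= => /eqP.
Qed.

(** The coefficients are re-indexed by [box], with value 0 off the support, so as to share the index
    set of the kernels. *)
Lemma psi_expansion : exists A : box n M -> 'rV[C]_n.+1 -> C,
  [/\ forall X Y, psi X Y = \sum_z A z X * q (2 * (bil X Y + bil (vec R z) Y)),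
      forall z X, A z X != 0 -> admissible z &
      forall X, A (zrho n M) X = \prod_(j < n.+1) \prod_(k < n.+1 | (j < k)%N) \prod_(l < M)
         br (l.+1%:R + X 0 k - X 0 j)].
Proof.
have [coef psiE lead] := BA_expansion hpsi.
pose A (z : box n M) X := if vec R z \in BA_support R n.+1 M then coef (vec R z) X else 0.
have vi : injective (@vec R n M) := @lvec_inj R n.+1 (M * n).
have supp nu : nu \in BA_support R n.+1 M -> exists2 z : box n M, admissible z & nu = vec R z.
  rewrite mem_undup => /mapP[l _ ->]; exists (box_weight l); first exact: box_weight_adm.
  by rewrite vec_box_weight.
exists A; split.
- move=> X Y; rewrite psiE mulr_sumr.
  have h (z : box n M) : A z X * q (2 * (bil X Y + bil (vec R z) Y)) =
    \sum_(nu <- BA_support R n.+1 M) (if nu == vec R z then q (2 * bil X Y) * (coef nu X * q (2 *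
      bil nu Y)) else 0).
    rewrite -big_mkcond /= /A; case: ifP => hz.
      rewrite -big_filter; have -> : [seq nu <- BA_support R n.+1 M | nu == vec R z] = [:: vec R z].
        by apply: filter_pred1_uniq; rewrite ?undup_uniq.
      by rewrite big_seq1 mulrDr (qD Hq); ring.
    rewrite mul0r big_seq_cond big1// => nu /andP[nuS /eqP e]; by move: hz; rewrite -e nuS.
  under [RHS]eq_bigr => z _ do rewrite h.
  rewrite [RHS]exchange_big big_seq_cond [RHS]big_seq_cond; apply: eq_bigr => nu;
    rewrite andbT => nuS /=.
  have [z _ e] := supp nu nuS; rewrite (bigD1 z)//= e eqxx big1 ?addr0// => z' /negbTE zz.
  by rewrite (inj_eq vi) eq_sym zz.
- move=> z X; rewrite /A; case: ifP => [h _|]; last by rewrite eqxx.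
  by have [z' az /vi ->] := supp _ h.
- move=> X; rewrite /A vec_zrho lead ifT.
    by apply: eq_bigr => j _; apply: eq_bigr => k _; rewrite big_add1 big_mkord.
  rewrite mem_undup; apply/mapP; exists [ffun=> ord0]; first by rewrite mem_enum.
  rewrite /BA_weight /rho scaler_sumr; apply: eq_bigr => j _.
  by rewrite scaler_sumr; apply: eq_bigr => k _; rewrite ffunE subr0.
Qed.

(** The difference of the two sets of coefficients, permuted and signed over all w, is a frame whose
    sum is the difference of two antisymmetrisations, both 0 on the hyperplanes. It is 0 at w = 1
    and rho because both leading coefficients are prescribed, so rigidity makes it 0 throughout. *)
Theorem psi_pol (c : box n M -> box n M -> C) X Y : BA_kernel q br c -> generic X ->
  psi X Y = pol q c X Y.
Proof.
move=> kc gX; have [A [psiE A_adm A_lead]] := psi_expansion.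
pose B (z : box n M) := \sum_e c e z * chq q (vec R e) X.
have polE Y' : pol q c X Y' = \sum_z B z * q (2 * (bil X Y' + bil (vec R z) Y')).
  rewrite /pol exchange_big; apply: eq_bigr => z _ /=; rewrite mulr_suml; apply: eq_bigr => e _.
  by rewrite -mulrA /chq -(qD Hq); congr (_ * q _); ring.
pose d (w : 'S_n.+1) (z : box n M) := (-1) ^+ w * (A (zperm (w^-1)%g z) X - B (zperm (w^-1)%g z)).
suff d0 : forall w z, d w z = 0.
  rewrite psiE polE; apply: eq_bigr => z _; congr (_ * _).
  by have := d0 1%g z; rewrite /d odd_perm1 mul1r invg1 zperm1 => /eqP; rewrite subr_eq0 => /eqP.
apply: (@frame_uniqueness R q br Hq n M X d) => //.
- move=> w z; rewrite mulf_eq0 signr_eq0 /= => h.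
  suff : admissible (zperm (w^-1)%g z) by move=> /(zperm_adm w); rewrite -zpermM mulgV zperm1.
  move: (zperm _ z) h => z' h; have [Az|] := eqVneq (A z' X) 0; last exact: A_adm.
  move: h; rewrite Az sub0r oppr_eq0 => Bz.
  have [e he|no] := pickP (fun e => c e z' != 0); first exact: (ker_adm kc he).
  by case/eqP: Bz; apply: big1 => e _; have := no e; move/negbFE/eqP => ->; rewrite mul0r.
- move=> j k s Y' jk sM e.
  have jk' : j != k by apply/eqP => h; move: jk; rewrite h ltnn.
  transitivity (\sum_(w : 'S_n.+1) (-1) ^+ w * psi X (col_perm w Y') - altpol q c X Y'); last first.
    by rewrite (psi_alternating_zero X jk' sM e) (ker_vanY kc X jk sM e) subrr.
  rewrite [X in X - _](reindex_inj invg_inj) -sumrB; apply: eq_bigr => w _ /=; rewrite odd_permV.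
  rewrite -[in RHS](ker_equiv kc (w^-1)%g) col_permA mulVg col_perm1 -mulrBr psiE polE -sumrB
    mulr_sumr.
  rewrite (reindex_inj (h := zperm w)); last first.
    by move=> z z' h; rewrite -[z]zperm1 -[z']zperm1 -(mulVg w) !zpermM h.
  apply: eq_bigr => z _; rewrite /d -zpermM mulVg zperm1 -mulrBl mulrA; congr (_ * _).
  have -> : col_perm w X + vec R (zperm w z) = col_perm w (X + vec R z).
    by rewrite vec_zperm; apply/rowP => i; rewrite !mxE.
  rewrite /chq -bilDl -(bil_col_perm w (X + vec R z)) col_permA mulgV col_perm1.
  by [].
- by rewrite /d odd_perm1 mul1r invg1 zperm1 A_lead -(ker_lead kc gX) subrr.
Qed.
End BakerAkhiezerKernel.

Theorem theorem3p1 (R : realType) (n m : nat) (a : R)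
    (psi : 'rV[R[i]]_n.+1 -> 'rV[R[i]]_n.+1 -> R[i])
    (hm : (1 <= m)%N)
    (ha : m%:R - 1 < a)
    (hq : forall k : nat, (0 < k)%N -> ~~ k.-unity_root (qpow a 1))
    (hpsi : is_Baker_Akhiezer a (m - 1) psi)
    (x y : 'rV[R]_n.+1)
    (hx : forall j k : 'I_n.+1, (j < k)%N -> x 0 j != x 0 k)
    (hy : forall j k : 'I_n.+1, (j < k)%N -> y 0 j != y 0 k) :
  Phi a m x y =
  Cconst a m n.+1 *
  ((\sum_(s : 'S_n.+1) (-1) ^+ s * psi (imul (col_perm s x)) (imul y)) /
   \prod_(j < n.+1) \prod_(k < n.+1 | (j < k)%N)
     (2 * sinhC ((pi * (y 0 j - y 0 k))%:C) * sinh_prod a m (x 0 k - x 0 j))).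
Proof.
case: m hm ha hpsi => // M _; rewrite -natr1 addrK subSS subn0 => aM hpsi.
have a0 : 0 < a := le_lt_trans (ler0n _ _) aM.
have [c kc ->//] := Phi_kernel aM hq n; rewrite -mulrA; congr (_ * (_ / _)); last first.
  by rewrite /sinh_pairs -big_split; apply: eq_bigr => j _; rewrite -big_split.
apply: eq_bigr => s _; congr (_ * _).
have -> : imul (col_perm s x) = col_perm s (imul x) by apply/rowP => j; rewrite !mxE.
by rewrite (psi_pol a0 hq hpsi _ kc)//; apply: generic_perm; exact: imul_generic.
Qed.
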